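(* Let $\mu>0$, $v>0$, $\tau\in\mathbb{R}\setminus\{0,1,-1\}$, and let $\omega>\frac{v^2}{(\tau^2+1)^2}$. Then the ground state of the action functional $S_\omega$ under the Nehari constraint, i.e. the global minimizer of $S_\omega$ on $\{u\in H^1_\tau\setminus\{0\}: I_\omega(u)=0\}$, is $u_{\widetilde T}$.
   Context: $H^1_\tau:=\{u\in H^1(\mathbb{R}_-)\oplus H^1(\mathbb{R}_+): u(0+)=\tau u(0-)\}$, $\mathbb{R}_-=(-\infty,0)$, $\mathbb{R}_+=(0,+\infty)$, and $\|u'\|_2^2:=\|u'\|_{L^2(\mathbb{R}_-)}^2+\|u'\|_{L^2(\mathbb{R}_+)}^2$, $\|u\|_p=\|u\|_{L^p(\mathbb{R})}$. The action and Nehari functionals are $$S_\omega(u)=\tfrac12\|u'\|_2^2-\tfrac{1}{2\mu+2}\|u\|_{2\mu+2}^{2\mu+2}-\tfrac v2|u(0-)|^2+\tfrac\omega2\|u\|_2^2,$$ $$I_\omega(u)=\|u'\|_2^2-\|u\|_{2\mu+2}^{2\mu+2}-v|u(0-)|^2+\omega\|u\|_2^2 .$$ The soliton is $\phi_\omega(x)=(\omega(\mu+1))^{\frac1{2\mu}}\cosh^{-\frac1\mu}(\mu\sqrt\omega\,x)$. Put $A(\omega)=\frac{v^2}{\omega}\tau^{2\mu}+(\tau^{2\mu+4}-1)(\tau^{2\mu}-1)$ and $$\widetilde T_-(\omega)=\frac{1}{\tau^{2\mu+4}-1}\Big(\frac{v}{\sqrt\omega}-\tau^2\sqrt{A(\omega)}\Big),\qquad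 \widetilde T_+(\omega)=\frac{1}{\tau^{2\mu+4}-1}\Big(\tau^{2\mu+2}\frac{v}{\sqrt\omega}-\sqrt{A(\omega)}\Big).$$ Define $\widetilde x_\pm$ by $\tanh(\mu\sqrt\omega\,\widetilde x_\pm)=\widetilde T_\pm(\omega)$, and set $u_{\widetilde T}(x)=\phi_\omega(x+\widetilde x_-)$ for $x<0$, $u_{\widetilde T}(x)=\phi_\omega(x+\widetilde x_+)$ for $x>0$. The authors remark that it is not restrictive to suppose $\tau>0$. *)

(* Defs.v *)
From mathcomp Require Import all_boot all_order all_algebra complex.
From mathcomp Require Import all_classical all_reals all_analysis.

Set Implicit Arguments.
Unset Strict Implicit.
Unset Printing Implicit Defensive.

Import Order.TTheory GRing.Theory Num.Theory numFieldNormedType.Exports.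
Import ComplexField.Normc.

Local Open Scope classical_set_scope.
Local Open Scope ring_scope.
Local Open Scope complex_scope.

Section FunctionSpaces.
Context {R : realType}.
Implicit Types (I : set R) (u g : R -> R[i]).

Definition Rneg : set R := `]-oo, 0[%classic.
Definition Rpos : set R := `]0, +oo[%classic.

Definition Cintegral I u : R[i] :=
  (\int[lebesgue_measure]_(x in I) complex.Re (u x)) +i*
  (\int[lebesgue_measure]_(x in I) complex.Im (u x)).

(* [normc z : R] is the modulus of [z : R[i]]. *)
Definition L2 I u : Prop :=
  [/\ measurable_fun I (@complex.Re R \o u), measurable_fun I (@complex.Im R \o u) &
      lebesgue_measure.-integrable I (fun x => (normc (u x) ^+ 2)%:E)].

Definition C1c I (phi : R -> R) : Prop :=
  [/\ forall x, derivable phi x 1, continuous (derive1 phi) &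
      exists K : set R,
        [/\ compact K, K `<=` I & forall x, ~ K x -> phi x = 0]].

Definition is_weak_derivative I u g : Prop :=
  forall phi, C1c I phi ->
    Cintegral I (fun x => u x * (derive1 phi x)%:C) =
    - Cintegral I (fun x => g x * (phi x)%:C).

(* An element of H^1(I), I an open interval, is identified with its unique
   representative that is continuous on I.  The values of u outside I are
   irrelevant. *)
Definition H1 I u : Prop :=
  [/\ {in I, continuous (@complex.Re R \o u)}, {in I, continuous (@complex.Im R \o u)}, L2 I u &
      exists2 g, L2 I g & is_weak_derivative I u g].

(* The weak derivative is unique up to a null set; this picks a version of it,
   and is meaningful only when H1 I u holds. *)
Definition weak_derivative I u : R -> R[i] :=
  xget (fun=> 0) [set g | L2 I g /\ is_weak_derivative I u g].

Definition trace_left u : R[i] :=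
  lim ((@complex.Re R \o u) @ (0 : R)^'-) +i* lim ((@complex.Im R \o u) @ (0 : R)^'-).
Definition trace_right u : R[i] :=
  lim ((@complex.Re R \o u) @ (0 : R)^'+) +i* lim ((@complex.Im R \o u) @ (0 : R)^'+).

(* H^1(R_-) (+) H^1(R_+) is realized by functions on R; the value at the single
   point 0 carries no information. *)
Definition H1tau (tau : R) u : Prop :=
  [/\ H1 Rneg u, H1 Rpos u & trace_right u = tau%:C * trace_left u].

(* || u ||_p ^ p *)
Definition normp_pow (p : R) u : R :=
  \int[lebesgue_measure]_x (normc (u x) `^ p).

(* || u' ||_2 ^ 2, without the singular part of u' at 0 *)
Definition norm2_deriv_sq u : R :=
  \int[lebesgue_measure]_(x in Rneg) (normc (weak_derivative Rneg u x) ^+ 2) +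
  \int[lebesgue_measure]_(x in Rpos) (normc (weak_derivative Rpos u x) ^+ 2).

Definition action (mu v omega : R) u : R :=
  1 / 2 * norm2_deriv_sq u
  - 1 / (2 * mu + 2) * normp_pow (2 * mu + 2) u
  - v / 2 * normc (trace_left u) ^+ 2
  + omega / 2 * normp_pow 2 u.

Definition nehari (mu v omega : R) u : R :=
  norm2_deriv_sq u
  - normp_pow (2 * mu + 2) u
  - v * normc (trace_left u) ^+ 2
  + omega * normp_pow 2 u.

Definition nehari_set (mu v tau omega : R) : set (R -> R[i]) :=
  [set u | [/\ H1tau tau u, exists2 x, x != 0 & u x != 0
             & nehari mu v omega u = 0]].

Definition ground_state (mu v tau omega : R) u : Prop :=
  nehari_set mu v tau omega u /\
  forall w, nehari_set mu v tau omega w ->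
    action mu v omega u <= action mu v omega w.

End FunctionSpaces.

Section StationaryState.
Context {R : realType}.
Implicit Types (mu v tau omega x : R).

Definition cosh x : R := (expR x + expR (- x)) / 2.
Definition tanh x : R := (expR x - expR (- x)) / (expR x + expR (- x)).

Definition soliton mu omega x : R :=
  (omega * (mu + 1)) `^ (1 / (2 * mu)) *
  cosh (mu * Num.sqrt omega * x) `^ (- (1 / mu)).

(* The next three expressions are meant for tau > 0; a negative tau enters
   below through its absolute value. *)
Definition A_coef mu v tau omega : R :=
  v ^+ 2 / omega * tau `^ (2 * mu) +
  (tau `^ (2 * mu + 4) - 1) * (tau `^ (2 * mu) - 1).

Definition Ttilde_minus mu v tau omega : R :=
  1 / (tau `^ (2 * mu + 4) - 1) *
  (v / Num.sqrt omega - tau ^+ 2 * Num.sqrt (A_coef mu v tau omega)).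

Definition Ttilde_plus mu v tau omega : R :=
  1 / (tau `^ (2 * mu + 4) - 1) *
  (tau `^ (2 * mu + 2) * (v / Num.sqrt omega)
   - Num.sqrt (A_coef mu v tau omega)).

(* The map u |-> u on R_-, -u on R_+ is a bijection from H^1_tau onto
   H^1_(-tau) that preserves the action and Nehari functionals: this reduces
   tau < 0 to |tau|, and is undone by the factor sgn(tau), which is 1 when
   tau > 0. *)
Definition u_Ttilde mu tau omega (xminus xplus : R) (x : R) : R[i] :=
  if x < 0 then (soliton mu omega (x + xminus))%:C
  else (Num.sg tau * soliton mu omega (x + xplus))%:C.

End StationaryState.

(* Main.v *)
Require Import Defs.
From mathcomp Require Import all_boot all_order all_algebra complex.
From mathcomp Require Import all_classical all_reals all_analysis.
From mathcomp Require Import measurable_realfun ring lra.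

Set Implicit Arguments.
Unset Strict Implicit.
Unset Printing Implicit Defensive.

Import Order.TTheory GRing.Theory Num.Theory numFieldNormedType.Exports.

Local Open Scope classical_set_scope.
Local Open Scope ring_scope.

(** Let k be the square root of omega, and let Psi T be the integral of
    (1 - t^2)^(1/mu) over [T, 1].  For u on a half-line and T0 in ]-1, 1[, let
    T(x) be the parameter for which Psi (T x) / Psi T0 is the fraction of the
    integral of |u|^(2 mu + 2) that lies beyond x.  Completing the square
    |u' + k T u|^2 and applying Young's inequality pointwise to the remainder gives
      k T0 |u(0)|^2 + c Psi(T0)^(mu/(mu+1)) (int |u|^(2 mu + 2))^(1/(mu+1))
        <= int |u'|^2 + omega |u|^2,
    with equality only for translated solitons.  Apply this on both sides of 0 with
    parameters z and T such that z + tau^2 T = v / k: the boundary terms then cancel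
    the point interaction, and z can still be chosen so that Psi z and Psi T are in
    the ratio of the two masses.  On the Nehari set, where the quadratic form equals
    the mass, this bounds the mass below by a multiple of Psi z + Psi T, which on the
    line z + tau^2 T = v / k is minimal exactly at z = - Ttilde_minus,
    T = Ttilde_plus.  The function u_Ttilde attains the bound. *)

(** No minimizing sequence is extracted: the bound is proved for each competitor, and the equality
    case is read off from two nonnegative deficits that must vanish. The parameter T is chosen by
    mass because along a soliton T is a tanh with T' = mu k (1 - T^2) and |u|^2 is a multiple of (1
    - T^2)^(1/mu), so that the mass beyond a point is a multiple of Psi T. Two degeneracies shape
    the estimates. The mass may vanish beyond some point, where the transported T would reach 1; and
    the ratio of the two masses may force z or T below -1, so the half-line bound is extended to
    every parameter at most 1, with Psi constant below -1. The condition on omega says v / k < 1 +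
    tau^2: the line z + tau^2 T = v / k then crosses the region z <= 1, T <= 1 in a segment with
    ends T = 1 and z = 1, along which Psi z and Psi T take every ratio. The second equation for the
    optimal pair, |tau|^(2 mu) (1 - z^2) = 1 - T^2, is at once the vanishing of the derivative of
    Psi z + Psi T along that line and the condition u(0+) = tau u(0-) for the moduli of two soliton
    pieces. *)

Notation leb := lebesgue_measure.
Notation L1 D f := (lebesgue_measure.-integrable D (EFin \o f)).

(** * Real-valued integrable functions *)

Section Integrability.
Context {R : realType}.
Implicit Types (f g h : R -> R) (D E : set (measurableTypeR R)).

Lemma L1D D f g : measurable D -> L1 D f -> L1 D g -> L1 D (fun x => f x + g x).
Proof.
move=> mD fi gi.
have := integrableD mD fi gi; congr (integrable _ _ _).
Qed.

Lemma L1Z D f (k : R) : measurable D -> L1 D f -> L1 D (fun x => k * f x).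
Proof. by move=> mD fi; exact: (integrableZl mD k fi). Qed.

Lemma L1Zr D f (k : R) : measurable D -> L1 D f -> L1 D (fun x => f x * k).
Proof.
move=> mD fi; apply: (eq_integrable mD (fun x => (k * f x)%:E)); last exact: L1Z.
by move=> x _; rewrite /= mulrC.
Qed.

Lemma L1N D f : measurable D -> L1 D f -> L1 D (fun x => - f x).
Proof. by move=> mD fi; exact: (integrableN fi). Qed.

Lemma L1B D f g : measurable D -> L1 D f -> L1 D g -> L1 D (fun x => f x - g x).
Proof. by move=> mD fi gi; apply: L1D => //; exact: L1N. Qed.

Lemma L1_eq D f g : measurable D -> (forall x, D x -> f x = g x) -> L1 D f -> L1 D g.
Proof.
move=> mD fg; apply: eq_integrable => // x /[!inE] Dx /=; by rewrite fg.
Qed.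

Lemma L1_norm D f : measurable D -> L1 D f -> L1 D (fun x => `|f x|).
Proof. by move=> mD fi; have := integrable_norm fi. Qed.

Lemma L1_meas D f : L1 D f -> measurable_fun D f.
Proof. by move=> /integrableP[/measurable_EFinP]. Qed.

Lemma L1_le D f g : measurable D -> measurable_fun D f ->
  (forall x, D x -> `|f x| <= g x) -> L1 D g -> L1 D f.
Proof.
move=> mD mf fg; apply: le_integrable => //; first exact/measurable_EFinP.
by move=> x Dx /=; rewrite lee_fin (le_trans (fg x Dx))// ler_norm.
Qed.

Lemma L1S D E f : measurable E -> measurable D -> D `<=` E -> L1 E f -> L1 D f.
Proof. exact: integrableS. Qed.

Lemma L1_cont f (a b : R) : continuous f -> L1 `[a, b] f.
Proof.
move=> cf; apply: continuous_compact_integrable; first exact: segment_compact.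
exact: continuous_subspaceT.
Qed.

Lemma L1_mul_cont f h (a b : R) : continuous h -> L1 `[a, b] f ->
  L1 `[a, b] (fun x => f x * h x).
Proof.
move=> ch fi.
have := @integrableMl _ _ R (@lebesgue_measure R) `[a, b]%classic (measurable_itv _) (EFin \o f) h fi.
apply.
  by apply: measurable_funS (continuous_measurable_fun ch).
have /compact_bounded[M [_ mrt]] := continuous_compact (continuous_subspaceT ch) (@segment_compact R a b).
by exists M; split; rewrite ?num_real // => ? ? ? ?; exact: mrt.
Qed.

End Integrability.

(** * Primitives of integrable functions *)
Section Primitive.
Context {R : realType}.
Implicit Types (f g F G : R -> R) (a b : R).

Definition is_primitive a b F f :=
  L1 `[a, b] f /\
  (forall y : R, a <= y -> y <= b -> F y = F a + \int[leb]_(t in `[a, y]) f t).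

Lemma L1_sub_itv f a b (x y : R) : L1 `[a, b] f -> a <= x -> y <= b -> L1 `[x, y] f.
Proof.
move=> fi ax yb; apply: L1S fi => //.
by apply: subset_itv; rewrite bnd_simp.
Qed.

Lemma primitive_L1 a b F f (x y : R) : is_primitive a b F f -> a <= x -> y <= b -> L1 `[x, y] f.
Proof. by move=> [fi _]; exact: L1_sub_itv. Qed.

Lemma Rintegral_split f (a b c : R) : a <= b -> b <= c -> L1 `[a, c] f ->
  \int[leb]_(t in `[a, c]) f t = \int[leb]_(t in `[a, b]) f t + \int[leb]_(t in `[b, c]) f t.
Proof.
move=> ab bc fi.
have := @Rintegral_itvB R f (BLeft a) (BRight c) b fi.
rewrite !bnd_simp => /(_ ab bc); rewrite Rintegral_itv_obnd_cbnd; last first.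
  by apply: L1S fi => //; apply: subset_itvr; rewrite bnd_simp.
by move=> <-; rewrite addrC subrK.
Qed.

Lemma primitiveB a b F f (x y : R) : is_primitive a b F f -> a <= x -> x <= y -> y <= b ->
  F y - F x = \int[leb]_(t in `[x, y]) f t.
Proof.
move=> Ff ax xy yb; have ay := le_trans ax xy.
rewrite Ff.2// [F x]Ff.2//; last exact: le_trans yb.
rewrite (@Rintegral_split f a x y)//; [ring|exact: primitive_L1 Ff _ _].
Qed.

Lemma primitive_sub a b F f (x y : R) : is_primitive a b F f -> a <= x -> y <= b ->
  is_primitive x y F f.
Proof.
move=> Ff ax yb; split => [|z xz zy]; first exact: primitive_L1 Ff _ _.
by rewrite -(primitiveB Ff)//; [rewrite addrC subrK|exact: le_trans yb].
Qed.

Lemma primitiveD a b F G f g : is_primitive a b F f -> is_primitive a b G g ->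
  is_primitive a b (fun x => F x + G x) (fun x => f x + g x).
Proof.
move=> Ff Gg; split => [|y ay yb]; first by apply: L1D => //; [exact: Ff.1|exact: Gg.1].
rewrite RintegralD//; [|exact: primitive_L1 Ff _ _|exact: primitive_L1 Gg _ _].
by rewrite Ff.2// Gg.2//; ring.
Qed.

Lemma primitiveZ a b F f (k : R) : is_primitive a b F f ->
  is_primitive a b (fun x => k * F x) (fun x => k * f x).
Proof.
move=> Ff; split => [|y ay yb]; first by apply: L1Z => //; exact: Ff.1.
by rewrite RintegralZl//; [rewrite Ff.2//; ring|exact: primitive_L1 Ff _ _].
Qed.

Lemma L1_small f (a b e : R) : L1 `[a, b] f -> 0 < e ->
  exists2 d : R, 0 < d & forall x y : R, a <= x -> x <= y -> y <= b -> y - x < d ->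
    \int[leb]_(t in `[x, y]) `|f t| < e.
Proof.
move=> fi e0.
have : leb.-integrable setT (EFin \o f \_ `[a, b]).
  by rewrite -restrict_EFin; apply/integrable_restrict => //=; rewrite setTI.
move=> /integral_normr_continuous /(_ _ e0)[d [d0 /=]] ifab.
exists d => // x y ax xy yb yxd.
have /ifab : (leb `[x, y] < d%:E)%E.
  rewrite lebesgue_measure_itv/= lte_fin.
  by case: ifPn => // {}ac; rewrite -EFinD lte_fin.
move=> /(_ (measurable_itv _)) {ifab}.
apply: le_lt_trans; rewrite le_eqVlt; apply/orP; left; apply/eqP.
apply: eq_Rintegral => t /[!inE] /=; rewrite in_itv/= => /andP[xt ty].
rewrite patchE mem_set//= in_itv/= (le_trans ax xt) (le_trans ty yb)//.
Qed.

Lemma primitive_unif a b F f (e : R) : is_primitive a b F f -> 0 < e ->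
  exists2 d : R, 0 < d & forall x y : R, a <= x -> x <= y -> y <= b -> y - x < d ->
    `|F y - F x| < e.
Proof.
move=> Ff e0; have [d d0 H] := L1_small Ff.1 e0.
exists d => // x y x0 xy yb yxd; rewrite (primitiveB Ff)//.
apply: le_lt_trans (H x y x0 xy yb yxd); apply: le_normr_Rintegral => //.
exact: primitive_L1 Ff _ _.
Qed.

(** For [x < a] the interval is empty and the integral is 0, hence continuity on the whole line and
    not only to the right of [a]. *)
Lemma continuous_Rintegral f a : (forall b, L1 `[a, b] f) ->
  continuous (fun x : R => \int[leb]_(t in `[a, x]) f t).
Proof.
move=> fi x; apply/cvgrPdist_lt => e e0.
have [d d0 H] := L1_small (fi (x + 1)) e0.
have key (y z : R) : y <= z -> z <= x + 1 -> z - y < d ->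
   `|\int[leb]_(t in `[a, z]) f t - \int[leb]_(t in `[a, y]) f t| < e.
  move=> yz zx zyd; have [ay|ya] := leP a y.
    rewrite (@Rintegral_split f a y z)// addrAC subrr add0r.
    apply: le_lt_trans (H y z ay yz zx zyd); apply: le_normr_Rintegral => //.
    exact: L1_sub_itv (fi z) ay _.
  rewrite [X in _ - X](_ : _ = 0); last first.
    by rewrite set_itv_ge ?Rintegral_set0// bnd_simp -ltNge.
  rewrite subr0; have [az|za] := leP a z; last first.
    by rewrite set_itv_ge ?Rintegral_set0 ?normr0// bnd_simp -ltNge.
  apply: le_lt_trans (H a z (lexx _) az zx _); first exact: le_normr_Rintegral.
  by apply: le_lt_trans zyd; rewrite lerD2l lerN2 ltW.
near=> y.
have yx : `|x - y| < Num.min d 1.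
  near: y; apply: (@cvgr_dist_lt R R^o); [exact: cvg_id|by rewrite lt_min d0 ltr01].
move: yx; rewrite lt_min ltr_norml => /andP[/andP[h1 h2]]; rewrite ltr_norml => /andP[h3 h4].
by have [xy|/ltW yx] := leP x y; [rewrite distrC|]; apply: key => //; lra.
Unshelve. all: by end_near. Qed.

End Primitive.

Section PrimitiveProduct.
Context {R : realType}.
Implicit Types (f g F G : R -> R) (a b : R).

Lemma Rintegral_ler f g (D : set (measurableTypeR R)) : measurable D -> L1 D f -> L1 D g ->
  (forall x, D x -> f x <= g x) -> \int[leb]_(t in D) f t <= \int[leb]_(t in D) g t.
Proof. by move=> mD fi gi fg; apply: le_Rintegral. Qed.

Lemma Rintegral_norm_le f g (D : set (measurableTypeR R)) : measurable D -> L1 D f -> L1 D g ->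
  (forall x, D x -> `|f x| <= g x) -> `|\int[leb]_(t in D) f t| <= \int[leb]_(t in D) g t.
Proof.
move=> mD fi gi fg; apply: le_trans (le_normr_Rintegral mD fi) _.
by apply: Rintegral_ler => //; exact: L1_norm.
Qed.

(** Leibniz rule for absolutely continuous functions, without almost everywhere differentiation: on
    intervals shorter than a modulus of uniform continuity the defect is at most [e] times the
    integral of |f| + |g|; such bounds add up under subdivision, and [e] is arbitrary. *)
Lemma primitiveM a b F G f g : continuous F -> continuous G ->
  is_primitive a b F f -> is_primitive a b G g ->
  is_primitive a b (fun x => F x * G x) (fun x => f x * G x + F x * g x).
Proof.
move=> cF cG Ff Gg.
pose h (x : R) : R := f x * G x + F x * g x.
have hi (x y : R) : a <= x -> y <= b -> L1 `[x, y] h.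
  move=> x0 yb; apply: L1D => //; first by apply: L1_mul_cont => //; exact: primitive_L1 Ff _ _.
  apply: (@L1_eq _ _ (fun t => g t * F t)) => //; first by move=> t _; rewrite mulrC.
  by apply: L1_mul_cont => //; exact: primitive_L1 Gg _ _.
pose k (x : R) : R := `|f x| + `|g x|.
have ki (x y : R) : a <= x -> y <= b -> L1 `[x, y] k.
  by move=> x0 yb; apply: L1D => //; apply: L1_norm => //; [exact: primitive_L1 Ff _ _|exact: primitive_L1 Gg _ _].
split => [|Y aY Yb]; first exact: hi.
have main (e : R) : 0 < e -> `|F Y * G Y - F a * G a - \int[leb]_(t in `[a, Y]) h t| <=
    e * \int[leb]_(t in `[a, Y]) k t.
  move=> e0.
  have [d1 d10 H1] := primitive_unif Ff e0.
  have [d2 d20 H2] := primitive_unif Gg e0.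
  pose d := Num.min d1 d2.
  have d0 : 0 < d by rewrite lt_min d10 d20.
  have step (x y : R) : a <= x -> x <= y -> y <= b -> y - x < d ->
     `|F y * G y - F x * G x - \int[leb]_(t in `[x, y]) h t| <= e * \int[leb]_(t in `[x, y]) k t.
    move=> x0 xy yY yxd; have [yxd1 yxd2] : y - x < d1 /\ y - x < d2.
      by move: yxd; rewrite lt_min => /andP[].
    have fi := primitive_L1 Ff x0 yY.
    have gi := primitive_L1 Gg x0 yY.
    have -> : F y * G y - F x * G x - \int[leb]_(t in `[x, y]) h t =
       \int[leb]_(t in `[x, y]) (f t * G y + F x * g t - h t).
      rewrite RintegralB//; [|by apply: L1D => //; [exact: L1Zr|exact: L1Z]|exact: hi].
      rewrite [X in _ = X - _]RintegralD//; [|exact: L1Zr|exact: L1Z].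
      rewrite RintegralZr// RintegralZl// -(primitiveB Ff)// -(primitiveB Gg)//.
      by congr (_ - _); ring.
    rewrite -RintegralZl//; last exact: ki.
    apply: Rintegral_norm_le => //.
    - apply: L1B => //; last exact: hi.
      by apply: L1D => //; [exact: L1Zr|exact: L1Z].
    - by apply: L1Z => //; exact: ki.
    move=> t /=; rewrite in_itv/= => /andP[xt ty].
    have -> : f t * G y + F x * g t - h t = f t * (G y - G t) + (F x - F t) * g t.
      by rewrite /h; ring.
    apply: le_trans (ler_normD _ _) _; rewrite !normrM /k mulrDr; apply: lerD.
      rewrite mulrC ler_wpM2r//; apply: ltW; apply: H2 => //; [exact: le_trans xt|].
      by apply: le_lt_trans yxd2; rewrite lerD2l lerN2.
    rewrite ler_wpM2r// distrC; apply: ltW; apply: H1 => //; [exact: le_trans yY|].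
    by apply: le_lt_trans yxd1; rewrite lerD2r.
  have all (n : nat) : forall x y : R, a <= x -> x <= y -> y <= b -> y - x < d * n.+1%:R ->
     `|F y * G y - F x * G x - \int[leb]_(t in `[x, y]) h t| <= e * \int[leb]_(t in `[x, y]) k t.
    elim: n => [|n IH] x y x0 xy yY yxd; first by apply: step; rewrite // -[d]mulr1.
    (* The first of [n.+2] equal pieces is split off: it is shorter than [d], and the rest is
       shorter than [d * n.+1%:R]. *)
    pose z := x + (y - x) / n.+2%:R.
    have n2 : 0 < n.+2%:R :> R by rewrite ltr0n.
    have xz : x <= z by rewrite lerDl divr_ge0 ?subr_ge0// ltW.
    have zxd : z - x < d.
      by rewrite /z addrAC subrr add0r ltr_pdivrMr.
    have yzE : y - z = (y - x) / n.+2%:R * n.+1%:R.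
      rewrite /z; have -> : n.+1%:R = n.+2%:R - 1 :> R by rewrite -[n.+2%:R]natr1 addrK.
      by rewrite mulrBr mulr1 divfK ?gt_eqF//; ring.
    have zy : z <= y by rewrite -subr_ge0 yzE mulr_ge0// divr_ge0 ?subr_ge0// ltW.
    have yzd : y - z < d * n.+1%:R.
      by rewrite yzE ltr_pM2r ?ltr0n// ltr_pdivrMr.
    have z0 := le_trans x0 xz.
    rewrite (@Rintegral_split _ h x z y)//; last exact: hi.
    rewrite (@Rintegral_split _ k x z y)//; last exact: ki.
    have := step x z x0 xz (le_trans zy yY) zxd.
    have := IH z y z0 zy yY yzd.
    set u := \int[leb]_(_ in _) h _; set v := \int[leb]_(_ in _) h _.
    move=> Ha Hb; rewrite mulrDr.
    have -> : F y * G y - F x * G x - (v + u) = (F y * G y - F z * G z - u) + (F z * G z - F x * G x - v) by ring.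
    by apply: le_trans (ler_normD _ _) _; rewrite addrC lerD.
  have [n Hn] : exists n : nat, Y - a < d * n.+1%:R.
    exists (Num.trunc ((Y - a) / d)); rewrite -ltr_pdivrMl// mulrC.
    by apply: truncnS_gt.
  by apply: (all n).
rewrite -/h.
set J := \int[leb]_(t in `[a, Y]) h t in main *.
set K := \int[leb]_(t in `[a, Y]) k t in main *.
have K0 : 0 <= K by apply: Rintegral_ge0 => t _; rewrite addr_ge0.
apply/eqP; rewrite -subr_eq0 -normr_le0.
apply/ler_addgt0Pr => e e0; rewrite add0r.
have -> : F Y * G Y - (F a * G a + J) = F Y * G Y - F a * G a - J by ring.
have K1 : 0 < K + 1 by rewrite ltr_wpDl.
apply: le_trans (main (e / (K + 1)) _) _; first by rewrite divr_gt0.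
by rewrite -mulrA ger_pMr// mulrC ler_pdivrMr// mul1r lerDl.
Qed.

(** Differentiability is asked only inside the interval because [transport] may have kinks at both
    ends of its interval. *)
Lemma primitive_C1 a b F f : continuous F -> continuous f ->
  (forall x : R, a < x -> x < b -> is_derive x (1:R) F (f x)) -> is_primitive a b F f.
Proof.
move=> cF cf dF; split => [|y]; first exact: L1_cont.
rewrite le_eqVlt => /predU1P[<- _|ay yb].
  by rewrite set_itv1 Rintegral_set1 addr0.
rewrite /Rintegral (@continuous_FTC2 _ f F a y)//=; first by rewrite addrCA subrr addr0.
- exact: continuous_subspaceT.
- split.
  + move=> x; rewrite in_itv/= => /andP[x0 xy].
    by have [] := dF x x0 (lt_le_trans xy yb).
  + by apply: cvg_at_right_filter; exact: cF.
  + by apply: cvg_at_left_filter; exact: cF.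
- move=> x; rewrite in_itv/= => /andP[x0 xy]; rewrite derive1E.
  by have [_ ->] := dF x x0 (lt_le_trans xy yb).
Qed.

End PrimitiveProduct.

Lemma continuous_powR (R : realType) (f : R -> R) (a : R) : continuous f ->
  (forall x, 0 <= f x) -> 0 < a -> continuous (fun x => f x `^ a).
Proof.
move=> cf f0 a0 x.
have := f0 x; rewrite le_eqVlt => /predU1P[fx0|fx0].
  apply/cvgrPdist_lt => e e0; rewrite /= -fx0 powR0 ?gt_eqF//.
  have d0 : 0 < e `^ a^-1 by exact: powR_gt0.
  have := cf x; move/cvgrPdist_lt => /(_ _ d0).
  apply: filterS => t; rewrite -fx0 !sub0r !normrN ger0_norm// ger0_norm ?powR_ge0// => ft.
  have -> : e = (e `^ a^-1) `^ a by rewrite -powRrM mulVf ?gt_eqF// powRr1// ltW.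
  by apply: gt0_ltr_powR; rewrite // nnegrE// ltW.
apply: (@continuous_comp R R R f (fun y => y `^ a)); first exact: cf.
apply: differentiable_continuous; apply/derivable1_diffP.
by apply: (@ex_derive _ _ _ _ _ _ _ (is_derive1_powR a fx0)).
Qed.

(** * The half-line inequality *)
Section Profile.
Context {R : realType}.
Implicit Types (mu t T : R).

(** Squared modulus of a soliton of amplitude 1 as a function of its tanh, see [wt_Th]. The
    truncation makes it vanish continuously outside ]-1, 1[, so that [Psi] is C^1 on the whole
    line. *)
Definition wt mu t : R := Num.max 0 (1 - t ^+ 2) `^ mu^-1.

Lemma wt_ge0 mu t : 0 <= wt mu t. Proof. exact: powR_ge0. Qed.

Lemma wtN mu t : wt mu (- t) = wt mu t. Proof. by rewrite /wt sqrrN. Qed.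

Lemma wtE mu t : -1 <= t <= 1 -> wt mu t = (1 - t ^+ 2) `^ mu^-1.
Proof. by move=> ht; rewrite /wt max_r//; nra. Qed.

Lemma wt_gt0 mu t : -1 < t < 1 -> 0 < wt mu t.
Proof. by move=> ht; rewrite wtE; [apply: powR_gt0; nra|lra]. Qed.

Lemma wt_out mu t : 0 < mu -> (t <= -1) || (1 <= t) -> wt mu t = 0.
Proof.
move=> mu0 ht; rewrite /wt max_l; first by rewrite powR0// invr_eq0 gt_eqF.
by case/orP: ht => ht; nra.
Qed.

Lemma wt_cont mu : 0 < mu -> continuous (wt mu).
Proof.
move=> mu0; apply: continuous_powR; last by rewrite invr_gt0.
  move=> x; apply: (@continuous_max R R (cst 0) (fun t : R => 1 - t ^+ 2)); first exact: cst_continuous.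
  apply: (@continuousB R R R (cst 1) (fun t : R => t ^+ 2)); first exact: cst_continuous.
  exact: exprn_continuous.
by move=> x; rewrite le_max lexx.
Qed.

Lemma wt_L1 mu (D : set (measurableTypeR R)) : 0 < mu -> measurable D -> L1 D (wt mu).
Proof.
move=> mu0 mD; apply: (@L1S _ D setT) => //.
have -> : EFin \o wt mu = (EFin \o wt mu) \_ `[-1, 1].
  apply/funext => t; rewrite patchE; case: ifPn => // /negP.
  rewrite inE/= in_itv/= => ht; rewrite wt_out//.
  by case: (leP t (-1)) ht => //= h1 h2; case: (leP 1 t) => // h3; exfalso; apply: h2; rewrite !ltW.
apply/(integrable_mkcond _ _).1; first exact: measurable_itv.
exact: L1_cont (wt_cont mu0).
Qed.

(* The integral of [wt] over [T, 1], written so that it is also meaningful, and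
   constant, for T <= -1. *)
Definition Psi mu T : R :=
  \int[leb]_(t in `]-oo, 1]) wt mu t - \int[leb]_(t in `]-oo, T]) wt mu t.

Lemma Psi_derive mu T : 0 < mu -> is_derive T (1:R) (Psi mu) (- wt mu T).
Proof.
move=> mu0.
have [//||d1 d2] := @continuous_FTC1 R (wt mu) -oo%O T (T + 1) _ (wt_L1 mu0 (measurable_itv _)) (ltNyr _).
- by rewrite ltrDl.
- exact: wt_cont.
rewrite -[- wt _ _]add0r; apply: is_deriveB.
by split; [exact: d1|rewrite -derive1E; exact: d2].
Qed.

Lemma Psi1 mu : Psi mu 1 = 0. Proof. by rewrite /Psi subrr. Qed.

Lemma Psi_cont mu : 0 < mu -> continuous (Psi mu).
Proof.
move=> mu0 T; apply: differentiable_continuous; apply/derivable1_diffP.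
by have [] := Psi_derive T mu0.
Qed.

Lemma Psi_lt mu (a b : R) : 0 < mu -> -1 <= a -> a < b -> b <= 1 -> Psi mu b < Psi mu a.
Proof.
move=> mu0 a1 ab b1.
have [||c] := @MVT R (Psi mu) (fun t => - wt mu t) a b ab.
- by move=> x _; exact: Psi_derive.
- exact/continuous_subspaceT/Psi_cont.
rewrite in_itv/= => /andP[ac cb] E; rewrite -subr_lt0 E mulNr oppr_lt0.
by rewrite mulr_gt0 ?subr_gt0//; apply: wt_gt0; rewrite (le_lt_trans a1 ac) (lt_le_trans cb b1).
Qed.

Lemma Psi_le mu (a b : R) : 0 < mu -> a <= b -> Psi mu b <= Psi mu a.
Proof.
move=> mu0; rewrite le_eqVlt => /predU1P[->//|ab].
have [||c _ E] := @MVT R (Psi mu) (fun t => - wt mu t) a b ab.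
- by move=> x _; exact: Psi_derive.
- exact/continuous_subspaceT/Psi_cont.
by rewrite -subr_le0 E mulNr oppr_le0 mulr_ge0 ?subr_ge0 ?wt_ge0// ltW.
Qed.

Lemma Psi_gt0 mu T : 0 < mu -> T < 1 -> 0 < Psi mu T.
Proof.
move=> mu0 T1; rewrite -(Psi1 mu).
apply: lt_le_trans (@Psi_le mu T (Num.max (-1) T) mu0 _); last by rewrite le_max lexx orbT.
by apply: Psi_lt => //; [rewrite le_max lexx|rewrite gt_max T1 andbT; lra].
Qed.

Lemma Psi_ge0 mu T : 0 < mu -> T <= 1 -> 0 <= Psi mu T.
Proof. by move=> mu0 T1; rewrite -(Psi1 mu); exact: Psi_le. Qed.

Lemma Psi_out mu T : 0 < mu -> T <= -1 -> Psi mu T = Psi mu (-1).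
Proof.
move=> mu0; rewrite le_eqVlt => /predU1P[->//|ab].
have [||c + E] := @MVT R (Psi mu) (fun t => - wt mu t) T (-1) ab.
- by move=> x _; exact: Psi_derive.
- exact/continuous_subspaceT/Psi_cont.
rewrite in_itv/= => /andP[ac cb].
by move/eqP: E; rewrite wt_out// ?(ltW cb)// oppr0 mul0r subr_eq0 => /eqP ->.
Qed.

(** By evenness of [wt]. [Psi mu (-1)] is thus the value of Psi z + Psi T on z + T = 0, which serves
    as a barrier in [matching_min]. *)
Lemma PsiN mu T : 0 < mu -> Psi mu T + Psi mu (- T) = Psi mu (-1).
Proof.
move=> mu0; rewrite -[RHS]add0r -(Psi1 mu).
apply: (@is_derive_0_is_cst R (fun t => Psi mu t + Psi mu (- t)) T 1) => t.
have -> : (0:R) = - wt mu t + (- wt mu (- t)) * (-1) by rewrite wtN; ring.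
apply: is_deriveD; first exact: Psi_derive.
apply: is_derive1_comp.
exact: Psi_derive.
Qed.

Lemma Psi_inj mu (a b : R) : 0 < mu -> -1 <= a <= 1 -> -1 <= b <= 1 ->
  Psi mu a = Psi mu b -> a = b.
Proof.
move=> mu0 /andP[a1 a2] /andP[b1 b2] E; apply/eqP; rewrite eq_le !leNgt; apply/andP; split; apply/negP => h.
  by have := Psi_lt mu0 b1 h a2; rewrite E ltxx.
by have := Psi_lt mu0 a1 h b2; rewrite E ltxx.
Qed.

Definition Psiinv mu (y : R) : R := xget 0 [set T : R | -1 <= T <= 1 /\ Psi mu T = y].

Lemma PsiK mu T : 0 < mu -> -1 <= T <= 1 -> Psiinv mu (Psi mu T) = T.
Proof.
move=> mu0 hT; rewrite /Psiinv; case: xgetP => [S _ [hS E]|/(_ T)]; last by case.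
exact: Psi_inj E.
Qed.

Lemma Psi_surj mu (y : R) : 0 < mu -> 0 <= y <= Psi mu (-1) -> exists2 T, -1 <= T <= 1 & Psi mu T = y.
Proof.
move=> mu0 /andP[y0 y1].
have [||T] := @IVT R (Psi mu) (-1) 1 y _ (continuous_subspaceT (Psi_cont mu0)).
- by lra.
- by rewrite Psi1 min_r ?max_l ?y0 ?y1//; apply: Psi_ge0 => //; lra.
by rewrite in_itv/= => hT E; exists T.
Qed.

Lemma PsiinvK mu (y : R) : 0 < mu -> 0 <= y <= Psi mu (-1) ->
  Psi mu (Psiinv mu y) = y /\ -1 <= Psiinv mu y <= 1.
Proof. by move=> mu0 /(Psi_surj mu0)[T hT <-]; rewrite PsiK. Qed.

Lemma Psiinv_derive mu (y : R) : 0 < mu -> 0 < y < Psi mu (-1) ->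
  is_derive y (1:R) (Psiinv mu) (- (wt mu (Psiinv mu y))^-1).
Proof.
move=> mu0 /andP[y0 y1].
have [|E1 /andP[h1 h2]] := @PsiinvK mu y mu0; first by rewrite !ltW.
set T := Psiinv mu y in E1 h1 h2 *.
have T1 : -1 < T.
  by rewrite lt_neqAle h1 andbT; apply/eqP => h; move: y1; rewrite -E1 -h ltxx.
have T2 : T < 1.
  by rewrite lt_neqAle h2 andbT; apply/eqP => h; move: y0; rewrite -E1 h Psi1 ltxx.
rewrite -E1 -invrN; apply: (@is_derive_inverse R (Psi mu) (Psiinv mu)).
- near=> t; apply: PsiK => //; apply/andP; split; apply/ltW; near: t.
    exact: lt_nbhsr.
  exact: lt_nbhsl.
- by near=> t; exact: Psi_cont.
- exact: Psi_derive.
- by rewrite oppr_eq0 gt_eqF// wt_gt0// T1.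
Unshelve. all: by end_near.
Qed.

End Profile.

(** * The pointwise Young inequality *)

Section Young.
Context {R : realType}.
Implicit Types (mu k : R).

Lemma powR_expR (x y : R) : expR x `^ y = expR (x * y). Proof. by rewrite expRM. Qed.

Lemma invr_expR (x : R) : (expR x)^-1 = expR (- x). Proof. by rewrite expRN. Qed.

Lemma mulr_expR (x y : R) : expR x * expR y = expR (x + y). Proof. by rewrite expRD. Qed.

(** Positive reals are written as exponentials, so that identities between real powers become
    rational identities between exponents. *)
Definition powR_expRE := (powR_expR, invr_expR, mulr_expR).

(** The sharp constant in [young_profile]. It does not depend on T because the exponent 1/mu of [wt]
    makes the powers of 1 - T^2 cancel there. *)
Definition gns_const mu k : R := (mu + 1) * k ^+ 2 * (mu * k) `^ (- (mu / (mu + 1))).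

Lemma gns_const_gt0 mu k : 0 < mu -> 0 < k -> 0 < gns_const mu k.
Proof.
move=> m0 k0; rewrite mulr_gt0 ?mulr_gt0 ?exprn_gt0 ?powR_gt0//; first lra.
by rewrite mulr_gt0.
Qed.

(** Weighted arithmetic-geometric inequality for 1 and z. Writing z = exp ((mu + 1) b) and dividing
    by exp (mu b) reduces it to the tangent bounds of exp at - mu b and b, which are strict unless b
    = 0. *)
Lemma bernoulli_powR mu (z : R) : 0 < mu -> 0 < z ->
  (mu + 1) * z `^ (mu / (mu + 1)) <= 1 + mu * z
  /\ ((mu + 1) * z `^ (mu / (mu + 1)) = 1 + mu * z -> z = 1).
Proof.
move=> mu0 /expR_total[x <-]; rewrite -expRM.
have mu1 : mu + 1 != 0 by rewrite gt_eqF//; lra.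
have [->|x0] := eqVneq x 0.
  by rewrite mul0r expR0 !mulr1 addrC.
set b := x / (mu + 1).
have b0 : b != 0 by rewrite mulf_neq0// invr_eq0.
have -> : x * (mu / (mu + 1)) = mu * b by rewrite /b; field.
have xE : x = b + mu * b by rewrite /b; field.
have h1 : 1 - mu * b < expR (- (mu * b)).
  by apply: expR_gt1Dx; rewrite oppr_eq0 mulf_neq0// gt_eqF.
have h2 : 1 + b < expR b by exact: expR_gt1Dx.
have e0 := expR_gt0 (mu * b).
have : (mu + 1) * expR (mu * b) < 1 + mu * expR x.
  rewrite [in ltRHS]xE expRD.
  have h : mu + 1 < expR (- (mu * b)) + mu * expR b by nra.
  have {}h : (mu + 1) * expR (mu * b) < (expR (- (mu * b)) + mu * expR b) * expR (mu * b).
    by rewrite ltr_pM2r.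
  have h3 : expR (- (mu * b)) * expR (mu * b) = 1 by rewrite -expRD addNr expR0.
  by move: h; rewrite [X in _ < X -> _]mulrDl h3; lra.
by move=> h; split; [exact: ltW|move=> E; move: h; rewrite E ltxx].
Qed.

(** Here m r^(mu+1) / wt T stands for T'. With z the ratio of T' to its soliton value mu k (1 -
    T^2), the two sides are k^2 (1 - T^2) r times those of [bernoulli_powR]; equality means z = 1 or
    r = 0. *)
Lemma young_profile mu k (m r T : R) : 0 < mu -> 0 < k -> 0 < m -> 0 <= r -> -1 < T < 1 ->
  gns_const mu k * m `^ (mu / (mu + 1)) * r `^ (mu + 1) <=
    k ^+ 2 * (1 - T ^+ 2) * r + k * (m * r `^ (mu + 1) / wt mu T) * r
  /\ (gns_const mu k * m `^ (mu / (mu + 1)) * r `^ (mu + 1) =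
    k ^+ 2 * (1 - T ^+ 2) * r + k * (m * r `^ (mu + 1) / wt mu T) * r ->
    r = 0 \/ m * r `^ (mu + 1) / wt mu T = mu * k * (1 - T ^+ 2)).
Proof.
move=> mu0 k0 m0; rewrite le_eqVlt => /predU1P[<- hT|r0 hT].
  rewrite powR0 ?gt_eqF//; last lra.
  by rewrite !(mulr0, mul0r, addr0); split => // _; left.
rewrite wtE; last lra.
set a := 1 - T ^+ 2.
have a0 : 0 < a by rewrite /a; nra.
have mu1 : mu + 1 != 0 by rewrite gt_eqF//; lra.
have mk0 : 0 < mu * k by rewrite mulr_gt0.
set q := m * _ / _.
pose z := q / (mu * k * a).
have z0 : 0 < z by rewrite /z /q !divr_gt0 ?mulr_gt0 ?powR_gt0.
have qE : q = mu * k * a * z by rewrite /z mulrC divfK// !mulf_neq0 ?gt_eqF.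
have -> : k ^+ 2 * a * r + k * q * r = k ^+ 2 * a * r * (1 + mu * z) by rewrite qE; ring.
have -> : gns_const mu k * m `^ (mu / (mu + 1)) * r `^ (mu + 1) =
    k ^+ 2 * a * r * ((mu + 1) * z `^ (mu / (mu + 1))).
  rewrite /z /q /gns_const.
  have [lm <-] := expR_total m0; have [lr <-] := expR_total r0.
  have [la <-] := expR_total a0; have [lk ->] : exists lk, mu * k = expR lk.
    by have [lk E] := expR_total mk0; exists lk.
  rewrite !powR_expRE.
  set e1 := expR (lk * _); set e2 := expR (lm * _); set e3 := expR (lr * _).
  set e4 := expR (_ * (mu / (mu + 1))).
  transitivity ((mu + 1) * k ^+ 2 * (e1 * e2 * e3)); first by rewrite -!mulrA.
  transitivity ((mu + 1) * k ^+ 2 * (expR la * expR lr * e4)); last by ring.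
  rewrite /e1 /e2 /e3 /e4 !powR_expRE; congr (_ * expR _); field.
  by rewrite mu1 gt_eqF.
have kar : 0 < k ^+ 2 * a * r by rewrite !mulr_gt0 ?exprn_gt0.
have [b1 b2] := bernoulli_powR mu0 z0.
split; first by rewrite ler_pM2l.
move/(mulfI (lt0r_neq0 kar))/b2 => z1; right; rewrite qE z1; ring.
Qed.

End Young.

(** * Tails of integrable functions on a ray *)

Section Tails.
Context {R : realType}.
Implicit Types (f g : R -> R) (a b x y : R).

Lemma L1_tail f a x : L1 `[a, +oo[ f -> a <= x -> L1 `[x, +oo[ f.
Proof.
move=> fi ax; apply: L1S fi => //.
by apply: subset_itvr; rewrite bnd_simp.
Qed.

Lemma L1_tail_seg f a x y : L1 `[a, +oo[ f -> a <= x -> L1 `[x, y] f.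
Proof.
move=> fi ax; apply: L1S fi => //.
by apply: subset_itv; rewrite bnd_simp.
Qed.

Lemma Rintegral_tail f a y : L1 `[a, +oo[ f -> a <= y ->
  \int[leb]_(t in `[a, +oo[) f t = \int[leb]_(t in `[a, y]) f t + \int[leb]_(t in `[y, +oo[) f t.
Proof.
move=> fi ay.
have := @Rintegral_itvB R f (BLeft a) +oo%O y fi.
rewrite !bnd_simp => /(_ ay isT); rewrite Rintegral_itv_obnd_cbnd; last first.
  by apply: L1S fi => //; apply: subset_itvr; rewrite bnd_simp.
by move=> <-; rewrite addrC subrK.
Qed.

Lemma tail_small f a (e : R) : L1 `[a, +oo[ f -> (forall x, a <= x -> 0 <= f x) -> 0 < e ->
  exists2 X, a <= X & forall y, X <= y -> \int[leb]_(t in `[y, +oo[) f t < e.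
Proof.
move=> fi f0 e0.
pose F (i : nat) : set (measurableTypeR R) := `[a, a + i%:R]%classic.
have U : \bigcup_i F i = `[a, +oo[%classic.
  apply/seteqP; split => [x [i _]|x]; rewrite /F /= !in_itv/=; first by move=> /andP[->].
  rewrite andbT => ax; exists (Num.trunc (x - a)).+1 => //=; rewrite in_itv/= ax/=.
  by rewrite -lerBlDl; apply/ltW/truncnS_gt.
have H : ((\int[leb]_(x in F i) (f x)%:E)%E @[i --> \oo] -->
    ((\int[leb]_(t in `[a, +oo[) f t)%:E))%classic.
  rewrite /Rintegral fineK; last exact: integrable_fin_num.
  rewrite -U; apply: ge0_nondecreasing_set_cvg_integral.
  - by move=> m n mn; apply/subsetPset/subset_itvl; rewrite bnd_simp lerD2l ler_nat.
  - by move=> i; exact: measurable_itv.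
  - by move=> i; apply/measurable_EFinP; apply: L1_meas; exact: (L1_tail_seg _ fi (lexx a)).
  - by move=> i x; rewrite /F/= in_itv/= lee_fin => /andP[ax _]; exact: f0.
have /fine_cvgP[_ /cvgrPdist_lt /(_ e e0)[N _ HN]] := H.
have aN : a <= a + N%:R by rewrite lerDl.
exists (a + N%:R) => // y Ny.
have := HN N (leqnn N) => /=.
rewrite [X in `|X - _|](Rintegral_tail fi aN) -/(Rintegral _ _ _) addrAC subrr add0r.
rewrite ger0_norm; last first.
  by apply: Rintegral_ge0 => t /=; rewrite in_itv/= andbT => h; apply: f0; exact: le_trans h.
apply: le_lt_trans; rewrite (Rintegral_tail (L1_tail fi aN) Ny) lerDr.
by apply: Rintegral_ge0 => t /=; rewrite in_itv/= => /andP[h _]; apply: f0; exact: le_trans h.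
Qed.

Lemma Rintegral_tail_ge0 f a : (forall x, a <= x -> 0 <= f x) ->
  0 <= \int[leb]_(t in `[a, +oo[) f t.
Proof. by move=> f0; apply: Rintegral_ge0 => t /=; rewrite in_itv/= andbT; exact: f0. Qed.

Lemma Rintegral_seg_le_tail f a y : L1 `[a, +oo[ f -> (forall x, a <= x -> 0 <= f x) -> a <= y ->
  \int[leb]_(t in `[a, y]) f t <= \int[leb]_(t in `[a, +oo[) f t.
Proof.
move=> fi f0 ay; rewrite (Rintegral_tail fi ay) lerDl.
by apply: Rintegral_tail_ge0 => x yx; apply: f0; exact: le_trans yx.
Qed.

(** Otherwise every far unit interval would contribute at least [e]. This replaces decay at
    infinity: one distant point with a small boundary term is enough. *)
Lemma L1_small_value f a X (e : R) : L1 `[a, +oo[ f -> (forall x, a <= x -> 0 <= f x) ->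
  0 < e -> exists y, [/\ a <= y, X <= y & f y < e].
Proof.
move=> fi f0 e0; apply: contrapT => H.
have fe y : a <= y -> X <= y -> e <= f y.
  by move=> ay Xy; rewrite leNgt; apply/negP => fy; apply: H; exists y.
have [X' aX' HX'] := tail_small fi f0 e0.
pose y := Num.max X X'.
have X'y : X' <= y by rewrite le_max lexx orbT.
have Xy : X <= y by rewrite le_max lexx.
have ay := le_trans aX' X'y.
have := HX' y X'y; apply/negP; rewrite -leNgt.
apply: le_trans (@Rintegral_seg_le_tail f y (y + 1) (L1_tail fi ay) _ _); last 2 first.
- by move=> x yx; apply: f0; exact: le_trans yx.
- by rewrite lerDl.
have <- : \int[leb]_(t in `[y, y + 1]) (e : R) = e.
  rewrite Rintegral_cst//= lebesgue_measure_itv/= lte_fin ltrDl ltr01.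
  by rewrite -EFinD addrAC subrr add0r/= mulr1.
apply: Rintegral_ler => //.
- by apply: (@L1_cont R (cst e)); exact: cst_continuous.
- exact: L1_tail_seg fi ay.
- by move=> x /=; rewrite in_itv/= => /andP[yx _]; apply: fe; exact: le_trans yx.
Qed.

End Tails.

(** * Mass and energy on a half-line *)

Section HalfLine.
Context {R : realType}.
Implicit Types (A B Ga Gb : R -> R) (a b x y mu k : R).

Definition sqsum A B x : R := A x ^+ 2 + B x ^+ 2.

Lemma sqsum_ge0 A B x : 0 <= sqsum A B x.
Proof. by rewrite addr_ge0 ?sqr_ge0. Qed.

(* [A], [B] are the real and imaginary parts of an H^1 function on [a, +oo[ and
   [Ga], [Gb] those of its derivative. *)
Record halfline a A B Ga Gb : Prop := Halfline {
  hl_contA : continuous A;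
  hl_contB : continuous B;
  hl_primA : forall b, is_primitive a b A Ga;
  hl_primB : forall b, is_primitive a b B Gb;
  hl_L1G : L1 `[a, +oo[ (sqsum Ga Gb);
  hl_L1 : L1 `[a, +oo[ (sqsum A B) }.

Definition mass mu A B a : R := \int[leb]_(x in `[a, +oo[) sqsum A B x `^ (mu + 1).

Definition energy k A B Ga Gb a : R :=
  \int[leb]_(x in `[a, +oo[) (sqsum Ga Gb x + k ^+ 2 * sqsum A B x).

Lemma halfline_sub a b A B Ga Gb : a <= b -> halfline a A B Ga Gb -> halfline b A B Ga Gb.
Proof.
move=> ab [cA cB pA pB G r]; split => //.
- by move=> c; exact: primitive_sub (pA c) ab (lexx _).
- by move=> c; exact: primitive_sub (pB c) ab (lexx _).
- exact: L1_tail G ab.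
- exact: L1_tail r ab.
Qed.

Lemma sqsum_cont A B : continuous A -> continuous B -> continuous (sqsum A B).
Proof.
move=> cA cB x; rewrite /sqsum.
apply: (@continuousD R R R (fun x => A x ^+ 2) (fun x => B x ^+ 2)).
  by apply: (@continuous_comp R R R A (fun y => y ^+ 2)); [exact: cA|exact: exprn_continuous].
by apply: (@continuous_comp R R R B (fun y => y ^+ 2)); [exact: cB|exact: exprn_continuous].
Qed.

Lemma sqsum_powR_cont mu A B : 0 < mu -> continuous A -> continuous B ->
  continuous (fun x => sqsum A B x `^ (mu + 1)).
Proof.
move=> mu0 cA cB; apply: continuous_powR; [exact: sqsum_cont|exact: sqsum_ge0|lra].
Qed.

Section Mass.
Context (a : R) (A B Ga Gb : R -> R) (mu k : R).
Hypotheses (hl : halfline a A B Ga Gb) (mu0 : 0 < mu) (k0 : 0 < k).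

Let rho := sqsum A B.
Let P x : R := rho x `^ (mu + 1).

Let cP : continuous P := sqsum_powR_cont mu0 (hl_contA hl) (hl_contB hl).

Let rho0 x : 0 <= rho x := sqsum_ge0 A B x.
Let P0 x : 0 <= P x := powR_ge0 _ _.

Lemma sqsum_primitive b : is_primitive a b rho (fun x => 2 * (A x * Ga x + B x * Gb x)).
Proof.
have cA := hl_contA hl; have cB := hl_contB hl.
have := primitiveD (primitiveM cA cA (hl_primA hl b) (hl_primA hl b))
  (primitiveM cB cB (hl_primB hl b) (hl_primB hl b)).
have -> : (fun x => A x * A x + B x * B x) = rho.
  by apply/funext => x; rewrite /rho /sqsum !expr2.
congr (is_primitive a b rho); apply/funext => x; ring.
Qed.

(** The Sobolev embedding: the derivative of |u|^2 is at most |u'|^2 + |u|^2, which is integrable.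
    It makes the mass finite. *)
Lemma sqsum_bounded : exists2 M, 0 <= M & forall x, a <= x -> rho x <= M.
Proof.
have i1 : L1 `[a, +oo[ (fun x => sqsum Ga Gb x + rho x).
  by apply: L1D => //; [exact: hl_L1G hl|exact: hl_L1 hl].
pose K := \int[leb]_(x in `[a, +oo[) (sqsum Ga Gb x + rho x).
have K0 : 0 <= K by apply: Rintegral_tail_ge0 => x _; rewrite addr_ge0 ?sqsum_ge0.
exists (rho a + K) => [|x ax]; first by rewrite addr_ge0.
rewrite -lerBlDl (primitiveB (sqsum_primitive x))//.
apply: le_trans (Rintegral_seg_le_tail i1 _ ax); last by move=> y _; rewrite addr_ge0 ?sqsum_ge0.
apply: Rintegral_ler => //; first by exact: (sqsum_primitive x).1.
  exact: L1_tail_seg i1 _.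
move=> y _; rewrite /rho /sqsum.
by have := sqr_ge0 (A y - Ga y); have := sqr_ge0 (B y - Gb y); nra.
Qed.

Lemma mass_L1 : L1 `[a, +oo[ P.
Proof.
have [M M0 rM] := sqsum_bounded.
apply: (@L1_le _ _ _ (fun x => M `^ mu * rho x)) => //.
- by apply: measurable_funS (continuous_measurable_fun cP).
- move=> x /=; rewrite in_itv/= andbT => ax.
  rewrite ger0_norm// /P; have := rho0 x; rewrite le_eqVlt => /predU1P[<-|r0].
    by rewrite powR0 ?mulr0// gt_eqF// addr_gt0.
  rewrite powRD; last by rewrite (gt_eqF r0) implybT.
  rewrite powRr1// ler_wpM2r//; apply: ge0_ler_powR; rewrite ?nnegrE// ?rM//.
  exact: ltW.
- by apply: L1Z => //; exact: hl_L1 hl.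
Qed.

Lemma energy_L1 : L1 `[a, +oo[ (fun x => sqsum Ga Gb x + k ^+ 2 * rho x).
Proof. by apply: L1D => //; [exact: hl_L1G hl|apply: L1Z => //; exact: hl_L1 hl]. Qed.

Lemma mass_ge0 x : 0 <= mass mu A B x.
Proof. by apply: Rintegral_tail_ge0 => t _; exact: P0. Qed.

Lemma mass_split y : a <= y -> mass mu A B a = \int[leb]_(x in `[a, y]) P x + mass mu A B y.
Proof. by move=> ay; rewrite /mass (Rintegral_tail mass_L1 ay). Qed.

(** The mass beyond x, written as a difference so that it is continuous on the whole line and
    constant to the left of [a]. *)
Definition tailmass x : R := mass mu A B a - \int[leb]_(t in `[a, x]) P t.

Lemma tailmassE y : a <= y -> tailmass y = mass mu A B y.
Proof. by move=> ay; rewrite /tailmass (mass_split ay) addrAC subrr add0r. Qed.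

Lemma tailmass_left x : x <= a -> tailmass x = mass mu A B a.
Proof.
rewrite le_eqVlt => /predU1P[->|xa]; first by rewrite tailmassE.
by rewrite /tailmass set_itv_ge ?Rintegral_set0 ?subr0// bnd_simp -ltNge.
Qed.

Lemma tailmass_cont : continuous tailmass.
Proof.
move=> x; apply: (@continuousB R R R (cst (mass mu A B a)) (fun x => \int[leb]_(t in `[a, x]) P t)).
  exact: cst_continuous.
by apply: continuous_Rintegral => b; exact: L1_cont.
Qed.

Lemma tailmass_le x y : x <= y -> tailmass y <= tailmass x.
Proof.
move=> xy; rewrite lerD2l lerN2; have [ax|xa] := leP a x; last first.
  rewrite [leLHS](_ : _ = 0); first exact: Rintegral_ge0.
  by rewrite set_itv_ge ?Rintegral_set0// bnd_simp -ltNge.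
rewrite (@Rintegral_split _ P a x y)//; last exact: L1_cont.
by rewrite lerDl Rintegral_ge0.
Qed.

Lemma tailmass_derive x : a < x -> is_derive x (1:R) tailmass (- P x).
Proof.
move=> ax; have [||d1 d2] := @continuous_FTC1_closed R P a x (x + 1) _ (L1_cont (f:=P) _ _ cP) ax.
- by rewrite ltrDl.
- exact: cP.
rewrite -[- P x]add0r; apply: is_deriveB.
by split; [exact: d1|rewrite -derive1E; exact: d2].
Qed.

End Mass.

End HalfLine.

(** * Transport of the mass onto a soliton *)

Section Transport.
Context {R : realType} (a : R) (A B Ga Gb : R -> R) (mu k : R).
Hypotheses (hl : halfline a A B Ga Gb) (mu0 : 0 < mu) (k0 : 0 < k).

Let rho := sqsum A B.
Let P (x : R) : R := rho x `^ (mu + 1).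
Let n := tailmass a A B mu.

(* The slack [e] keeps the transported parameter below 1 even if the mass beyond
   [Y] vanishes. *)
Variables (T0 m e Y : R).
Hypotheses (hT0 : -1 < T0 < 1) (m0 : 0 < m) (aY : a <= Y).
Hypotheses (nY : 0 < n Y + e) (hm : m * (mass mu A B a + e) = Psi mu T0).

(** The monotone map that carries the measure m P dx to wt dt. Freezing it beyond [Y] keeps the
    argument of [Psiinv] bounded away from 0, hence inside the range where the inverse is
    differentiable. *)
Definition transport x : R := Psiinv mu (m * (n (Num.min x Y) + e)).

Let T := transport.

Lemma transport_arg x : 0 < m * (n (Num.min x Y) + e) <= Psi mu T0.
Proof.
apply/andP; split.
  rewrite mulr_gt0// (lt_le_trans nY)// lerD2r; apply: tailmass_le hl mu0 _ _ _.
  by rewrite ge_min lexx orbT.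
rewrite -hm ler_pM2l// lerD2r -(tailmass_left hl mu0 (lexx a)).
have [xa|ax] := leP (Num.min x Y) a.
  by rewrite /n !(tailmass_left hl mu0).
by apply: tailmass_le hl mu0 _ _ _; exact: ltW.
Qed.

Lemma transport_arg' x : 0 < m * (n (Num.min x Y) + e) < Psi mu (-1).
Proof.
have /andP[h1 h2] := transport_arg x; rewrite h1 (le_lt_trans h2)//.
by apply: Psi_lt => //; have := hT0; lra.
Qed.

Lemma Psi_transport x : Psi mu (T x) = m * (n (Num.min x Y) + e).
Proof.
have /andP[h1 h2] := transport_arg' x.
by have [] := @PsiinvK R mu _ mu0 (_ : 0 <= m * (n (Num.min x Y) + e) <= _); first by rewrite !ltW.
Qed.

Lemma transport_bnd x : -1 < T x < 1.
Proof.
have /andP[h1 h2] := transport_arg' x.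
have /andP[h3 h4] : -1 <= T x <= 1.
  by have [|] := @PsiinvK R mu (m * (n (Num.min x Y) + e)) mu0; first by rewrite !ltW.
have E := Psi_transport x; rewrite !lt_neqAle h3 h4 !andbT; apply/andP; split; apply/eqP => h.
  by move: h2; rewrite -E -h ltxx.
by move: h1; rewrite -E h Psi1 ltxx.
Qed.

Lemma transport_start : T a = T0.
Proof.
rewrite /T /transport min_l// /n (tailmassE hl mu0 (lexx a)) hm PsiK//; have := hT0; lra.
Qed.

Lemma transport_cont : continuous T.
Proof.
move=> x; apply: (@continuous_comp R R R (fun x => m * (n (Num.min x Y) + e)) (Psiinv mu)).
  apply: (@continuousM R R (cst m) (fun x => n (Num.min x Y) + e)); first exact: cst_continuous.
  apply: (@continuousD R R R (fun x => n (Num.min x Y)) (cst e)); last exact: cst_continuous.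
  apply: (@continuous_comp R R R (fun x => Num.min x Y) n); last exact: tailmass_cont hl mu0 _.
  apply: (@continuous_min R R id (cst Y)); [exact: cvg_id|exact: cst_continuous].
apply: differentiable_continuous; apply/derivable1_diffP.
by have [] := Psiinv_derive mu0 (transport_arg' x).
Qed.

Definition transport' x : R := m * P x / wt mu (T x).

Lemma transport'_cont : continuous transport'.
Proof.
have cP : continuous P := sqsum_powR_cont mu0 (hl_contA hl) (hl_contB hl).
move=> x; apply: (@continuousM R R (fun x => m * P x) (fun x => (wt mu (T x))^-1)).
  by apply: (@continuousM R R (cst m) P); [exact: cst_continuous|exact: cP].
apply: (@continuousV R R (fun x => wt mu (T x))).
  by rewrite gt_eqF// wt_gt0// transport_bnd.
by apply: (@continuous_comp R R R T (wt mu)); [exact: transport_cont|exact: wt_cont].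
Qed.

Lemma transport_derive x : a < x -> x < Y -> is_derive x (1:R) T (transport' x).
Proof.
move=> ax xY.
apply: (@near_eq_is_derive R R R (fun t => Psiinv mu (m * (n t + e)))).
  near=> t; rewrite /T /transport min_l//; apply: ltW; near: t; exact: lt_nbhsl.
have -> : transport' x = - (wt mu (T x))^-1 * (m * (- P x)) by rewrite /transport'; ring.
have Tx : T x = Psiinv mu (m * (n x + e)) by rewrite /T /transport min_l// ltW.
rewrite Tx; apply: (@is_derive1_comp R (Psiinv mu) (fun t => m * (n t + e))).
  by apply: Psiinv_derive => //; have := transport_arg' x; rewrite min_l// ltW.
have -> : m * - P x = m *: (- P x + 0) by rewrite addr0.
apply: (@is_deriveZ R R R (fun t => n t + e)); apply: (@is_deriveD R R R n (cst e)).
exact: (tailmass_derive hl mu0 ax).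
Unshelve. all: by end_near. Qed.

Lemma transport_primitive : is_primitive a Y T transport'.
Proof.
by apply: primitive_C1; [exact: transport_cont|exact: transport'_cont|exact: transport_derive].
Qed.

Definition young_deficit x : R :=
  k ^+ 2 * (1 - T x ^+ 2) * rho x + k * transport' x * rho x
  - gns_const mu k * m `^ (mu / (mu + 1)) * P x.

Lemma young_deficit_ge0 x : 0 <= young_deficit x.
Proof.
rewrite subr_ge0.
by have [] := young_profile mu0 k0 m0 (sqsum_ge0 A B x) (transport_bnd x).
Qed.

Lemma young_deficit_eq0 x : young_deficit x = 0 ->
  rho x = 0 \/ transport' x = mu * k * (1 - T x ^+ 2).
Proof.
move/eqP; rewrite subr_eq0 => /eqP/esym.
by have [_] := young_profile mu0 k0 m0 (sqsum_ge0 A B x) (transport_bnd x).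
Qed.

Definition square_deficit x : R :=
  (Ga x + k * T x * A x) ^+ 2 + (Gb x + k * T x * B x) ^+ 2.

Lemma square_deficit_ge0 x : 0 <= square_deficit x.
Proof. by rewrite addr_ge0 ?sqr_ge0. Qed.

Lemma young_deficit_cont : continuous young_deficit.
Proof.
have cT := transport_cont; have cT' := transport'_cont.
have cP : continuous P := sqsum_powR_cont mu0 (hl_contA hl) (hl_contB hl).
have cr : continuous rho := sqsum_cont (hl_contA hl) (hl_contB hl).
have cc (c : R) : continuous (cst c : R -> R) by move=> t; exact: cst_continuous.
have cT2 : continuous (fun x => 1 - T x ^+ 2).
  move=> x; apply: (@continuousB R R R (cst 1) (fun x => T x ^+ 2)); first exact: cc.
  by apply: (@continuous_comp R R R T (fun y => y ^+ 2)); [exact: cT|exact: exprn_continuous].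
move=> x.
apply: (@continuousB R R R (fun x => k ^+ 2 * (1 - T x ^+ 2) * rho x + k * transport' x * rho x)
  (fun x => gns_const mu k * m `^ (mu / (mu + 1)) * P x)).
  apply: (@continuousD R R R (fun x => k ^+ 2 * (1 - T x ^+ 2) * rho x) (fun x => k * transport' x * rho x)).
    apply: (@continuousM R R (fun x => k ^+ 2 * (1 - T x ^+ 2)) rho); last exact: cr.
    by apply: (@continuousM R R (cst (k ^+ 2)) (fun x => 1 - T x ^+ 2)); [exact: cc|exact: cT2].
  apply: (@continuousM R R (fun x => k * transport' x) rho); last exact: cr.
  by apply: (@continuousM R R (cst k) transport'); [exact: cc|exact: cT'].
by apply: (@continuousM R R (cst (gns_const mu k * m `^ (mu / (mu + 1)))) P); [exact: cc|exact: cP].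
Qed.

Lemma square_deficit_L1 : L1 `[a, Y] square_deficit.
Proof.
have cT := transport_cont.
have cr : continuous rho := sqsum_cont (hl_contA hl) (hl_contB hl).
have cT2 : continuous (fun x => k ^+ 2 * T x ^+ 2 * rho x).
  move=> x; apply: (@continuousM R R (fun x => k ^+ 2 * T x ^+ 2) rho); last exact: cr.
  apply: (@continuousM R R (cst (k ^+ 2)) (fun x => T x ^+ 2)); first exact: cst_continuous.
  by apply: (@continuous_comp R R R T (fun y => y ^+ 2)); [exact: cT|exact: exprn_continuous].
pose f (x : R) : R := sqsum Ga Gb x + k ^+ 2 * T x ^+ 2 * rho x
  + k * ((2 * (A x * Ga x + B x * Gb x)) * T x).
apply: (@L1_eq _ _ f) => //.
  by move=> x _; rewrite /f /square_deficit /rho /sqsum; ring.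
apply: L1D => //; last first.
  by apply: L1Z => //; apply: L1_mul_cont => //; exact: (sqsum_primitive hl Y).1.
apply: L1D => //; first exact: L1_tail_seg (hl_L1G hl) (lexx _).
exact: L1_cont.
Qed.

(** Completing the square leaves - k T rho' + k^2 (1 - T^2) rho. Integrating the first term by
    parts, - k T rho' = - k (T rho)' + k T' rho, produces the boundary terms and the right-hand side
    of Young's inequality. *)
Lemma energy_identity :
  \int[leb]_(x in `[a, Y]) (sqsum Ga Gb x + k ^+ 2 * rho x) =
  k * (T0 * rho a - T Y * rho Y)
  + gns_const mu k * m `^ (mu / (mu + 1)) * (mass mu A B a - n Y)
  + \int[leb]_(x in `[a, Y]) square_deficit x + \int[leb]_(x in `[a, Y]) young_deficit x.
Proof.
have cr : continuous rho := sqsum_cont (hl_contA hl) (hl_contB hl).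
have cP : continuous P := sqsum_powR_cont mu0 (hl_contA hl) (hl_contB hl).
have pr := primitiveM transport_cont cr transport_primitive (sqsum_primitive hl Y).
have E1 := primitiveB pr (lexx _) aY (lexx _).
set h := (fun x => _ + _) in pr E1.
have i1 := square_deficit_L1.
have i2 : L1 `[a, Y] young_deficit by exact/L1_cont/young_deficit_cont.
have i3 : L1 `[a, Y] P by exact: L1_cont.
have -> : mass mu A B a - n Y = \int[leb]_(x in `[a, Y]) P x.
  by rewrite /n /tailmass opprB addrC subrK.
have -> : T0 * rho a - T Y * rho Y = - \int[leb]_(x in `[a, Y]) h x.
  by rewrite -E1 transport_start; ring.
rewrite mulrN -mulNr -!RintegralZl//; last exact: pr.1.
rewrite -!RintegralD//.
- apply: eq_Rintegral => x _; rewrite /h /young_deficit /square_deficit /rho /sqsum; ring.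
- by apply: L1D => //; [apply: L1D => //; [apply: L1Z => //; exact: pr.1|exact: L1Z]].
- by apply: L1D => //; [apply: L1Z => //; exact: pr.1|exact: L1Z].
- by apply: L1Z => //; exact: pr.1.
- exact: L1Z.
Qed.

End Transport.

(** * The sharp half-line inequality *)

Section HalfLineIneq.
Context {R : realType}.
Implicit Types (A B Ga Gb : R -> R) (a mu k T : R).

Definition gns_value mu k T N : R :=
  gns_const mu k * Psi mu T `^ (mu / (mu + 1)) * N `^ (mu + 1)^-1.

Lemma ltr_squeeze (c d : R) : (forall s, 0 < s < 1 -> s * c <= d) -> c <= d.
Proof.
move=> H; rewrite leNgt; apply/negP => dc.
have h1 := H 2^-1; have {}h1 : 2^-1 * c <= d by apply: h1; lra.
have c0 : 0 < c by lra.
have := H ((d + c) / (2 * c)).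
have -> : (d + c) / (2 * c) * c = (d + c) / 2 by field; rewrite gt_eqF.
have -> : 0 < (d + c) / (2 * c) < 1.
  by apply/andP; split; [rewrite divr_gt0; lra|rewrite ltr_pdivrMr; lra].
by move=> /(_ isT); lra.
Qed.

Lemma halfline_transport_ineq a A B Ga Gb mu k T0 (e : R) :
  halfline a A B Ga Gb -> 0 < mu -> 0 < k -> -1 < T0 < 1 -> 0 < e ->
  k * T0 * sqsum A B a + gns_const mu k *
    (Psi mu T0 / (mass mu A B a + e)) `^ (mu / (mu + 1)) * mass mu A B a
  <= energy k A B Ga Gb a.
Proof.
move=> hl mu0 k0 hT0 e0.
set N := mass mu A B a; set m := Psi mu T0 / (N + e).
have N0 : 0 <= N by exact: mass_ge0.
have Ne0 : 0 < N + e by rewrite ltr_wpDl.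
have m0 : 0 < m by rewrite divr_gt0// Psi_gt0//; lra.
set C := gns_const mu k * _.
have C0 : 0 < C by rewrite mulr_gt0 ?powR_gt0// gns_const_gt0.
apply/ler_addgt0Pr => d d0.
(* Truncation at [Y] loses at most k rho(Y) and C times the mass beyond [Y]; with both quantities
   below [d1] the total loss is at most [d]. *)
pose d1 := d / (k + C).
have kC0 : 0 < k + C by rewrite addr_gt0.
have d10 : 0 < d1 by rewrite divr_gt0.
have [X aX HX] := tail_small (mass_L1 hl mu0) (fun x _ => powR_ge0 _ _) d10.
have [Y [aY XY rY]] := L1_small_value X (hl_L1 hl) (fun x _ => sqsum_ge0 _ _ x) d10.
have nYE := tailmassE hl mu0 aY.
have nY0 : 0 <= mass mu A B Y by exact: mass_ge0.
have nY : 0 < tailmass a A B mu Y + e by rewrite nYE ltr_wpDl.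
have hm : m * (N + e) = Psi mu T0 by rewrite /m divfK// gt_eqF.
have E := energy_identity k hl mu0 hT0 m0 aY nY hm.
have g0 x : a <= x -> 0 <= sqsum Ga Gb x + k ^+ 2 * sqsum A B x.
  by move=> _; rewrite addr_ge0 ?sqsum_ge0// mulr_ge0 ?sqr_ge0// sqsum_ge0.
have := Rintegral_seg_le_tail (energy_L1 k hl) g0 aY.
rewrite -/(energy k A B Ga Gb a) E -/C -/N nYE.
set S := \int[leb]_(x in _) _; set D := \int[leb]_(x in _) _.
have S0 : 0 <= S by apply: Rintegral_ge0 => x _; exact: square_deficit_ge0.
have D0 : 0 <= D.
  by apply: Rintegral_ge0 => x _; exact: (young_deficit_ge0 hl mu0 k0 hT0 m0 nY hm).
have /andP[t1 t2] := transport_bnd hl mu0 hT0 m0 nY hm Y.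
set t := transport _ _ _ _ _ _ _ _ in t1 t2 *.
have r0 := sqsum_ge0 A B Y.
have dE : d = k * d1 + C * d1 by rewrite /d1; field; rewrite gt_eqF.
have nlt : mass mu A B Y < d1 by exact: HX.
have h1 : C * mass mu A B Y <= C * d1 by rewrite ler_pM2l// ltW.
have h2 : k * (t * sqsum A B Y) <= k * d1.
  by rewrite ler_pM2l//; nra.
lra.
Qed.

Lemma halfline_ineq_open a A B Ga Gb mu k T0 :
  halfline a A B Ga Gb -> 0 < mu -> 0 < k -> -1 < T0 < 1 ->
  k * T0 * sqsum A B a + gns_value mu k T0 (mass mu A B a) <= energy k A B Ga Gb a.
Proof.
move=> hl mu0 k0 hT0.
set N := mass mu A B a.
have : 0 <= N by exact: mass_ge0.
have mu1 : 0 < mu + 1 by rewrite addr_gt0.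
rewrite le_eqVlt => /predU1P[N0|N0].
  have := halfline_transport_ineq hl mu0 k0 hT0 ltr01.
  by rewrite -/N /gns_value -N0 !mulr0 powR0 ?mulr0// invr_eq0 gt_eqF.
rewrite addrC -lerBrDr; apply: ltr_squeeze => s /andP[s0 s1].
rewrite lerBrDr addrC.
have th0 : 0 < mu / (mu + 1) by rewrite divr_gt0.
(* The slack N / l - N divides the transport factor by 1 / l, and [l] is the number whose power
   mu/(mu+1) is [s]: the bound with slack is exactly [s] times the desired one, and s tends to 1. *)
pose l := s `^ (mu / (mu + 1))^-1.
have l0 : 0 < l by exact: powR_gt0.
have l1 : l < 1.
  have -> : 1 = 1 `^ (mu / (mu + 1))^-1 :> R by rewrite powR1.
  by apply: gt0_ltr_powR => //; rewrite ?nnegrE ?invr_gt0// ltW.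
have e0 : 0 < N / l - N by rewrite subr_gt0 ltr_pdivlMr// gtr_pMr.
have := halfline_transport_ineq hl mu0 k0 hT0 e0.
rewrite -/N (_ : N + (N / l - N) = N / l); last by ring.
apply: le_trans; rewrite lerD2l /gns_value.
rewrite le_eqVlt; apply/orP; left; apply/eqP.
have P0 : 0 <= Psi mu T0 by apply: Psi_ge0 => //; lra.
have -> : Psi mu T0 / (N / l) = l * (Psi mu T0 * N^-1) by rewrite invf_div; ring.
rewrite !powRM ?mulr_ge0 ?invr_ge0// ?ltW//.
rewrite -powRrM mulVf ?gt_eqF// powRr1; last exact: ltW.
have -> : N `^ (mu + 1)^-1 = N^-1 `^ (mu / (mu + 1)) * N; last by ring.
have [x <-] := expR_total N0.
rewrite !powR_expRE; congr expR; field; exact: lt0r_neq0.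
Qed.

Lemma gns_value_ge0 mu k T N : 0 < mu -> 0 < k -> 0 <= gns_value mu k T N.
Proof. by move=> mu0 k0; rewrite /gns_value mulr_ge0 ?powR_ge0// mulr_ge0 ?powR_ge0// ltW// gns_const_gt0. Qed.

(** At T = 1 the term with Psi vanishes and the bound is a limit from below. For T <= -1 it follows
    from the case T = -1, itself a limit from above, since Psi is constant there while k T |u(0)|^2
    only decreases with T. *)
Lemma halfline_ineq a A B Ga Gb mu k T :
  halfline a A B Ga Gb -> 0 < mu -> 0 < k -> T <= 1 ->
  k * T * sqsum A B a + gns_value mu k T (mass mu A B a) <= energy k A B Ga Gb a.
Proof.
move=> hl mu0 k0.
have th0 : 0 < mu / (mu + 1) by rewrite divr_gt0// addr_gt0.
set N := mass mu A B a; set r := sqsum A B a; set E := energy k A B Ga Gb a.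
have r0 : 0 <= r by exact: sqsum_ge0.
have op T0 := @halfline_ineq_open a A B Ga Gb mu k T0 hl mu0 k0.
rewrite le_eqVlt => /predU1P[->|T1].
  rewrite /gns_value Psi1 powR0 ?gt_eqF// mulr0 mul0r addr0 mulr1.
  apply: ltr_squeeze => s hs; have hs' : -1 < s < 1 by lra.
  have := op s hs'; have := gns_value_ge0 s N mu0 k0; rewrite -/r -/N -/E.
  by move: (gns_value _ _ _ _) => g g0; lra.
have [T2|T2] := ltP (-1) T; first by apply: op; rewrite T2.
(* The truncation at 0 changes nothing for [t <= 1], where [Psi] is nonnegative, and makes [h]
   continuous on the whole line. *)
pose h (t : R) : R := E - k * t * r - gns_const mu k * Num.max 0 (Psi mu t) `^ (mu / (mu + 1)) * N `^ (mu + 1)^-1.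
have hE t : t <= 1 -> h t = E - (k * t * r + gns_value mu k t N).
  by move=> t1; rewrite /h /gns_value max_r ?Psi_ge0//; ring.
have ch : continuous h.
  have cc (c : R) : continuous (cst c : R -> R) by move=> t; exact: cst_continuous.
  move=> t; apply: (@continuousB R R R (fun t => E - k * t * r)).
    apply: (@continuousB R R R (cst E) (fun t => k * t * r)); first exact: cc.
    apply: (@continuousM R R (fun t => k * t) (cst r)); last exact: cc.
    by apply: (@continuousM R R (cst k) id); [exact: cc|exact: cvg_id].
  apply: (@continuousM R R (fun t => gns_const mu k * Num.max 0 (Psi mu t) `^ (mu / (mu + 1))) (cst (N `^ (mu + 1)^-1))); last exact: cc.
  apply: (@continuousM R R (cst (gns_const mu k)) (fun t => Num.max 0 (Psi mu t) `^ (mu / (mu + 1)))); first exact: cc.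
  apply: continuous_powR => //; last by move=> y; rewrite le_max lexx.
  by move=> y; apply: (@continuous_max R R (cst 0) (Psi mu)); [exact: cc|exact: Psi_cont].
have h1 : 0 <= h (-1).
  rewrite leNgt; apply/negP => h0.
  have /cvgrPdist_lt/(_ (- h (-1))) := ch (-1); rewrite oppr_gt0 => /(_ h0)[d /= d0 H].
  pose t := -1 + Num.min (d / 2) 1.
  have m0 : 0 < Num.min (d / 2) 1 by rewrite lt_min ltr01 andbT; lra.
  have m1 : Num.min (d / 2) 1 <= 1 by rewrite ge_min lexx orbT.
  have md : Num.min (d / 2) 1 < d by rewrite gt_min; apply/orP; left; lra.
  have t1 : -1 < t < 1 by rewrite /t; lra.
  have := H t; rewrite /ball_/= /t.
  have -> : -1 - (-1 + Num.min (d / 2) 1) = - Num.min (d / 2) 1 by ring.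
  rewrite normrN gtr0_norm// => /(_ md); rewrite -/t => ht.
  have := op t t1; rewrite -/r -/N -/E -subr_ge0 -hE; last lra.
  by move: ht; rewrite ltr_norml => /andP[]; move: (h t) (h (-1)); clear; move=> u w; lra.
have := hE (-1); rewrite /gns_value -(Psi_out mu0 T2) => H.
have {}H : h (-1) = E - (k * -1 * r + gns_value mu k T N) by apply: H; lra.
rewrite {}H in h1; clear hE ch h op.
have : k * T * r <= k * -1 * r by rewrite ler_wpM2r// ler_pM2l.
rewrite -/(gns_value mu k T N); move: (gns_value _ _ _ _) h1 => g; lra.
Qed.

End HalfLineIneq.

(** * Hyperbolic functions and the soliton shape *)

Section Hyperbolic.
Context {R : realType}.
Implicit Types (x y t : R).

Lemma cosh_gt0 x : 0 < cosh x.
Proof. by rewrite divr_gt0 ?addr_gt0 ?expR_gt0. Qed.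

Lemma tanhE x : tanh x = 1 - 2 / (expR (2 * x) + 1).
Proof.
rewrite /tanh expRN (_ : 2 * x = x + x); last by ring.
rewrite expRD; have e0 := expR_gt0 x.
move: (expR x) e0 => e e0; field.
by rewrite !gt_eqF//; nra.
Qed.

Lemma tanh_bnd x : -1 < tanh x < 1.
Proof.
rewrite tanhE; have e0 := expR_gt0 (2 * x); move: (expR (2 * x)) e0 => e e0.
have h : 0 < 2 / (e + 1) by rewrite divr_gt0//; lra.
have h2 : 2 / (e + 1) < 2 by rewrite ltr_pdivrMr; nra.
lra.
Qed.

Lemma tanh_le x y : x <= y -> tanh x <= tanh y.
Proof.
move=> xy; rewrite !tanhE lerD2l lerN2 ler_pM2l// lef_pV2 ?posrE ?ltr_wpDl ?expR_ge0//.
by rewrite lerD2r ler_expR ler_pM2l.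
Qed.

Lemma tanh_char t y : 1 + t = expR (2 * y) * (1 - t) -> t = tanh y.
Proof.
rewrite tanhE; have e0 := expR_gt0 (2 * y); move: (expR (2 * y)) e0 => e e0 E.
have : t * (e + 1) = e - 1 by lra.
have e1 : e + 1 != 0 by rewrite gt_eqF//; lra.
by move=> H; apply: (mulIf e1); rewrite H; field.
Qed.

Lemma tanh_charE y : 1 + tanh y = expR (2 * y) * (1 - tanh y).
Proof.
rewrite tanhE; have e0 := expR_gt0 (2 * y); move: (expR (2 * y)) e0 => e e0.
by field; rewrite gt_eqF//; lra.
Qed.

Lemma tanh_surj t : -1 < t < 1 -> exists y, tanh y = t.
Proof.
move=> /andP[t1 t2].
have h : 0 < (1 + t) / (1 - t) by rewrite divr_gt0; lra.
have [y yE] := expR_total h; exists (y / 2); apply/esym/tanh_char.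
rewrite (_ : 2 * (y / 2) = y); last by field.
by rewrite yE divfK// gt_eqF//; lra.
Qed.

Lemma sech2E x : 1 - tanh x ^+ 2 = (cosh x ^+ 2)^-1.
Proof.
rewrite /tanh /cosh expRN; have e0 := expR_gt0 x.
move: (expR x) e0 => e e0; field.
by rewrite !gt_eqF//; nra.
Qed.

Lemma is_derive_cosh x : is_derive x (1:R) (@cosh R) (tanh x * cosh x).
Proof.
have -> : tanh x * cosh x = 2^-1 *: (expR x + expR (- x) * (-1)).
  rewrite /tanh /cosh -[_ *: _]/(_ * _); field.
  by rewrite gt_eqF// addr_gt0 ?expR_gt0.
have -> : @cosh R = 2^-1 \*: (fun x => expR x + expR (- x)).
  by apply/funext => t; rewrite /cosh mulrC.
by apply: is_deriveZ; apply: is_deriveD.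
Qed.

Lemma is_derive_tanh x : is_derive x (1:R) (@tanh R) (1 - tanh x ^+ 2).
Proof.
pose g (x : R) : R := (expR (2 * x) + 1)^-1.
have e1 (y : R) : expR (2 * y) + 1 != 0 by rewrite gt_eqF// ltr_wpDl ?expR_ge0.
have -> : 1 - tanh x ^+ 2 = 0 - 2 *: (- (expR (2 * x) + 1) ^- 2 *: (expR (2 * x) * (2 * 1) + 0)).
  by rewrite tanhE -![_ *: _]/(_ * _); field; exact: e1.
have -> : @tanh R = cst 1 - 2 \*: g.
  by apply/funext => t; rewrite tanhE.
apply: is_deriveB; apply: is_deriveZ.
apply: (@is_deriveV R (fun x => expR (2 * x) + 1)) => //.
Qed.

Lemma const_on_segment (f : R -> R) a b : continuous f ->
  (forall x, a < x -> x < b -> is_derive x (1:R) f 0) ->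
  forall x, a <= x -> x <= b -> f x = f a.
Proof.
move=> cf df x; rewrite le_eqVlt => /predU1P[->//|ax] xb.
have [||c _] := @MVT R f (cst 0) a x ax.
- by move=> y; rewrite in_itv/= => /andP[ay yx]; apply: df => //; exact: lt_le_trans xb.
- exact: continuous_subspaceT.
by rewrite mul0r => /eqP; rewrite subr_eq0 => /eqP.
Qed.

(** The soliton divided by its amplitude, k being the square root of omega. *)
Definition sech_profile mu k x : R := cosh (mu * k * x) `^ (- (1 / mu)).

Lemma sech_profile_gt0 mu k x : 0 < sech_profile mu k x.
Proof. by rewrite powR_gt0// cosh_gt0. Qed.

Lemma is_derive_sech_profile mu k x : mu != 0 ->
  is_derive x (1:R) (sech_profile mu k) (- k * tanh (mu * k * x) * sech_profile mu k x).
Proof.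
move=> mu0; have c0 := cosh_gt0 (mu * k * x).
have -> : - k * tanh (mu * k * x) * sech_profile mu k x =
  (- (1 / mu) * cosh (mu * k * x) `^ (- (1 / mu) - 1)) *
    ((tanh (mu * k * x) * cosh (mu * k * x)) * (mu * k)).
  rewrite /sech_profile powRB; last by rewrite (gt_eqF c0) implybT.
  by rewrite powRr1 ?ltW//; field; rewrite mu0 gt_eqF.
apply: (@is_derive1_comp R (fun y => y `^ (- (1 / mu))) (fun x => cosh (mu * k * x))).
  exact: is_derive1_powR.
apply: (@is_derive1_comp R (@cosh R) (fun x => mu * k * x)).
  exact: is_derive_cosh.
rewrite -[X in is_derive _ _ _ X]mulr1.
exact: (@is_deriveZ R R R id (mu * k)).
Qed.

End Hyperbolic.

(** * The equality case *)
Section ZeroIntegrals.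
Context {R : realType}.
Implicit Types (f g s : R -> R) (a b x y : R).

Lemma Rintegral_sub_le s a b x y : L1 `[a, b] s -> (forall t, 0 <= s t) ->
  a <= x -> x <= y -> y <= b ->
  \int[leb]_(t in `[x, y]) s t <= \int[leb]_(t in `[a, b]) s t.
Proof.
move=> si s0 ax xy yb; have ay := le_trans ax xy; have xb := le_trans xy yb.
rewrite (Rintegral_split ax xb si) (@Rintegral_split _ s x y b)//; last exact: L1_sub_itv si _ _.
have h1 : 0 <= \int[leb]_(t in `[a, x]) s t by exact: Rintegral_ge0.
have h2 : 0 <= \int[leb]_(t in `[y, b]) s t by exact: Rintegral_ge0.
by rewrite addrCA lerDl addr_ge0.
Qed.

Lemma zero_integral_cont f a b : continuous f -> (forall x, 0 <= f x) ->
  \int[leb]_(t in `[a, b]) f t = 0 -> forall x, a < x -> x < b -> f x = 0.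
Proof.
move=> cf f0 I0 x ax xb.
have [|d1 d2] := @continuous_FTC1_closed R f a x b xb (L1_cont (f := f) _ _ cf) ax.
  exact: cf.
pose F (y : R) : R := \int[leb]_(t in `[a, y]) f t.
have F0 : is_derive x (1:R) F 0.
  apply: (@near_eq_is_derive R R R (cst 0)).
  near=> y.
  have ay : a <= y by apply/ltW; near: y; exact: lt_nbhsr.
  have yb : y <= b by apply/ltW; near: y; exact: lt_nbhsl.
  apply/eqP; rewrite eq_sym eq_le; apply/andP; split; last exact: Rintegral_ge0.
  by rewrite -[leRHS]I0; apply: Rintegral_sub_le => //; exact: L1_cont.
by rewrite -d2 derive1E; have [_ ->] := F0.
Unshelve. all: by end_near. Qed.

(** In place of the Cauchy-Schwarz inequality, |g| <= c + s / c with [c] arbitrarily small. *)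
Lemma zero_integral_of_square g s a b x y : L1 `[a, b] s -> (forall t, 0 <= s t) ->
  \int[leb]_(t in `[a, b]) s t = 0 -> L1 `[x, y] g -> (forall t, g t ^+ 2 <= s t) ->
  a <= x -> x <= y -> y <= b -> \int[leb]_(t in `[x, y]) g t = 0.
Proof.
move=> si s0 I0 gi gs ax xy yb.
have sxy : L1 `[x, y] s by exact: L1_sub_itv si _ _.
have J0 : \int[leb]_(t in `[x, y]) s t = 0.
  apply/eqP; rewrite eq_le Rintegral_ge0// andbT -I0.
  exact: Rintegral_sub_le.
apply/eqP; rewrite -normr_le0; apply/ler_addgt0Pr => e e0; rewrite add0r.
pose c := e / (y - x + 1).
have yx1 : 0 < y - x + 1 by lra.
have c0 : 0 < c by rewrite divr_gt0.
have ic : L1 `[x, y] (fun=> c) by apply: L1_cont; exact: cst_continuous.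
apply: le_trans (@Rintegral_norm_le _ g (fun t => c + c^-1 * s t) _ _ _ _ _) _ => //.
- by apply: L1D => //; exact: L1Z.
- move=> t _; apply: le_trans (_ : c + c^-1 * g t ^+ 2 <= _); last first.
    by rewrite lerD2l ler_pM2l ?invr_gt0.
  have : 0 <= c^-1 * (`|g t| - c) ^+ 2 by rewrite mulr_ge0 ?sqr_ge0// invr_ge0 ltW.
  have -> : c^-1 * (`|g t| - c) ^+ 2 = c + c^-1 * g t ^+ 2 - 2 * `|g t|.
    by rewrite -(real_normK (num_real (g t))); field; rewrite gt_eqF.
  by have := normr_ge0 (g t); lra.
rewrite RintegralD//; [|exact: L1Z].
rewrite [X in _ + X]RintegralZl// J0 mulr0 addr0 Rintegral_cst//= lebesgue_measure_itv/= lte_fin.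
case: ifPn => _ /=; last by rewrite mulr0 ltW.
by rewrite /c -mulrA ger_pMr// mulrC ler_pdivrMr// mul1r lerDl.
Qed.

End ZeroIntegrals.

Section EqualityTransport.
Context {R : realType} (a : R) (A B Ga Gb : R -> R) (mu k T0 : R).
Hypotheses (hl : halfline a A B Ga Gb) (mu0 : 0 < mu) (k0 : 0 < k) (hT0 : -1 < T0 < 1).
Let N := mass mu A B a.
Hypothesis N0 : 0 < N.
Hypothesis heq : k * T0 * sqsum A B a + gns_value mu k T0 N = energy k A B Ga Gb a.

Let m := Psi mu T0 / N.
(** The slack is 0 here, so positivity of the mass beyond [Y] is assumed in each lemma;
    [equality_mass_gt0] finally proves it for every [Y]. *)
Let T Y := transport a A B mu m 0 Y.

Let Psi0 : 0 < Psi mu T0. Proof. by apply: Psi_gt0 => //; case/andP: hT0. Qed.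
Let m0 : 0 < m. Proof. by rewrite divr_gt0. Qed.
Let hm : m * (mass mu A B a + 0) = Psi mu T0.
Proof. by rewrite addr0 /m divfK// gt_eqF. Qed.

Let gns_valueE t M : 0 < M -> Psi mu t = m * M ->
  gns_value mu k t M = gns_const mu k * m `^ (mu / (mu + 1)) * M.
Proof.
move=> M0 E; rewrite /gns_value E powRM ?ltW//.
move: (gns_const mu k) => C; rewrite -!mulrA; congr (_ * (_ * _)).
have mu1 : mu + 1 != 0 by rewrite gt_eqF// addr_gt0.
have [x <-] := expR_total M0.
by rewrite !powR_expRE; congr expR; field.
Qed.

(** The energy identity on [a, Y] is added to the half-line inequality on [Y, +oo[ at the
    transported parameter. Since Psi (T Y) is [m] times the mass beyond [Y], both values of
    [gns_value] are the same multiple of the mass, everything cancels against [heq], and the sum of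
    the two deficits is at most 0. *)
Lemma equality_deficits Y : a <= Y -> 0 < mass mu A B Y ->
  \int[leb]_(x in `[a, Y]) square_deficit a A B Ga Gb mu k m 0 Y x = 0 /\
  \int[leb]_(x in `[a, Y]) young_deficit a A B mu k m 0 Y x = 0.
Proof.
move=> aY MY; have nE := tailmassE hl mu0 aY.
have nY : 0 < tailmass a A B mu Y + 0 by rewrite nE addr0.
have E := energy_identity k hl mu0 hT0 m0 aY nY hm.
have EE : energy k A B Ga Gb a = \int[leb]_(x in `[a, Y]) (sqsum Ga Gb x + k ^+ 2 * sqsum A B x)
   + energy k A B Ga Gb Y by rewrite /energy (Rintegral_tail (energy_L1 k hl) aY).
have /andP[_ /ltW t1] := transport_bnd hl mu0 hT0 m0 nY hm Y.
have := halfline_ineq (halfline_sub aY hl) mu0 k0 t1.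
have PT := Psi_transport hl mu0 hT0 m0 nY hm Y.
rewrite minxx addr0 nE in PT.
rewrite (gns_valueE MY PT).
move: heq; rewrite EE E (gns_valueE (t := T0) N0); last by rewrite /m divfK// gt_eqF.
rewrite nE -/N.
set S := \int[leb]_(x in _) _; set D := \int[leb]_(x in _) _.
have S0 : 0 <= S by apply: Rintegral_ge0 => x _; exact: square_deficit_ge0.
have D0 : 0 <= D.
  by apply: Rintegral_ge0 => x _; exact: (young_deficit_ge0 hl mu0 k0 hT0 m0 nY hm).
move=> h1 h2; suff : S + D <= 0 by split; apply/eqP; rewrite eq_le; lra.
lra.
Qed.

(** The vanishing square says u' = - k T u almost everywhere, which is recorded in integral form. *)
Lemma equality_ODE Y x y : a <= x -> x <= y -> y <= Y -> 0 < mass mu A B Y ->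
  A y - A x = \int[leb]_(t in `[x, y]) (- (k * T Y t * A t)) /\
  B y - B x = \int[leb]_(t in `[x, y]) (- (k * T Y t * B t)).
Proof.
move=> ax xy yY MY; have aY : a <= Y by apply: le_trans yY; exact: le_trans xy.
have [S0 _] := equality_deficits aY MY.
have nE := tailmassE hl mu0 aY.
have nY : 0 < tailmass a A B mu Y + 0 by rewrite nE addr0.
have cT := transport_cont hl mu0 hT0 m0 nY hm.
have key (F f : R -> R) : continuous F -> is_primitive a y F f ->
   (forall t, (f t + k * T Y t * F t) ^+ 2 <= square_deficit a A B Ga Gb mu k m 0 Y t) ->
   F y - F x = \int[leb]_(t in `[x, y]) (- (k * T Y t * F t)).
  move=> cF Ff sq.
  have fi : L1 `[x, y] f := primitive_L1 Ff ax (lexx _).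
  have hi : L1 `[x, y] (fun t => k * T Y t * F t).
    apply: L1_cont => t; apply: (@continuousM R R (fun t => k * T Y t) F); last exact: cF.
    by apply: (@continuousM R R (cst k) (T Y)); [exact: cst_continuous|exact: cT].
  rewrite (primitiveB Ff)//; apply/eqP; rewrite -subr_eq0 -RintegralB//; last exact: L1N.
  apply/eqP; apply: (zero_integral_of_square (square_deficit_L1 k hl mu0 hT0 m0 nY hm)) => //.
  - by move=> t; exact: square_deficit_ge0.
  - by apply: L1B => //; exact: L1N.
  - by move=> t; rewrite opprK.
split; [apply: (key A Ga)|apply: (key B Gb)] => //.
- exact: hl_contA hl.
- exact: hl_primA hl y.
- by move=> t; rewrite /square_deficit lerDl sqr_ge0.
- exact: hl_contB hl.
- exact: hl_primB hl y.
- by move=> t; rewrite /square_deficit lerDr sqr_ge0.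
Qed.

(** Equality in Young's inequality leaves two values for the continuous quotient [q] of T' by 1 -
    T^2, namely 0 and mu k, so it is constant by the intermediate value theorem. If it were 0, T
    would be constant and the mass beyond [Y] would still be [N]. *)
Lemma equality_transport_ODE Y x : 0 < mass mu A B Y -> mass mu A B Y < N -> a < x -> x < Y ->
  transport' a A B mu m 0 Y x = mu * k * (1 - T Y x ^+ 2).
Proof.
move=> MY MN ax xY; have aY : a <= Y by rewrite ltW// (lt_trans ax).
have [_ D0] := equality_deficits aY MY.
have nE := tailmassE hl mu0 aY.
have nY : 0 < tailmass a A B mu Y + 0 by rewrite nE addr0.
have cT := transport_cont hl mu0 hT0 m0 nY hm.
have cT' := transport'_cont hl mu0 hT0 m0 nY hm.
have tb := transport_bnd hl mu0 hT0 m0 nY hm.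
pose T' := transport' a A B mu m 0 Y.
pose q t := T' t / (1 - T Y t ^+ 2).
have al t : 0 < 1 - T Y t ^+ 2 by have := tb t; rewrite -/(T Y); nra.
have dich t : a < t -> t < Y -> T' t = 0 \/ T' t = mu * k * (1 - T Y t ^+ 2).
  move=> alt tY.
  have := zero_integral_cont (@young_deficit_cont _ _ _ _ _ _ _ k hl mu0 _ _ _ _ hT0 m0 nY hm)
    (fun t => young_deficit_ge0 hl mu0 k0 hT0 m0 nY hm t) D0 alt tY.
  move/(young_deficit_eq0 hl mu0 k0 hT0 m0 nY hm) => [r0|]; last by right.
  by left; rewrite /T' /transport' r0 powR0 ?mulr0 ?mul0r// gt_eqF// addr_gt0.
have cq : continuous q.
  move=> u; apply: (@continuousM R R T' (fun t => (1 - T Y t ^+ 2)^-1)); first exact: cT'.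
  apply: (@continuousV R R (fun t => 1 - T Y t ^+ 2)); first by rewrite gt_eqF.
  apply: (@continuousB R R R (cst 1) (fun x => T Y x ^+ 2)); first exact: cst_continuous.
  by apply: (@continuous_comp R R R (T Y) (fun y => y ^+ 2)); [exact: cT|exact: exprn_continuous].
have mk0 : 0 < mu * k by rewrite mulr_gt0.
have qd t : a < t -> t < Y -> q t = 0 \/ q t = mu * k.
  move=> h1 h2; have [E|E] := dich t h1 h2; rewrite /q E; [left|right].
    by rewrite mul0r.
  by rewrite mulfK// gt_eqF.
have [h|//] := dich x ax xY.
have qx : q x = 0 by rewrite /q h mul0r.
suff all0 t : a < t -> t < Y -> T' t = 0.
  have E : T Y Y = T Y a.
    apply: (const_on_segment cT) (lexx _) => // t h1 h2.
    have := transport_derive hl mu0 hT0 m0 nY hm h1 h2.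
    by rewrite -[transport' _ _ _ _ _ _ _ t]/(T' t) all0.
  have := Psi_transport hl mu0 hT0 m0 nY hm Y.
  rewrite -/(T Y Y) E minxx /T (transport_start hl mu0 hT0 aY hm) addr0 nE.
  rewrite /m => E2; move: MN.
  have -> : mass mu A B Y = N; last by rewrite ltxx.
  apply: (mulfI (lt0r_neq0 m0)); rewrite -E2 /m divfK// gt_eqF//.
move=> h1 h2.
have [E|E] := qd t h1 h2.
  by apply/eqP; move/eqP: E; rewrite /q mulf_eq0 invr_eq0 (gt_eqF (al t)) orbF.
exfalso.
pose lo := Num.min x t; pose hi := Num.max x t.
have lohi : lo <= hi by rewrite ge_min le_max lexx.
have alo : a < lo by rewrite lt_min ax.
have hiY : hi < Y by rewrite gt_max xY.
have [|c] := @IVT R q lo hi (mu * k / 2) lohi (continuous_subspaceT cq).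
  have mk2 : mu * k / 2 <= mu * k by lra.
  have mk1 : 0 <= mu * k / 2 by lra.
  rewrite /lo /hi; case: (leP x t) => _; rewrite qx E.
    by rewrite (min_l (ltW mk0)) (max_r (ltW mk0)) mk1.
  by rewrite (min_r (ltW mk0)) (max_l (ltW mk0)) mk1.
rewrite in_itv/= => /andP[c1 c2].
by have [->|->] := qd c (lt_le_trans alo c1) (le_lt_trans c2 hiY); lra.
Qed.

End EqualityTransport.

Section EqualityTanh.
Context {R : realType} (a : R) (A B Ga Gb : R -> R) (mu k T0 s0 : R).
Hypotheses (hl : halfline a A B Ga Gb) (mu0 : 0 < mu) (k0 : 0 < k).
Let N := mass mu A B a.
Hypothesis N0 : 0 < N.
Hypothesis hs0 : tanh s0 = T0.
Hypothesis heq : k * T0 * sqsum A B a + gns_value mu k T0 N = energy k A B Ga Gb a.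

Let m := Psi mu T0 / N.
Let T Y := transport a A B mu m 0 Y.

Let hT0 : -1 < T0 < 1. Proof. by rewrite -hs0 tanh_bnd. Qed.
Let Psi0 : 0 < Psi mu T0. Proof. by apply: Psi_gt0 => //; case/andP: hT0. Qed.
Let m0 : 0 < m. Proof. by rewrite divr_gt0. Qed.
Let hm : m * (mass mu A B a + 0) = Psi mu T0.
Proof. by rewrite addr0 /m divfK// gt_eqF. Qed.

Let Th x := tanh (s0 + mu * k * (x - a)).

(** Separation of variables in T' = mu k (1 - T^2): the quotient (1 + T) / (1 - T) is exp (2 artanh
    T) and grows at the rate 2 mu k, so [g] below is constant. *)
Lemma equality_transport_tanh Y x : a <= x -> x <= Y -> 0 < mass mu A B Y -> mass mu A B Y < N ->
  T Y x = Th x.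
Proof.
move=> ax xY MY MN; have aY : a <= Y by exact: le_trans xY.
have nE := tailmassE hl mu0 aY.
have nY : 0 < tailmass a A B mu Y + 0 by rewrite nE addr0.
have cT := transport_cont hl mu0 hT0 m0 nY hm.
have tb := transport_bnd hl mu0 hT0 m0 nY hm.
rewrite -/(T Y) in cT tb.
have nz t : 1 - T Y t != 0 by have := tb t; rewrite -/(T Y t) => h; rewrite gt_eqF//; lra.
pose g t := (1 + T Y t) / (1 - T Y t) * expR (- (2 * (mu * k)) * (t - a)).
have cg : continuous g.
  have c1 : continuous (fun t => 1 - T Y t).
    by move=> t; apply: (@continuousB R R R (cst 1) (T Y)); [exact: cst_continuous|exact: cT].
  have c2 : continuous (fun t => 1 + T Y t).
    by move=> t; apply: (@continuousD R R R (cst 1) (T Y)); [exact: cst_continuous|exact: cT].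
  move=> t; apply: (@continuousM R R (fun t => (1 + T Y t) / (1 - T Y t)) (fun t => expR (- (2 * (mu * k)) * (t - a)))).
    apply: (@continuousM R R (fun t => 1 + T Y t) (fun t => (1 - T Y t)^-1)); first exact: c2.
    by apply: (@continuousV R R (fun t => 1 - T Y t)); [exact: nz|exact: c1].
  apply: (@continuous_comp R R R (fun t => - (2 * (mu * k)) * (t - a)) expR); last exact: continuous_expR.
  apply: (@continuousM R R (cst (- (2 * (mu * k)))) (fun t => t - a)); first exact: cst_continuous.
  by apply: (@continuousB R R R id (cst a)); [exact: cvg_id|exact: cst_continuous].
have dg t : a < t -> t < Y -> is_derive t (1:R) g 0.
  move=> at0 tY; have dT := transport_derive hl mu0 hT0 m0 nY hm at0 tY.
  rewrite (equality_transport_ODE hl mu0 k0 hT0 N0 heq MY MN at0 tY) -/m -/(T Y) in dT.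
  have d1 : is_derive t (1:R) (fun t => 1 + T Y t) (0 + mu * k * (1 - T Y t ^+ 2)).
    exact: (@is_deriveD R R R (cst 1) (T Y)).
  have d2 : is_derive t (1:R) (fun t => 1 - T Y t) (0 - mu * k * (1 - T Y t ^+ 2)).
    exact: (@is_deriveB R R R (cst 1) (T Y)).
  have d3 := @is_deriveV R (fun t => 1 - T Y t) t _ 1 (nz t) d2.
  have d4 : is_derive t (1:R) (fun t => expR (- (2 * (mu * k)) * (t - a)))
     (expR (- (2 * (mu * k)) * (t - a)) * (- (2 * (mu * k)) * (1 - 0))).
    apply: (@is_derive1_comp R expR (fun t => - (2 * (mu * k)) * (t - a))).
  have d5 := @is_deriveM R R (fun t => 1 + T Y t) (fun t => (1 - T Y t)^-1) t 1 _ _ d1 d3.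
  have d6 := @is_deriveM R R _ (fun t => expR (- (2 * (mu * k)) * (t - a))) t 1 _ _ d5 d4.
  apply: (is_derive_eq d6).
  rewrite -![_ *: _]/(_ * _) fctE /=; field; exact: nz.
have := const_on_segment cg dg ax xY.
rewrite /g subrr mulr0 expR0 mulr1 /T (transport_start hl mu0 hT0 aY hm) -/(T Y) => E.
apply: tanh_char.
have h : 1 + T Y x = (1 + T0) / (1 - T0) * expR (2 * (mu * k) * (x - a)) * (1 - T Y x).
  have ee : expR (- (2 * (mu * k)) * (x - a)) * expR (2 * (mu * k) * (x - a)) = 1.
    by rewrite mulNr expRN mulVf// gt_eqF// expR_gt0.
  rewrite -E; set e1 := expR (- (2 * (mu * k)) * (x - a)) in ee *.
  set e2 := expR (2 * (mu * k) * (x - a)) in ee *.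
  transitivity ((1 + T Y x) * (e1 * e2)); first by rewrite ee mulr1.
  by field; exact: nz.
rewrite {1}h; congr (_ * _).
have -> : 1 + T0 = expR (2 * s0) * (1 - T0) by rewrite -hs0 tanh_charE.
rewrite mulfK; last by rewrite gt_eqF//; have := hT0; lra.
by rewrite -expRD; congr expR; ring.
Qed.

(* If the mass were exhausted at [Y], the transported parameter would tend to 1
   there, but it equals [Th], which stays below [Th Y] < 1. *)
Lemma equality_mass_gt0 Y : a <= Y -> 0 < mass mu A B Y.
Proof.
move=> aY; rewrite ltNge; apply/negP => MY.
have cn := tailmass_cont hl mu0.
have na := tailmassE hl mu0 (lexx a).
have nY := tailmassE hl mu0 aY.
pose Tm := Th Y.
have /andP[Tm1 Tm2] : -1 < Tm < 1 by exact: tanh_bnd.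
have P1 : 0 < Psi mu Tm by exact: Psi_gt0.
have P2 : 0 < Psi mu Tm / m by exact: divr_gt0 P1 m0.
(* The tail mass takes the value [v] at some [y] before [Y]; being below Psi (Th Y) / m, it
   contradicts m v = Psi (Th y) >= Psi (Th Y). *)
pose v := Num.min (Psi mu Tm / m) N / 2.
have w0 : 0 < Num.min (Psi mu Tm / m) N by rewrite lt_min N0 P2.
have v0 : 0 < v by rewrite divr_gt0.
have v1 : v < N.
  by rewrite /v ltr_pdivrMr// (le_lt_trans (_ : _ <= N))// ?ge_min ?lexx ?orbT// ltr_pMr// ltr1n.
have v2 : v < Psi mu Tm / m.
  rewrite /v ltr_pdivrMr// (le_lt_trans (_ : _ <= Psi mu Tm / m))// ?ge_min ?lexx//.
  by rewrite (ltr_pMr _ P2) ltr1n.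
have [|y] := @IVT R (tailmass a A B mu) a Y v aY (continuous_subspaceT cn).
  rewrite na nY -/N min_r; last exact: le_trans MY (ltW N0).
  by rewrite max_l ?(le_trans MY (ltW v0)) ?(ltW v1)// (le_trans MY (ltW N0)).
rewrite in_itv/= => /andP[ay yY].
rewrite (tailmassE hl mu0 ay) => My.
have MY0 : 0 < mass mu A B y by rewrite My.
have MYN : mass mu A B y < N by rewrite My.
have E := equality_transport_tanh ay (lexx y) MY0 MYN.
have ny : 0 < tailmass a A B mu y + 0 by rewrite (tailmassE hl mu0 ay) addr0.
have := Psi_transport hl mu0 hT0 m0 ny hm y.
rewrite -/(T y y) E minxx addr0 (tailmassE hl mu0 ay) My => PE.
have : Psi mu Tm <= Psi mu (Th y).
  by apply: Psi_le => //; apply: tanh_le; rewrite lerD2l ler_pM2l ?mulr_gt0// lerD2r.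
by rewrite PE leNgt => /negP; apply; rewrite mulrC -(ltr_pdivlMr _ _ m0).
Qed.

Lemma equality_ODE_tanh y : a <= y ->
  A y - A a = \int[leb]_(t in `[a, y]) (- (k * Th t * A t)) /\
  B y - B a = \int[leb]_(t in `[a, y]) (- (k * Th t * B t)).
Proof.
move=> ay.
have [X aX HX] := tail_small (mass_L1 hl mu0) (fun x _ => powR_ge0 _ _) N0.
pose Y := Num.max X y.
have yY : y <= Y by rewrite le_max lexx orbT.
have aY := le_trans ay yY.
have MN : mass mu A B Y < N by apply: HX; rewrite le_max lexx.
have M0 := equality_mass_gt0 aY.
have [-> ->] := equality_ODE hl mu0 k0 hT0 N0 heq (lexx a) ay yY M0.
split; apply: eq_Rintegral => t /[!inE]/=; rewrite in_itv/= => /andP[h1 h2];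
  by rewrite -/m -/(T Y) equality_transport_tanh// (le_trans h2).
Qed.

End EqualityTanh.

Section EqualityProfile.
Context {R : realType} (A B Ga Gb : R -> R) (mu k x0 : R).
Hypotheses (hl : halfline 0 A B Ga Gb) (mu0 : 0 < mu) (k0 : 0 < k).
Let T0 := tanh (mu * k * x0).
Let N := mass mu A B 0.
Hypothesis N0 : 0 < N.
Hypothesis heq : k * T0 * sqsum A B 0 + gns_value mu k T0 N = energy k A B Ga Gb 0.

Let p x : R := sech_profile mu k (x + x0).

Let dp x : is_derive x (1:R) p (- k * tanh (mu * k * (x + x0)) * p x).
Proof.
rewrite -[X in is_derive _ _ _ X]mulr1.
apply: (@is_derive1_comp R (sech_profile mu k) (fun x => x + x0)).
  by apply: is_derive_sech_profile; rewrite gt_eqF.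
by rewrite -[X in is_derive _ _ _ X]addr0; exact: (@is_deriveD R R R id (cst x0)).
Qed.

Let p0 x : 0 < p x. Proof. exact: sech_profile_gt0. Qed.

Let cp : continuous p.
Proof.
by move=> x; apply: differentiable_continuous; apply/derivable1_diffP; case: (dp x).
Qed.

Let cTh : continuous (fun x : R => tanh (mu * k * x0 + mu * k * (x - 0))).
Proof.
move=> x; apply: (@continuous_comp R R R (fun x => mu * k * x0 + mu * k * (x - 0)) (@tanh R)).
  apply: (@continuousD R R R (cst (mu * k * x0)) (fun x => mu * k * (x - 0))); first exact: cst_continuous.
  apply: (@continuousM R R (cst (mu * k)) (fun t => t - 0)); first exact: cst_continuous.
  by apply: (@continuousB R R R id (cst 0)); [exact: cvg_id|exact: cst_continuous].
apply: differentiable_continuous; apply/derivable1_diffP.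
by case: (is_derive_tanh (mu * k * x0 + mu * k * (x - 0))).
Qed.

(** The integrand is continuous, so the integral equation is a classical one; [F] and [p] solve the
    same linear equation and their quotient has derivative 0. *)
Lemma ODE_profile (F : R -> R) : continuous F ->
  (forall y : R, 0 <= y -> F y - F 0 =
     \int[leb]_(t in `[0, y]) (- (k * tanh (mu * k * x0 + mu * k * (t - 0)) * F t))) ->
  forall x : R, 0 <= x -> F x = F 0 / p 0 * p x.
Proof.
move=> cF HF x x_ge0.
pose h (t : R) : R := - (k * tanh (mu * k * x0 + mu * k * (t - 0)) * F t).
have ch : continuous h.
  move=> t; apply: (@continuousN R R R (fun t => k * tanh (mu * k * x0 + mu * k * (t - 0)) * F t)).
  apply: (@continuousM R R (fun t => k * tanh (mu * k * x0 + mu * k * (t - 0))) F); last exact: cF.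
  by apply: (@continuousM R R (cst k) (fun t => tanh (mu * k * x0 + mu * k * (t - 0)))); [exact: cst_continuous|exact: cTh].
have dF (t : R) : 0 < t -> is_derive t (1:R) F (h t).
  move=> t0; have [||d1 d2] := @continuous_FTC1_closed R h 0 t (t + 1) _ (L1_cont (f := h) _ _ ch) t0.
  - by rewrite ltrDl.
  - exact: ch.
  apply: (@near_eq_is_derive R R R (fun y => F 0 + \int[leb]_(z in `[0, y]) h z)).
    near=> y; rewrite -HF; first by rewrite addrC subrK.
    by apply: ltW; near: y; exact: lt_nbhsr.
  rewrite -[h t]add0r; apply: is_deriveD.
  by split; [exact: d1|rewrite -derive1E; exact: d2].
pose g (t : R) : R := F t / p t.
have cg : continuous g.
  move=> t; apply: (@continuousM R R F (fun t => (p t)^-1)); first exact: cF.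
  by apply: (@continuousV R R p); [rewrite gt_eqF|exact: cp].
have dg (t : R) : 0 < t -> t < x -> is_derive t (1:R) g 0.
  move=> t0 _; have pt : p t != 0 by rewrite gt_eqF.
  have d3 := @is_deriveV R p t _ 1 pt (dp t).
  have d4 := @is_deriveM R R F (fun t => (p t)^-1) t 1 _ _ (dF t t0) d3.
  apply: (is_derive_eq d4).
  rewrite -![_ *: _]/(_ * _) /h subr0 -mulrDr [x0 + t]addrC; field; exact: pt.
have := const_on_segment cg dg x_ge0 (lexx x).
by rewrite /g => <-; rewrite divfK// gt_eqF.
Unshelve. all: by end_near. Qed.

(** The linear equation for u leaves the amplitude free. It is fixed by the nonlinear equation for
    the transport at a single point, here [Y / 2], where the powers of cosh cancel. *)
Lemma equality_profile : exists cA cB : R,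
  [/\ (cA ^+ 2 + cB ^+ 2) `^ (mu + 1) = mu * k * N / Psi mu T0,
      forall x : R, 0 <= x -> A x = cA * p x & forall x : R, 0 <= x -> B x = cB * p x].
Proof.
exists (A 0 / p 0), (B 0 / p 0).
have HA := ODE_profile (hl_contA hl) (fun y hy => (equality_ODE_tanh hl mu0 k0 N0 erefl heq hy).1).
have HB := ODE_profile (hl_contB hl) (fun y hy => (equality_ODE_tanh hl mu0 k0 N0 erefl heq hy).2).
split => //.
have [X aX HX] := tail_small (mass_L1 hl mu0) (fun x _ => powR_ge0 _ _) N0.
pose Y := Num.max X 1.
have Y0 : 0 < Y by rewrite lt_max ltr01 orbT.
have MN : mass mu A B Y < N by apply: HX; rewrite le_max lexx.
have M0 := equality_mass_gt0 hl mu0 k0 N0 erefl heq (ltW Y0).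
have xY : Y / 2 < Y by lra.
have x1 : 0 < Y / 2 by lra.
have hT0 : -1 < T0 < 1 by exact: tanh_bnd.
have := equality_transport_ODE hl mu0 k0 hT0 N0 heq M0 MN x1 xY.
rewrite /transport' (equality_transport_tanh hl mu0 k0 N0 erefl heq (ltW x1) (ltW xY) M0 MN).
have -> : mu * k * x0 + mu * k * (Y / 2 - 0) = mu * k * (Y / 2 + x0) by ring.
set y := mu * k * _; set C := _ ^+ 2 + _ ^+ 2.
have -> : sqsum A B (Y / 2) = C * cosh y `^ (- (1 / mu)) ^+ 2.
  by rewrite /sqsum HA ?ltW// HB ?ltW// /C /p /sech_profile -/y; ring.
rewrite wtE; last by have := tanh_bnd y; lra.
rewrite sech2E powRM ?sqr_ge0 ?addr_ge0 ?sqr_ge0//.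
have [c <-] := expR_total (cosh_gt0 y).
have P0 : 0 < Psi mu T0 by apply: Psi_gt0 => //; case/andP: hT0.
rewrite !expr2 !powR_expRE => E.
have {}E : Psi mu T0 / N * C `^ (mu + 1) = mu * k.
  have e0 := expR_eq0 (- (c + c)).
  apply: (mulIf (negbT e0)); rewrite -E -!mulrA; congr (_ * (_ * (_ * _))).
  by rewrite powR_expRE; congr expR; field; rewrite gt_eqF.
rewrite -E; field.
by rewrite !gt_eqF.
Qed.

End EqualityProfile.

(** * The algebra of the matching conditions at 0 *)

Lemma subr1_sqr_gt0 (R : realType) (x : R) : (0 < 1 - x ^+ 2) = (-1 < x < 1).
Proof. by rewrite -ltr_norml subr_gt0 -(real_normK (num_real x)) expr_lt1. Qed.

(** With c = t^(2 mu), [q] is the square root of [A_coef] and the last two hypotheses are the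
    formulas for - Ttilde_minus and Ttilde_plus cleared of their denominator [D]. All inequalities
    are checked after multiplication by [D], which has the sign of t - 1; hence the two cases. *)
Lemma matching_algebra (R : realType) (t c s q u D P S : R) :
  0 < t -> 0 < c -> 0 < s -> s < 1 + u -> 0 <= q -> u = t ^+ 2 -> D = c * u ^+ 2 - 1 ->
  q ^+ 2 = s ^+ 2 * c + D * (c - 1) ->
  (1 < t) && (1 < c) || (t < 1) && (c < 1) ->
  P * D = u * q - s -> S * D = c * u * s - q ->
  [/\ P + u * S = s, c * (1 - P ^+ 2) = 1 - S ^+ 2, 0 < P + S,
      -1 < P < 1 & -1 < S < 1] /\ (if 1 < t then 0 < P else 0 < S).
Proof.
move=> t0 c0 s0 st q0 uE DE qE tc PD SD.
have u0 : 0 < u by rewrite uE exprn_gt0.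
have D0 : D != 0.
  case/orP: tc => /andP[h1 h2].
    have u1 : 1 < u by rewrite uE expr2; nra.
    by rewrite gt_eqF// DE; nra.
  have u1 : u < 1 by rewrite uE expr2; nra.
  by rewrite lt_eqF// DE; nra.
have E1 : P + u * S = s.
  by apply: (mulIf D0); rewrite mulrDl PD -mulrA SD DE; ring.
have E2 : c * (1 - P ^+ 2) = 1 - S ^+ 2.
  have DD : D ^+ 2 != 0 by rewrite expf_neq0.
  apply: (mulIf DD).
  have -> : c * (1 - P ^+ 2) * D ^+ 2 = c * (D ^+ 2 - (P * D) ^+ 2) by ring.
  have -> : (1 - S ^+ 2) * D ^+ 2 = D ^+ 2 - (S * D) ^+ 2 by ring.
  rewrite PD SD.
  have -> : c * (D ^+ 2 - (u * q - s) ^+ 2) =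
    c * D ^+ 2 - c * u ^+ 2 * q ^+ 2 + 2 * c * u * q * s - c * s ^+ 2 by ring.
  have -> : D ^+ 2 - (c * u * s - q) ^+ 2 =
    D ^+ 2 - c ^+ 2 * u ^+ 2 * s ^+ 2 + 2 * c * u * q * s - q ^+ 2 by ring.
  by rewrite qE DE; ring.
have PSD : (P + S) * D = (u - 1) * q + (c * u - 1) * s by rewrite mulrDl PD SD; ring.
case/orP: tc => /andP[t1 c1].
  have u1 : 1 < u by rewrite uE expr2; nra.
  have Dp : 0 < D by rewrite DE; nra.
  have PS : 0 < P + S.
    rewrite -(pmulr_lgt0 _ Dp) PSD ltr_wpDl//; first by rewrite mulr_ge0//; lra.
    by rewrite mulr_gt0//; nra.
  have P0 : 0 < P.
    rewrite -(pmulr_lgt0 _ Dp) PD subr_gt0.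
    rewrite -(@ltr_pXn2r _ 2)// ?nnegrE ?mulr_ge0// ?ltW//.
    rewrite exprMn qE.
    have -> : u ^+ 2 * (s ^+ 2 * c + D * (c - 1)) = s ^+ 2 + D * (s ^+ 2 + u ^+ 2 * (c - 1)) by rewrite DE; ring.
    rewrite ltrDl mulr_gt0// ltr_pwDl ?exprn_gt0// mulr_ge0 ?sqr_ge0//; lra.
  have P1 : P < 1.
    rewrite -(ltr_pM2r Dp) mul1r PD ltrBlDr.
    rewrite -(@ltr_pXn2r _ 2)// ?nnegrE ?mulr_ge0 ?addr_ge0// ?ltW//.
    rewrite exprMn qE -subr_gt0.
    (* This factorization is where the threshold on omega enters: s < 1 + u makes u^2 - (s - 1)^2
       positive, which puts [P] below 1. *)
    have -> : (D + s) ^+ 2 - u ^+ 2 * (s ^+ 2 * c + D * (c - 1)) = D * (u ^+ 2 - (s - 1) ^+ 2) by rewrite DE; ring.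
    by rewrite mulr_gt0// subr_sqr mulr_gt0; lra.
  have S1 : 0 < 1 - S ^+ 2 by rewrite -E2 mulr_gt0// subr1_sqr_gt0; lra.
  rewrite subr1_sqr_gt0 in S1; rewrite t1; split => //; split => //; lra.
have u1 : u < 1 by rewrite uE expr2; nra.
have Dn : D < 0 by rewrite DE; nra.
have cu : c * u < 1 by nra.
have PS : 0 < P + S.
  have h1 : (u - 1) * q <= 0 by rewrite mulr_le0_ge0//; lra.
  have h2 : (c * u - 1) * s < 0 by rewrite pmulr_llt0//; lra.
  rewrite -(nmulr_llt0 _ Dn) PSD; lra.
have S0 : 0 < S.
  rewrite -(nmulr_llt0 _ Dn) SD subr_lt0.
  rewrite -(@ltr_pXn2r _ 2)// ?nnegrE ?mulr_ge0// ?ltW//.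
  rewrite qE -subr_gt0.
  have -> : s ^+ 2 * c + D * (c - 1) - (c * u * s) ^+ 2 = (- D) * (s ^+ 2 * c + (1 - c)) by rewrite DE; ring.
  have h : 0 <= s ^+ 2 * c by rewrite mulr_ge0 ?sqr_ge0// ltW.
  by rewrite mulr_gt0 ?oppr_gt0//; lra.
have P1 : P < 1.
  rewrite -(ltr_nM2r Dn) mul1r PD.
  have [Ds|Ds] := ltP (D + s) 0.
    have : 0 <= u * q by rewrite mulr_ge0// ltW.
    by lra.
  rewrite ltrBrDr -(@ltr_pXn2r _ 2)// ?nnegrE ?mulr_ge0// ?(ltW u0)//.
  rewrite exprMn qE -subr_gt0.
  have -> : u ^+ 2 * (s ^+ 2 * c + D * (c - 1)) - (D + s) ^+ 2 = (- D) * (u ^+ 2 - (s - 1) ^+ 2) by rewrite DE; ring.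
  have us : 1 - u < s by move: Ds; rewrite DE; nra.
  by rewrite mulr_gt0 ?oppr_gt0// subr_sqr mulr_gt0; lra.
have Pm : -1 < P.
  (* If P <= -1 then S > - P >= 1, so 0 <= P^2 - 1 < S^2 - 1, against [E2] with c < 1. *)
  rewrite ltNge; apply/negP => Pn.
  have h1 : P ^+ 2 < S ^+ 2 by rewrite !expr2; nra.
  have h2 : 1 <= P ^+ 2 by rewrite expr2; nra.
  by nra.
have S1 : 0 < 1 - S ^+ 2 by rewrite -E2 mulr_gt0// subr1_sqr_gt0; lra.
rewrite subr1_sqr_gt0 in S1.
have -> : (1 < t) = false by apply/negbTE; rewrite -leNgt ltW.
split => //; split => //; lra.
Qed.

(* In the application [P] = - Ttilde_minus, [S] = Ttilde_plus and [s] = v / k.  On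
   the line z + u * T = s, the z-derivative of Psi z + Psi T has the sign of
   (1 - T ^+ 2) - c * (1 - z ^+ 2), since c = t `^ (2 * mu) and u = t ^+ 2. *)
Section Matching.
Context {R : realType} (mu t c s u P S : R).
Hypotheses (mu0 : 0 < mu) (t0 : 0 < t) (uE : u = t ^+ 2) (cE : c = t `^ (2 * mu))
  (t1 : t != 1)
  (E1 : P + u * S = s) (E2 : c * (1 - P ^+ 2) = 1 - S ^+ 2) (PS : 0 < P + S)
  (hP : -1 < P < 1) (hS : -1 < S < 1) (side : if 1 < t then 0 < P else 0 < S).

Lemma matching_regime : (1 < t) && (1 < c) || (t < 1) && (c < 1).
Proof.
have mu2 : 0 < 2 * mu by rewrite mulr_gt0.
case: (ltgtP t 1) (t1) => //= h _.
  have := @gt0_ltr_powR R (2 * mu) mu2 t 1; rewrite powR1 -cE ?nnegrE => -> //; exact: ltW.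
have := @gt0_ltr_powR R (2 * mu) mu2 1 t; rewrite powR1 -cE ?nnegrE => -> //; exact: ltW.
Qed.

(** Along the line the difference is quadratic in z and vanishes at [P], so it factors as z - P
    times the bracket in [chi]. The bracket is positive except possibly for z < 0 if t > 1, or T < 0
    if t < 1; there z + T > 0 compares the squares of z and T directly. *)
Lemma matching_sign z T : u * T = s - z -> -1 < z <= 1 -> -1 < T <= 1 -> 0 < z + T ->
  (z < P -> (1 - T ^+ 2) < c * (1 - z ^+ 2)) /\ (P < z -> c * (1 - z ^+ 2) < 1 - T ^+ 2).
Proof.
move=> uT hz hT zT.
have c0 : 0 < c by rewrite cE powR_gt0.
have u0 : 0 < u by rewrite uE exprn_gt0.
have ST : u * (S - T) = z - P by move: E1 uT; lra.
have chi : (1 - T ^+ 2 - c * (1 - z ^+ 2)) * u = (z - P) * ((S + T) + c * u * (z + P)).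
  have -> : 1 - T ^+ 2 = c * (1 - P ^+ 2) + (S - T) * (S + T) by rewrite E2; ring.
  transitivity (c * u * (z - P) * (z + P) + (u * (S - T)) * (S + T)); first by ring.
  by rewrite ST; ring.
suff : (z < P -> 0 < (S + T) + c * u * (z + P) \/ 1 - T ^+ 2 < c * (1 - z ^+ 2)) /\
       (P < z -> 0 < (S + T) + c * u * (z + P) \/ c * (1 - z ^+ 2) < 1 - T ^+ 2).
  move=> [H1 H2]; split => h.
    have [b0|//] := H1 h; rewrite -subr_lt0 -(pmulr_llt0 _ u0) chi pmulr_llt0//; lra.
  have [b0|//] := H2 h; rewrite -subr_gt0 -(pmulr_lgt0 _ u0) chi mulr_gt0//; lra.
case/orP: matching_regime side => /andP[h1 h2].
  rewrite h1 => P0; have u1 : 1 < u by rewrite uE expr2; nra.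
  have cu : 1 < c * u by nra.
  have [z0|z0] := ltP z 0.
    split => [_|]; [right|lra].
    have h3 : z ^+ 2 < T ^+ 2 by rewrite -subr_gt0 subr_sqr mulr_gt0//; lra.
    have h4 : 0 < 1 - z ^+ 2 by rewrite subr1_sqr_gt0; lra.
    have : 0 < (c - 1) * (1 - z ^+ 2) by rewrite mulr_gt0//; lra.
    lra.
  have b0 : 0 < (S + T) + c * u * (z + P).
    have h : 0 <= (c * u - 1) * (z + P) by rewrite mulr_ge0//; lra.
    have := PS; lra.
  by split; left.
have -> : (1 < t) = false by apply/negbTE; rewrite -leNgt ltW.
move=> S0; have u1 : u < 1 by rewrite uE expr2; have := t0; nra.
have cu : c * u < 1 by nra.
have cu0 : 0 < c * u by rewrite mulr_gt0.
have [T0|T0] := ltP T 0.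
  split => [|_]; last right.
    have : 0 < u * (S - T) by rewrite mulr_gt0//; lra.
    by rewrite ST; lra.
  have h3 : T ^+ 2 < z ^+ 2 by rewrite -subr_gt0 subr_sqr mulr_gt0//; lra.
  have h5 : 0 <= (1 - z) * (1 + z) by apply: mulr_ge0; lra.
  have h4 : 0 <= (1 - c) * ((1 - z) * (1 + z)) by apply: mulr_ge0 => //; lra.
  lra.
have b0 : 0 < (S + T) + c * u * (z + P).
  have h : 0 < (1 - c * u) * (S + T) by rewrite mulr_gt0//; lra.
  have h' : 0 < c * u * (z + T + (P + S)) by rewrite mulr_gt0// addr_gt0.
  lra.
by split; left.
Qed.

(** Where z <= -1, T <= -1 or z + T <= 0 the sum is at least Psi (-1), which exceeds its value at
    (P, S). The remaining part of the line is convex and contains (P, S), so the mean value theorem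
    between z and P applies with the sign of [slope]. *)
Lemma matching_min z T : u * T = s - z -> z <= 1 -> T <= 1 ->
  Psi mu P + Psi mu S <= Psi mu z + Psi mu T /\
  (Psi mu P + Psi mu S = Psi mu z + Psi mu T -> z = P).
Proof.
move=> uT z1 T1.
have [hP1 hP2] := andP hP; have [hS1 hS2] := andP hS.
have u0 : 0 < u by rewrite uE exprn_gt0.
have big : Psi mu P + Psi mu S < Psi mu (-1).
  rewrite -(PsiN P mu0) ltrD2l; apply: Psi_lt => //; move: PS; lra.
have strict : z != P -> Psi mu P + Psi mu S < Psi mu z + Psi mu T.
  move=> zP.
  have [zm|zm] := leP z (-1).
    by apply: lt_le_trans big _; rewrite (Psi_out mu0 zm) lerDl Psi_ge0.
  have [Tm|Tm] := leP T (-1).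
    by apply: lt_le_trans big _; rewrite (Psi_out mu0 Tm) lerDr Psi_ge0.
  have [zT|zT] := leP (z + T) 0.
    by apply: lt_le_trans big _; rewrite -(PsiN z mu0) lerD2l; apply: Psi_le => //; lra.
  pose T2 y := (s - y) / u.
  have T2z : T2 z = T by rewrite /T2 -uT mulrC mulKf// gt_eqF.
  have T2P : T2 P = S by rewrite /T2 -E1 addrAC subrr add0r mulrC mulKf// gt_eqF.
  pose M y := Psi mu y + Psi mu (T2 y).
  have dM y : is_derive y (1:R) M (- wt mu y + (- wt mu (T2 y)) * (- u^-1)).
    apply: is_deriveD; first exact: Psi_derive.
    apply: is_derive1_comp; first exact: Psi_derive.
    have -> : T2 = u^-1 \*: (fun y => s - y) by apply/funext => x; rewrite /T2 mulrC.
    rewrite (_ : - u^-1 = u^-1 *: (0 - 1)); last by rewrite -[_ *: _]/(_ * _); ring.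
    by apply: is_deriveZ; apply: (@is_deriveB R R R (cst s) id).
  have cM : continuous M.
    by move=> y; apply: differentiable_continuous; apply/derivable1_diffP; case: (dM y).
  have slope y : -1 < y < 1 -> -1 < T2 y < 1 -> 0 < y + T2 y ->
     (y < P -> - wt mu y + (- wt mu (T2 y)) * (- u^-1) < 0) /\
     (P < y -> 0 < - wt mu y + (- wt mu (T2 y)) * (- u^-1)).
    move=> hy hT yT.
    have uT2 : u * T2 y = s - y by rewrite /T2 mulrC divfK// gt_eqF.
    have [] := matching_sign uT2 _ _ yT; [lra|lra|] => H1 H2.
    have c0 : 0 < c by rewrite cE powR_gt0.
    (* Since c^(1/mu) = t^2 = u, comparing [u * wt mu y] with [wt mu (T2 y)] is comparing the bases
       in [matching_sign]. *)
    have uwt : u * wt mu y = (c * (1 - y ^+ 2)) `^ mu^-1.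
      rewrite wtE; last lra.
      rewrite powRM ?ltW// ?subr1_sqr_gt0//; congr (_ * _).
      rewrite cE -powRrM mulfK ?gt_eqF// uE -powR_mulrn// ltW//.
    have wt2 : wt mu (T2 y) = (1 - T2 y ^+ 2) `^ mu^-1 by rewrite wtE//; lra.
    have p1 : 0 < 1 - T2 y ^+ 2 by rewrite subr1_sqr_gt0.
    have p2 : 0 < c * (1 - y ^+ 2) by rewrite mulr_gt0// subr1_sqr_gt0.
    have mui : 0 < mu^-1 by rewrite invr_gt0.
    have E : - wt mu y + (- wt mu (T2 y)) * (- u^-1) = (wt mu (T2 y) - u * wt mu y) / u.
      by field; rewrite gt_eqF.
    rewrite E; split => h.
      rewrite pmulr_llt0 ?invr_gt0// subr_lt0 uwt wt2.
      by apply: gt0_ltr_powR; rewrite ?nnegrE ?ltW// H1.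
    rewrite divr_gt0// subr_gt0 uwt wt2.
    by apply: gt0_ltr_powR; rewrite ?nnegrE ?ltW// H2.
  have T2lt (y y' : R) : y < y' -> T2 y' < T2 y.
    by move=> h; rewrite ltr_pM2r ?invr_gt0// ltrD2l ltrN2.
  have uu y y' : T2 y - T2 y' = (y' - y) / u by rewrite /T2 -mulrBl; congr (_ / _); ring.
  have lin y (l : R) : 0 <= l <= 1 -> y = l * z + (1 - l) * P -> 0 < y + T2 y.
    move=> /andP[l0 l1] ->.
    have -> : l * z + (1 - l) * P + T2 (l * z + (1 - l) * P) =
       l * (z + T2 z) + (1 - l) * (P + T2 P) by rewrite /T2; ring.
    rewrite T2z T2P; have PS' := PS.
    have [->|l0'] := eqVneq l 0; first by rewrite subr0 mul0r mul1r add0r.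
    have l2 : 0 < l by rewrite lt_def l0'.
    have a1 : 0 < l * (z + T) by exact: mulr_gt0.
    have a2 : 0 <= (1 - l) * (P + S) by apply: mulr_ge0; lra.
    lra.
  have between y : (z < y < P) || (P < y < z) -> 0 < y + T2 y.
    move=> h; have zP0 : z - P != 0 by rewrite subr_eq0.
    apply: (lin y ((y - P) / (z - P))); last by field.
    case/orP: h => /andP[h1 h2].
      rewrite -mulrNN -invrN !opprB divr_ge0 ?ler_pdivrMr ?mul1r; lra.
    rewrite divr_ge0 ?ler_pdivrMr ?mul1r; lra.
  case: (ltgtP z P) zP => // zP _.
    have [|y + E] := @MVT R M _ z P zP (fun x _ => dM x); first exact: continuous_subspaceT.
    rewrite in_itv/= => /andP[zy yP].
    have [|||H _] := slope y.
    - by rewrite (lt_trans zm zy) (lt_trans yP hP2).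
    - by rewrite (lt_trans hS1)/= -?T2P ?T2lt// (lt_le_trans (T2lt _ _ zy))// T2z.
    - by apply: between; rewrite zy yP.
    rewrite -T2P -T2z -subr_lt0 -/(M P) -/(M z) E nmulr_rlt0 ?subr_gt0//; exact: H.
  have [|y + E] := @MVT R M _ P z zP (fun x _ => dM x); first exact: continuous_subspaceT.
  rewrite in_itv/= => /andP[Py yz].
  have [|||_ H] := slope y.
  - by rewrite (lt_trans hP1 Py) (lt_le_trans yz z1).
  - by rewrite (lt_trans Tm)/= -?T2z ?T2lt// (lt_trans (T2lt _ _ Py))// T2P.
  - by apply: between; rewrite Py yz orbT.
  rewrite -T2P -T2z -subr_gt0 -/(M P) -/(M z) E mulr_gt0 ?subr_gt0//; exact: H.
have [zP|zP] := eqVneq z P.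
  have TS : T = S.
    by apply: (mulfI (lt0r_neq0 u0)); rewrite uT zP -E1; ring.
  by rewrite zP TS lexx.
have h := strict zP; split; first exact: ltW.
by move=> E; move: h; rewrite E ltxx.
Qed.

End Matching.

(** * Sobolev functions on half-lines *)
Section WeakDerivative.
Context {R : realType}.
Implicit Types (f g phi : R -> R) (I : set R) (a b x y : R).

Lemma continuous_clamp f (a b : R) : a <= b -> (forall z, a <= z -> z <= b -> {for z, continuous f}) ->
  continuous (fun z => f (Num.max a (Num.min z b))).
Proof.
move=> ab cf z; apply: (@continuous_comp R R R (fun z => Num.max a (Num.min z b)) f).
  apply: (@continuous_max R R (cst a) (fun z => Num.min z b)); first exact: cst_continuous.
  by apply: (@continuous_min R R id (cst b)); [exact: cvg_id|exact: cst_continuous].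
by apply: cf; rewrite ?le_max ?lexx// ge_max ab ge_min lexx orbT.
Qed.

Lemma clamp_id (a b z : R) : a <= z -> z <= b -> Num.max a (Num.min z b) = z.
Proof. by move=> az zb; rewrite min_l// max_r. Qed.

Lemma Rintegral_support f (a b : R) (D : set (measurableTypeR R)) :
  `[a, b]%classic `<=` D -> (forall x, D x -> ~ (a <= x <= b) -> f x = 0) ->
  \int[leb]_(x in D) f x = \int[leb]_(x in `[a, b]) f x.
Proof.
move=> sub f0; rewrite Rintegral_mkcond [RHS]Rintegral_mkcond; congr Rintegral.
apply/funext => x; rewrite !patchE.
case: ifPn => xD; case: ifPn => xab //.
  by apply: f0; [exact/set_mem|move: xab; rewrite notin_setE/= in_itv/=].
by exfalso; move/negP: xD; apply; apply/mem_set/sub/set_mem.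
Qed.

Lemma derive1_locally0 phi (z : R) : (\near z, phi z = 0) -> derive1 phi z = 0.
Proof.
move=> H; rewrite derive1E.
have : is_derive z (1:R) phi 0.
  apply: (@near_eq_is_derive R R R (cst 0)).
  by apply: filterS H => t ->.
by case.
Qed.

Definition bump (a b x : R) : R := Num.max 0 ((x - a) * (b - x)).

Lemma bump_ge0 a b x : 0 <= bump a b x.
Proof. by rewrite le_max lexx. Qed.

Lemma bump_gt0 a b x : a < x < b -> 0 < bump a b x.
Proof. by move=> /andP[ax xb]; rewrite lt_max mulr_gt0 ?orbT// subr_gt0. Qed.

Lemma bump_out a b x : a <= b -> (x <= a) || (b <= x) -> bump a b x = 0.
Proof. by move=> ab /orP[] h; rewrite /bump max_l//; nra. Qed.

Lemma bump_cont a b : continuous (bump a b).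
Proof.
move=> x; apply: (@continuous_max R R (cst 0) (fun x => (x - a) * (b - x))); first exact: cst_continuous.
apply: (@continuousM R R (fun x => x - a) (fun x => b - x)).
  by apply: (@continuousB R R R id (cst a)); [exact: cvg_id|exact: cst_continuous].
by apply: (@continuousB R R R (cst b) id); [exact: cst_continuous|exact: cvg_id].
Qed.

(** The zero integral is what makes the primitive of [psi] vanish again to the right of [b], hence
    an admissible test function. *)
Lemma test_function_exists (psi : R -> R) a b I : a <= b -> continuous psi ->
  (forall x, (x <= a) || (b <= x) -> psi x = 0) ->
  \int[leb]_(x in `[a, b]) psi x = 0 -> `[a, b]%classic `<=` I ->
  exists phi : R -> R, [/\ C1c I phi, derive1 phi = psi, forall x, is_derive x (1:R) phi (psi x) &
     forall x, (x <= a) || (b <= x) -> phi x = 0].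
Proof.
move=> ab cpsi psi0 I0 sub.
pose phi (x : R) : R := \int[leb]_(t in `]-oo, x]) psi t.
have psii (D : set (measurableTypeR R)) : measurable D -> L1 D psi.
  move=> mD; apply: (@L1S _ D setT) => //.
  have -> : EFin \o psi = (EFin \o psi) \_ `[a, b].
    apply/funext => t; rewrite patchE; case: ifPn => // /negP.
    rewrite inE/= in_itv/= => ht; rewrite /= psi0//.
    by case: (leP t a) ht => //= h1 h2; case: (leP b t) => // h3; exfalso; apply: h2; rewrite !ltW.
  by apply/(integrable_mkcond _ _).1; [exact: measurable_itv|exact: L1_cont].
have dphi x : is_derive x (1:R) phi (psi x).
  have [||d1 d2] := @continuous_FTC1 R psi -oo%O x (x + 1) _ (psii _ (measurable_itv _)) (ltNyr _).
  - by rewrite ltrDl.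
  - exact: cpsi.
  by split; [exact: d1|rewrite -derive1E; exact: d2].
have D1 : derive1 phi = psi by apply/funext => x; rewrite derive1E; case: (dphi x).
have cphi : continuous phi.
  by move=> x; apply: differentiable_continuous; apply/derivable1_diffP; case: (dphi x).
have left x : x <= a -> phi x = 0.
  move=> xa; rewrite /phi (@eq_Rintegral _ _ _ _ _ (cst 0)); last first.
    by move=> t /[!inE]/=; rewrite in_itv/= => tx; rewrite psi0// (le_trans tx xa).
  by rewrite Rintegral_cst//= mul0r.
have right x : b <= x -> phi x = 0.
  move=> bx; have ax := le_trans ab bx.
  have pp : is_primitive a x phi psi by apply: primitive_C1.
  have := primitiveB pp (lexx _) ax (lexx _); rewrite (left a)// subr0 => ->.
  rewrite -I0; apply: Rintegral_support.
    by apply: subset_itvl; rewrite bnd_simp.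
  move=> t _ ht; apply: psi0; case: (leP t a) => //= h1; case: (leP b t) => // h3.
  by exfalso; apply: ht; rewrite !ltW.
have out x : (x <= a) || (b <= x) -> phi x = 0 by case/orP; [exact: left|exact: right].
exists phi; split => //; split.
- by move=> x; case: (dphi x).
- by rewrite D1.
- exists `[a, b]%classic; split => //; first exact: segment_compact.
  move=> x /=; rewrite in_itv/= => ht; apply: out; case: (leP x a) => //= h1; case: (leP b x) => // h3.
  by exfalso; apply: ht; rewrite !ltW.
Qed.

(* Test against a primitive of (F - m) * w, where F is f minus a primitive of g, w
   is a bump and m the w-average of F: this yields int (F - m)^2 w = 0. *)
Lemma weak_FTC f g I a b : a < b -> `[a, b]%classic `<=` I ->
  (forall z, a <= z -> z <= b -> {for z, continuous f}) -> L1 `[a, b] g ->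
  (forall phi, C1c I phi ->
     \int[leb]_(x in I) (f x * derive1 phi x) = - \int[leb]_(x in I) (g x * phi x)) ->
  forall x y, a < x -> x <= y -> y < b -> f y - f x = \int[leb]_(t in `[x, y]) g t.
Proof.
move=> ab sub cf gi weak x y ax xy yb.
(* [g] is cut off and, in [F], [f] is clamped outside [a, b], so that both primitives and continuity
   make sense on the whole line. *)
pose gt := g \_ `[a, b].
have gti c d : L1 `[c, d] gt.
  apply: (@L1S _ _ setT) => //.
  rewrite /gt -restrict_EFin; apply/(integrable_mkcond _ _).1 => //; exact: measurable_itv.
have gtE z : a <= z -> z <= b -> gt z = g z.
  by move=> az zb; rewrite /gt patchE mem_set//= in_itv/= az.
pose G (z : R) : R := \int[leb]_(t in `[a, z]) gt t.
have cG : continuous G by apply: continuous_Rintegral => c; exact: gti.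
have pG : is_primitive a b G gt.
  by split => // z az zb; rewrite /G set_itv1 Rintegral_set1 add0r.
pose F (z : R) : R := f (Num.max a (Num.min z b)) - G z.
have cF : continuous F.
  move=> z; apply: (@continuousB R R R (fun z => f (Num.max a (Num.min z b))) G); last exact: cG.
  exact: (continuous_clamp (ltW ab) cf).
pose w := bump a b.
have cw : continuous w by exact: bump_cont.
pose W := \int[leb]_(t in `[a, b]) w t.
have W0 : W != 0.
  apply/eqP => W0.
  have mab : a < (a + b) / 2 < b by lra.
  have := zero_integral_cont cw (bump_ge0 a b) W0 (andP mab).1 (andP mab).2.
  by apply/eqP; rewrite gt_eqF// bump_gt0.
have cFw : continuous (fun t => F t * w t).
  by move=> t; apply: (@continuousM R R F w); [exact: cF|exact: cw].
pose m := (\int[leb]_(t in `[a, b]) (F t * w t)) / W.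
pose psi (t : R) : R := (F t - m) * w t.
have cpsi : continuous psi.
  move=> t; apply: (@continuousM R R (fun t => F t - m) w); last exact: cw.
  by apply: (@continuousB R R R F (cst m)); [exact: cF|exact: cst_continuous].
have psiI : \int[leb]_(t in `[a, b]) psi t = 0.
  transitivity (\int[leb]_(t in `[a, b]) (F t * w t - m * w t)).
    by apply: eq_Rintegral => t _; rewrite /psi mulrBl.
  rewrite RintegralB//; [|exact: L1_cont|by apply: L1Z => //; exact: L1_cont].
  rewrite RintegralZl//; last exact: L1_cont.
  by rewrite -/W /m divfK// subrr.
have psi0 t : (t <= a) || (b <= t) -> psi t = 0.
  by move=> ht; rewrite /psi /w bump_out ?mulr0// ltW.
have [phi [phiC dphi dphi' phi0]] := test_function_exists (ltW ab) cpsi psi0 psiI sub.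
have out t : ~ (a <= t <= b) -> (t <= a) || (b <= t).
  by move=> ht; case: (leP t a) => //= h1; case: (leP b t) => // h3; exfalso; apply: ht; rewrite !ltW.
have := weak phi phiC.
rewrite (@Rintegral_support _ a b I)//; last by move=> t _ ht; rewrite dphi psi0 ?mulr0// out.
rewrite (@Rintegral_support _ a b I)//; last by move=> t _ ht; rewrite phi0 ?mulr0// out.
have cphi : continuous phi.
  by move=> t; apply: differentiable_continuous; apply/derivable1_diffP; case: (dphi' t).
have pphi : is_primitive a b phi psi by apply: primitive_C1.
have pm := primitiveM cG cphi pG pphi.
have := primitiveB pm (lexx _) (ltW ab) (lexx _).
rewrite !phi0 ?lexx ?orbT// !mulr0 subr0 => /esym E1.
have igphi : L1 `[a, b] (fun t => gt t * phi t) by apply: L1_mul_cont.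
have iGpsi : L1 `[a, b] (fun t => G t * psi t).
  by apply: L1_cont => t; apply: (@continuousM R R G psi); [exact: cG|exact: cpsi].
rewrite RintegralD// in E1.
rewrite dphi => E2.
have E3 : \int[leb]_(t in `[a, b]) (F t * psi t) = 0.
  transitivity (\int[leb]_(t in `[a, b]) (f t * psi t - G t * psi t)).
    apply: eq_Rintegral => t /[!inE]/=; rewrite in_itv/= => /andP[h1 h2].
    by rewrite /F clamp_id// mulrBl.
  rewrite RintegralB//; last first.
    apply: (@L1_eq _ _ (fun t => F t * psi t + G t * psi t)) => //.
      move=> t /=; rewrite in_itv/= => /andP[h1 h2]; rewrite /F clamp_id//; ring.
    apply: L1D => //; apply: L1_cont => t.
    by apply: (@continuousM R R F psi); [exact: cF|exact: cpsi].
  have Egphi : \int[leb]_(t in `[a, b]) (gt t * phi t) = \int[leb]_(t in `[a, b]) (g t * phi t).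
    by apply: eq_Rintegral => t /[!inE]/=; rewrite in_itv/= => /andP[h1 h2]; rewrite gtE.
  by rewrite E2 -opprD -Egphi E1 oppr0.
have E4 : \int[leb]_(t in `[a, b]) ((F t - m) ^+ 2 * w t) = 0.
  transitivity (\int[leb]_(t in `[a, b]) (F t * psi t - m * psi t)).
    by apply: eq_Rintegral => t _; rewrite /psi; ring.
  rewrite RintegralB//; [|apply: L1_cont => t; apply: (@continuousM R R F psi); [exact: cF|exact: cpsi]|by apply: L1Z => //; exact: L1_cont].
  by rewrite RintegralZl//; [rewrite E3 psiI mulr0 subr0|exact: L1_cont].
have csq : continuous (fun t => (F t - m) ^+ 2 * w t).
  move=> t; apply: (@continuousM R R (fun t => (F t - m) ^+ 2) w); last exact: cw.
  apply: (@continuous_comp R R R (fun t => F t - m) (fun y => y ^+ 2)); last exact: exprn_continuous.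
  by apply: (@continuousB R R R F (cst m)); [exact: cF|exact: cst_continuous].
have Fm t : a < t -> t < b -> F t = m.
  move=> h1 h2.
  have := zero_integral_cont csq _ E4 h1 h2.
  move=> /(_ (fun z => mulr_ge0 (sqr_ge0 _) (bump_ge0 _ _ _)))/eqP.
  rewrite mulf_eq0 sqrf_eq0 subr_eq0 (gt_eqF (bump_gt0 _)) ?orbF; last by rewrite h1.
  by move/eqP.
have yE := Fm y (lt_le_trans ax xy) yb; have xE := Fm x ax (le_lt_trans xy yb).
have : F y = F x by rewrite yE xE.
rewrite /F !clamp_id ?ltW// ?(lt_le_trans ax)// ?(le_lt_trans xy)// => E.
have -> : f y - f x = G y - G x by move: E; lra.
rewrite (primitiveB pG (ltW ax) xy (ltW yb)).
apply: eq_Rintegral => t /[!inE]/=; rewrite in_itv/= => /andP[h1 h2].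
by rewrite gtE ?(le_trans (ltW ax) h1) ?(le_trans h2 (ltW yb)).
Qed.

End WeakDerivative.

(** * Reflection of the line *)

Section Reflection.
Context {R : realType}.
Implicit Types (f g h : R -> R) (D : set (measurableTypeR R)).

Let mopp : measurable_fun [set: measurableTypeR R] (-%R : measurableTypeR R -> measurableTypeR R).
Proof. exact: oppr_measurable. Qed.

Lemma L1_oppT f : L1 setT f -> L1 setT (fun x => f (- x)).
Proof.
move=> /integrableP[mf fi]; apply/integrableP; split.
  exact: (measurableT_comp mf mopp).
have := @ge0_integral_pushforward _ _ _ _ _ _ mopp (@lebesgue_measure R) setT (fun x => `|(f x)%:E|%E).
rewrite preimage_setT => H.
have E : (\int[leb]_(x in [set: measurableTypeR R]) `|(f (- x))%:E| = \int[leb]_(x in [set: measurableTypeR R]) `|(f x)%:E|)%E.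
  rewrite -[LHS]/(\int[leb]_(x in [set: measurableTypeR R]) ((fun x => `|(f x)%:E|%E) \o -%R) x)%E -H//.
    by apply: eq_measure_integral => A mA _; exact: lebesgue_measureN.
  by apply: measurableT_comp.
by rewrite /comp E.
Qed.

Lemma Rintegral_oppT f : L1 setT f -> \int[leb]_x f (- x) = \int[leb]_x f x.
Proof.
move=> fi; congr fine.
have := @integral_pushforward _ _ _ _ _ _ mopp (@lebesgue_measure R) setT (EFin \o f).
rewrite preimage_setT => H.
rewrite -[LHS]/(\int[leb]_(x in [set: measurableTypeR R]) ((EFin \o f) \o -%R) x)%E -H//.
- by apply: eq_measure_integral => A mA _; exact: lebesgue_measureN.
- by case/integrableP : fi.
- exact: L1_oppT.
Qed.

Lemma patch_opp f (D D' : set R) x : (forall x, D' x <-> D (- x)) ->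
  (f \_ D) (- x) = ((fun t => f (- t)) \_ D') x.
Proof.
move=> DD'; rewrite !patchE.
by case: ifPn => h1; case: ifPn => h2 //; exfalso;
  [move/negP: h2; apply; apply/mem_set/DD'/set_mem|move/negP: h1; apply; apply/mem_set/DD'/set_mem].
Qed.

Lemma L1_mkcond f D : measurable D -> L1 D f <-> L1 setT (f \_ D).
Proof. by move=> mD; rewrite -restrict_EFin; exact: integrable_mkcond. Qed.

Lemma L1_patch f D : measurable D -> L1 D f -> L1 setT (f \_ D).
Proof. by move=> mD /(L1_mkcond f mD). Qed.

Lemma L1_opp f (D D' : set (measurableTypeR R)) : measurable D -> measurable D' ->
  (forall x, D' x <-> D (- x)) -> L1 D f -> L1 D' (fun x => f (- x)).
Proof.
move=> mD mD' DD' /(L1_mkcond f mD)/L1_oppT H; apply/(L1_mkcond _ mD').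
by apply: L1_eq H => // x _; exact: patch_opp.
Qed.

Lemma Rintegral_opp f (D D' : set (measurableTypeR R)) : measurable D -> measurable D' ->
  (forall x, D' x <-> D (- x)) -> L1 D f ->
  \int[leb]_(x in D') f (- x) = \int[leb]_(x in D) f x.
Proof.
move=> mD mD' DD' /(L1_mkcond f mD) H.
rewrite Rintegral_mkcond [RHS]Rintegral_mkcond -[RHS]Rintegral_oppT//.
by apply: eq_Rintegral => x _; rewrite (patch_opp _ _ DD').
Qed.

Lemma L1_point f (c : R) : L1 `[c, c] f.
Proof.
apply: (@L1_eq _ _ (fun=> f c)) => //.
  by move=> x /=; rewrite in_itv/= -eq_le => /eqP ->.
by apply: L1_cont; exact: cst_continuous.
Qed.

Lemma L1_open_ray f (a : R) : L1 `]a, +oo[ f -> L1 `[a, +oo[ f.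
Proof.
move=> fi; apply/(L1_mkcond _ (measurable_itv _)).
have h1 : L1 setT (f \_ `]a, +oo[) by apply: L1_patch.
have h2 : L1 setT (f \_ `[a, a]) by apply: L1_patch => //; exact: L1_point.
apply: (@L1_eq _ _ (fun x => (f \_ `]a, +oo[) x + (f \_ `[a, a]) x)) => //; last exact: L1D.
move=> x _; rewrite !patchE !mem_setE !in_itv/= !andbT.
by rewrite -[point]/(0 : R); case: (ltgtP a x) => _ /=; rewrite ?addr0 ?add0r.
Qed.

(** Both halves are parametrized outward from 0, so that the left and right sides of u obey the same
    half-line statements; [h 0] is left free. *)
Lemma Rintegral_whole h hl hr :
  (forall x, 0 < x -> h x = hr x) -> (forall x, 0 < x -> h (- x) = hl x) ->
  L1 `[0, +oo[ hl -> L1 `[0, +oo[ hr ->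
  \int[leb]_x h x = \int[leb]_(x in `[0, +oo[) hl x + \int[leb]_(x in `[0, +oo[) hr x.
Proof.
move=> hE hE' il ir.
pose hl' (x : R) : R := hl (- x).
have il' : L1 `]-oo, 0] hl'.
  by apply: L1_opp il => // x; rewrite /= !in_itv/= andbT oppr_ge0.
have h1 : L1 `]-oo, 0[ hl' by apply: L1S il' => //; apply: subset_itvl; rewrite bnd_simp.
have h2 : L1 `]0, +oo[ hr by apply: L1S ir => //; apply: subset_itvr; rewrite bnd_simp.
have i1 : L1 `]-oo, 0[ h.
  apply: L1_eq h1 => // x /=; rewrite in_itv/= /hl' => x0.
  by rewrite -hE' ?opprK// oppr_gt0.
have i2 : L1 `]0, +oo[ h.
  by apply: L1_eq h2 => // x /=; rewrite in_itv/= andbT => x0; rewrite hE.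
have i3 := L1_open_ray i2.
have iT : L1 setT h.
  apply: (@L1_eq _ _ (fun x => (h \_ `]-oo, 0[) x + (h \_ `[0, +oo[) x)) => //.
    move=> x _; rewrite !patchE !mem_setE !in_itv/= !andbT.
    by rewrite -[point]/(0 : R); case: (ltP x 0) => _ /=; rewrite ?addr0 ?add0r.
  by apply: L1D => //; exact: L1_patch.
have TU : setT = (`]-oo, 0[%classic `|` `[0, +oo[%classic : set R).
  apply/seteqP; split => x _ //=; rewrite !in_itv/= andbT.
  by case: (ltP x 0); [left|right].
rewrite TU Rintegral_setU//; last 2 first.
- by rewrite -TU.
- apply/disj_setPS => x [/=]; rewrite !in_itv/= andbT => h3 h4.
  by move: h3; rewrite ltNge h4.
congr (_ + _); last first.
  rewrite -!Rintegral_itv_obnd_cbnd//.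
  by apply: eq_Rintegral => x /[!inE]/=; rewrite in_itv/= andbT => x0; rewrite hE.
transitivity (\int[leb]_(x in `]-oo, 0[) hl' x).
  apply: eq_Rintegral => x /[!inE]/=; rewrite in_itv/= /hl' => x0.
  by rewrite -hE' ?opprK// oppr_gt0.
rewrite Rintegral_itv_bndo_bndc//.
by apply: Rintegral_opp => // x; rewrite /= !in_itv/= andbT oppr_ge0.
Qed.

End Reflection.

Import ComplexField.Normc.
Local Open Scope complex_scope.

Section SobolevHalfLine.
Context {R : realType}.
Implicit Types (f g : R -> R) (u : R -> R[i]).

Lemma normc_sqr (z : R[i]) : normc z ^+ 2 = complex.Re z ^+ 2 + complex.Im z ^+ 2.
Proof. by case: z => x y /=; rewrite sqr_sqrtr// addr_ge0 ?sqr_ge0. Qed.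

Lemma L1_of_sqr g (b : R) (s : R -> R) : measurable_fun (`]0, +oo[ : set R) g ->
  L1 `]0, +oo[ s -> (forall x, 0 < x -> g x ^+ 2 <= s x) -> L1 `[0, b] g.
Proof.
move=> mg si gs.
have [b0|b0] := leP b 0.
  have [->|b0'] := eqVneq b 0; first exact: L1_point.
  rewrite set_itv_ge ?bnd_simp -?ltNge; first exact: integrable_set0.
  by rewrite lt_neqAle b0'.
have si' : L1 `]0, b] s by apply: L1S si => //; apply: subset_itvl; rewrite bnd_simp.
have gi : L1 `]0, b] g.
  apply: (@L1_le _ _ _ (fun x => 1 + s x)) => //.
  - by apply: measurable_funS mg => //; apply: subset_itvl; rewrite bnd_simp.
  - move=> x /=; rewrite in_itv/= => /andP[x0 _].
    apply: le_trans (_ : 1 + g x ^+ 2 <= _); last by rewrite lerD2l gs.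
    rewrite -(real_normK (num_real (g x))).
    by have := sqr_ge0 (`|g x| - 1); have := normr_ge0 (g x); nra.
  - apply: L1D => //; apply: (@L1S _ _ `[0, b]) => //.
      by apply: subset_itvr; rewrite bnd_simp.
    by apply: L1_cont; exact: cst_continuous.
apply/(L1_mkcond _ (measurable_itv _)).
have h1 : L1 setT (g \_ `]0, b]) by apply: L1_patch.
have h2 : L1 setT (g \_ `[0, 0]) by apply: L1_patch => //; exact: L1_point.
apply: (@L1_eq _ _ (fun x => (g \_ `]0, b]) x + (g \_ `[0, 0]) x)) => //; last exact: L1D.
move=> x _; rewrite !patchE !mem_setE !in_itv/= -[point]/(0 : R).
case: (ltgtP 0 x) => [h|h|<-] /=; rewrite ?addr0 ?add0r ?andbF//.
by rewrite (ltW b0).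
Qed.

(** [f] is controlled only on ]0, +oo[. It is rebuilt from the primitive of [g], normalized at 1,
    which is continuous up to 0 and so exhibits the trace. *)
Lemma halfline_extension f g (s : R -> R) : (forall x, 0 < x -> {for x, continuous f}) ->
  measurable_fun (`]0, +oo[ : set R) g -> L1 `]0, +oo[ s -> (forall x, 0 < x -> g x ^+ 2 <= s x) ->
  (forall x y, 0 < x -> x <= y -> f y - f x = \int[leb]_(t in `[x, y]) g t) ->
  exists F : R -> R, [/\ continuous F, forall x, 0 < x -> F x = f x,
    forall b, is_primitive 0 b F g & lim (f x @[x --> (0 : R)^'+]) = F 0].
Proof.
move=> cf mg si gs fg.
have gi b := L1_of_sqr b mg si gs.
pose G (x : R) : R := \int[leb]_(t in `[0, x]) g t.
pose F (x : R) : R := f 1 - G 1 + G x.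
have cG : continuous G by apply: continuous_Rintegral.
have cF : continuous F.
  by move=> x; apply: (@continuousD R R R (cst (f 1 - G 1)) G); [exact: cst_continuous|exact: cG].
have FE x : 0 < x -> F x = f x.
  move=> x0; rewrite /F; have [x1|/ltW x1] := leP 1 x.
    have := fg 1 x ltr01 x1; rewrite /G (@Rintegral_split _ g 0 1 x)//; lra.
  have := fg x 1 x0 x1; rewrite /G (@Rintegral_split _ g 0 x 1)//; [lra|exact: ltW].
exists F; split => //.
- by move=> b; split => // y y0 yb; rewrite /F /G set_itv1 Rintegral_set1 addr0.
- apply/cvg_lim => //.
  have : F x @[x --> (0 : R)^'+] --> F 0 by apply: cvg_at_right_filter; exact: cF.
  apply: cvg_trans; apply: near_eq_cvg; near=> x; apply: FE.
  by near: x; exact: nbhs_right_gt.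
Unshelve. all: by end_near. Qed.

Lemma H1_weak_derivative I u : H1 I u -> L2 I (weak_derivative I u) /\
  is_weak_derivative I u (weak_derivative I u).
Proof.
case=> _ _ _ [g g2 gw]; rewrite /weak_derivative.
by case: xgetP => [h _ //|/(_ g)]; case.
Qed.

Lemma weak_derivative_Re I u (g : R -> R[i]) : is_weak_derivative I u g -> forall phi, C1c I phi ->
  \int[leb]_(x in I) (complex.Re (u x) * derive1 phi x) = - \int[leb]_(x in I) (complex.Re (g x) * phi x).
Proof.
move=> H phi /H; rewrite /Cintegral => -[E _].
have -> : (fun x => complex.Re (u x) * derive1 phi x) = (fun x => complex.Re (u x * (derive1 phi x)%:C)).
  by apply/funext => x; case: (u x) => a b /=; rewrite mulr0 subr0.
rewrite E; congr (- _); apply: eq_Rintegral => x _; by case: (g x) => a b /=; rewrite mulr0 subr0.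
Qed.

Lemma weak_derivative_Im I u (g : R -> R[i]) : is_weak_derivative I u g -> forall phi, C1c I phi ->
  \int[leb]_(x in I) (complex.Im (u x) * derive1 phi x) = - \int[leb]_(x in I) (complex.Im (g x) * phi x).
Proof.
move=> H phi /H; rewrite /Cintegral => -[_ E].
have -> : (fun x => complex.Im (u x) * derive1 phi x) = (fun x => complex.Im (u x * (derive1 phi x)%:C)).
  by apply/funext => x; case: (u x) => a b /=; rewrite mulr0 add0r.
rewrite E; congr (- _); apply: eq_Rintegral => x _; by case: (g x) => a b /=; rewrite mulr0 add0r.
Qed.

Lemma H1_right u : H1 Rpos u -> exists A B Ga Gb : R -> R,
  [/\ halfline 0 A B Ga Gb, forall x, 0 < x -> u x = A x +i* B x,
      trace_right u = A 0 +i* B 0,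
      \int[leb]_(x in Rpos) (normc (weak_derivative Rpos u x) ^+ 2) = \int[leb]_(x in `[0, +oo[) sqsum Ga Gb x
    & forall x, 0 < x -> weak_derivative Rpos u x = Ga x +i* Gb x].
Proof.
move=> Hu; have [g2 gw] := H1_weak_derivative Hu.
case: Hu => cR cI u2 _.
set g := weak_derivative Rpos u in g2 gw *.
pose s x := normc (g x) ^+ 2.
case: g2 => mgR mgI si.
case: u2 => muR muI ui.
have sub (x y : R) : 0 < x -> x <= y -> `[x / 2, y + 1]%classic `<=` (Rpos : set R).
  by move=> x0 xy z /=; rewrite /Rpos/= !in_itv/= => /andP[h _]; rewrite andbT (lt_le_trans _ h)// divr_gt0.
have aux (f h : R -> R) : (forall z, 0 < z -> {for z, continuous f}) -> measurable_fun (`]0, +oo[ : set R) h ->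
    (forall x, 0 < x -> h x ^+ 2 <= s x) ->
    (forall phi, C1c Rpos phi ->
     \int[leb]_(x in Rpos) (f x * derive1 phi x) = - \int[leb]_(x in Rpos) (h x * phi x)) ->
    exists F : R -> R, [/\ continuous F, forall x, 0 < x -> F x = f x,
       forall b, is_primitive 0 b F h & lim (f x @[x --> (0 : R)^'+]) = F 0].
  move=> cf mh hs wk; apply: (halfline_extension cf mh si hs) => x y x0 xy.
  have x2 : 0 < x / 2 by lra.
  apply: (weak_FTC (I := Rpos) (a := x / 2) (b := y + 1)) => //; try lra.
  - exact: sub.
  - by move=> z h1 _; apply: cf; exact: lt_le_trans h1.
  - by apply: (L1_sub_itv (L1_of_sqr (y + 1) mh si hs)) => //; lra.
have [A [cA AE pA tA]] : exists F : R -> R, [/\ continuous F, forall x, 0 < x -> F x = complex.Re (u x),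
    forall b, is_primitive 0 b F (fun x => complex.Re (g x)) &
    lim (complex.Re (u x) @[x --> (0 : R)^'+]) = F 0].
  apply: aux.
  - by move=> z z0; apply: cR; rewrite inE /Rpos/= in_itv/= andbT.
  - exact: mgR.
  - by move=> x _; rewrite /s normc_sqr lerDl sqr_ge0.
  - exact: weak_derivative_Re.
have [B [cB BE pB tB]] : exists F : R -> R, [/\ continuous F, forall x, 0 < x -> F x = complex.Im (u x),
    forall b, is_primitive 0 b F (fun x => complex.Im (g x)) &
    lim (complex.Im (u x) @[x --> (0 : R)^'+]) = F 0].
  apply: aux.
  - by move=> z z0; apply: cI; rewrite inE /Rpos/= in_itv/= andbT.
  - exact: mgI.
  - by move=> x _; rewrite /s normc_sqr lerDr sqr_ge0.
  - exact: weak_derivative_Im.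
exists A, B, (fun x => complex.Re (g x)), (fun x => complex.Im (g x)).
have sE x : s x = sqsum (fun x => complex.Re (g x)) (fun x => complex.Im (g x)) x by rewrite /s normc_sqr.
have iG : L1 `]0, +oo[ (sqsum (fun x => complex.Re (g x)) (fun x => complex.Im (g x))).
  by apply: (@L1_eq R _ s) => //; move=> x _; exact: sE.
have iU : L1 `]0, +oo[ (sqsum A B).
  apply: (@L1_eq R _ (fun x => normc (u x) ^+ 2)) => // x /=; rewrite in_itv/= andbT => x0.
  by rewrite /sqsum AE// BE// normc_sqr.
split.
- by split => //; exact: L1_open_ray.
- by move=> x x0; rewrite AE// BE//; case: (u x).
- by rewrite /trace_right tA tB.
- rewrite -Rintegral_itv_obnd_cbnd//; apply: eq_Rintegral => x _; exact: sE.
- by move=> x _; case: (g x).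
Qed.

(** The left half-line is reflected onto the right one, which turns the weak derivative g(x) into -
    g(- x). *)
Lemma H1_left u : H1 Rneg u -> exists A B Ga Gb : R -> R,
  [/\ halfline 0 A B Ga Gb, forall x, 0 < x -> u (- x) = A x +i* B x,
      trace_left u = A 0 +i* B 0,
      \int[leb]_(x in Rneg) (normc (weak_derivative Rneg u x) ^+ 2) = \int[leb]_(x in `[0, +oo[) sqsum Ga Gb x
    & forall x, 0 < x -> weak_derivative Rneg u (- x) = - (Ga x +i* Gb x)].
Proof.
move=> Hu; have [g2 gw] := H1_weak_derivative Hu.
case: Hu => cR cI u2 _.
set g := weak_derivative Rneg u in g2 gw *.
pose s (x : R) : R := normc (g x) ^+ 2.
case: g2 => mgR mgI si.
case: u2 => muR muI ui.
have refl (x : R) : (`]0, +oo[%classic : set R) x <-> (Rneg : set R) (- x).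
  by rewrite /Rneg /= !in_itv/= andbT oppr_lt0.
have mneg : measurable (Rneg : set (measurableTypeR R)) by exact: measurable_itv.
have sio : L1 `]0, +oo[ (fun x => s (- x)) by apply: (@L1_opp R s Rneg) => //; exact: measurable_itv.
have uio : L1 `]0, +oo[ (fun x => normc (u (- x)) ^+ 2).
  by apply: (@L1_opp R (fun x => normc (u x) ^+ 2) Rneg) => //; exact: measurable_itv.
have sub (x y : R) : 0 < x -> x <= y -> `[- (y + 1), - (x / 2)]%classic `<=` (Rneg : set R).
  move=> x0 xy z /=; rewrite /Rneg/= !in_itv/= => /andP[_ h].
  by rewrite (le_lt_trans h)// oppr_lt0 divr_gt0.
have aux (f h : R -> R) : (forall z, z < 0 -> {for z, continuous f}) -> measurable_fun (Rneg : set R) h ->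
    (forall x, h x ^+ 2 <= s x) ->
    (forall phi, C1c Rneg phi ->
     \int[leb]_(x in Rneg) (f x * derive1 phi x) = - \int[leb]_(x in Rneg) (h x * phi x)) ->
    exists F : R -> R, [/\ continuous F, forall x, 0 < x -> F x = f (- x),
       forall b, is_primitive 0 b F (fun x => - h (- x)) & lim (f x @[x --> (0 : R)^'-]) = F 0].
  move=> cf mh hs wk.
  have mh' : measurable_fun (`]0, +oo[ : set R) (fun x => - h (- x)).
    apply: (@measurableT_comp _ _ _ _ _ _ (-%R : R -> R) _ (fun x : R => h (- x))) => //.
    apply: (@measurable_comp _ _ _ _ _ _ (Rneg : set R) h _ (-%R : R -> R)) => //.
    by move=> _ [x x0 <-]; apply/refl.
  have hs' x : 0 < x -> (- h (- x)) ^+ 2 <= s (- x) by move=> _; rewrite sqrrN.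
  have [|x y x0 xy|F [cF FE pF lF]] := @halfline_extension (fun x => f (- x)) _ _ _ mh' sio hs'.
  - move=> x x0; apply: (@continuous_comp R R R -%R f); first exact: oppr_continuous.
    by apply: cf; rewrite oppr_lt0.
  - have x2 : 0 < x / 2 by lra.
    have hi : L1 `[- (y + 1), - (x / 2)] h.
      have h1 : L1 `[x / 2, y + 1] (fun t => - h (- t)).
        by apply: (L1_sub_itv (L1_of_sqr (y + 1) mh' sio hs')) => //; lra.
      apply: (@L1_eq _ _ (fun t => - - h (- - t))) => //; first by move=> t _; rewrite !opprK.
      apply: (@L1_opp R (fun t => - - h (- t)) `[x / 2, y + 1]) => //; last exact: L1N.
      by move=> t; rewrite /= !in_itv/=; split => /andP[? ?]; apply/andP; split; lra.
    have E : f (- x) - f (- y) = \int[leb]_(t in `[- y, - x]) h t.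
      apply: (weak_FTC (I := Rneg) (a := - (y + 1)) (b := - (x / 2))) => //; try lra.
      + exact: sub.
      + by move=> z _ h1; apply: cf; apply: (le_lt_trans h1); lra.
    have hi' : L1 `[- y, - x] h by apply: (L1_sub_itv hi); lra.
    rewrite -[LHS]opprK opprB E -mulN1r -RintegralZl//.
    rewrite -(@Rintegral_opp R (fun t => -1 * h t) `[- y, - x] `[x, y])//.
    + by apply: eq_Rintegral => t _; rewrite mulN1r.
    + by move=> t; rewrite /= !in_itv/=; split => /andP[? ?]; apply/andP; split; lra.
    + exact: L1Z.
  exists F; split => //; apply/cvg_lim => //.
  have : F (- x) @[x --> (0 : R)^'-] --> F 0.
    apply: cvg_at_left_filter; rewrite -[in X in _ --> X]oppr0.
    by apply: (@continuous_comp R R R -%R F); [exact: oppr_continuous|exact: cF].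
  apply: cvg_trans; apply: near_eq_cvg; near=> x; rewrite FE ?opprK// oppr_gt0.
  by near: x; exact: nbhs_left_lt.
have [A [cA AE pA tA]] : exists F : R -> R, [/\ continuous F, forall x, 0 < x -> F x = complex.Re (u (- x)),
    forall b, is_primitive 0 b F (fun x => - complex.Re (g (- x))) &
    lim (complex.Re (u x) @[x --> (0 : R)^'-]) = F 0].
  apply: (aux (@complex.Re R \o u) (@complex.Re R \o g)).
  - by move=> z z0; apply: cR; rewrite inE /Rneg/= in_itv/=.
  - exact: mgR.
  - by move=> x; rewrite /s normc_sqr lerDl sqr_ge0.
  - exact: weak_derivative_Re.
have [B [cB BE pB tB]] : exists F : R -> R, [/\ continuous F, forall x, 0 < x -> F x = complex.Im (u (- x)),
    forall b, is_primitive 0 b F (fun x => - complex.Im (g (- x))) &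
    lim (complex.Im (u x) @[x --> (0 : R)^'-]) = F 0].
  apply: (aux (@complex.Im R \o u) (@complex.Im R \o g)).
  - by move=> z z0; apply: cI; rewrite inE /Rneg/= in_itv/=.
  - exact: mgI.
  - by move=> x; rewrite /s normc_sqr lerDr sqr_ge0.
  - exact: weak_derivative_Im.
exists A, B, (fun x => - complex.Re (g (- x))), (fun x => - complex.Im (g (- x))).
have sE x : s (- x) = sqsum (fun x => - complex.Re (g (- x))) (fun x => - complex.Im (g (- x))) x.
  by rewrite /s normc_sqr /sqsum !sqrrN.
have iG : L1 `]0, +oo[ (sqsum (fun x => - complex.Re (g (- x))) (fun x => - complex.Im (g (- x)))).
  by apply: (@L1_eq R _ (fun x => s (- x))) => //; move=> x _; exact: sE.
have iU : L1 `]0, +oo[ (sqsum A B).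
  apply: (@L1_eq R _ (fun x => normc (u (- x)) ^+ 2)) => // x /=; rewrite in_itv/= andbT => x0.
  by rewrite /sqsum AE// BE// normc_sqr.
split.
- by split => //; exact: L1_open_ray.
- by move=> x x0; rewrite AE// BE//; case: (u _).
- by rewrite /trace_left tA tB.
- rewrite -Rintegral_itv_obnd_cbnd//.
  transitivity (\int[leb]_(x in `]0, +oo[) s (- x)); last by apply: eq_Rintegral => x _; exact: sE.
  by apply/esym/Rintegral_opp.
- by move=> x _; case: (g _) => a b /=; rewrite /GRing.opp/= !opprK.
Unshelve. all: by end_near. Qed.

End SobolevHalfLine.

(** * Uniqueness of the weak derivative *)

Section Uniqueness.
Context {R : realType}.
Implicit Types (f g h : R -> R).

Lemma primitive0_ae f : L1 setT f -> (forall x : R, \int[leb]_(t in `]-oo, x]) f t = 0) ->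
  {ae lebesgue_measure, forall x : R, f x = 0}.
Proof.
move=> fi F0.
have fi' (y : R) : L1 `]-oo, y] f by apply: L1S fi.
have loc : locally_integrable [set: R] f by apply: open_integrable_locally => //; exact: openT.
have := FTC1Ny fi' loc; apply: filterS; first exact: (ae_filter_ringOfSetsType (@lebesgue_measure R)).
move=> x [_ <-].
rewrite (_ : (fun _ => _) = cst 0); last by apply/funext => y; rewrite F0.
by rewrite derive1E derive_val.
Qed.

(** By Lebesgue differentiation, equal primitives force equality almost everywhere. Needed because
    the weak derivative is a chosen version, known only through its primitive. *)
Lemma Rintegral_sqr_unique h1 h2 (b : R) : L1 `[0, b] h1 -> L1 `[0, b] h2 ->
  (forall x, 0 <= x -> x <= b -> \int[leb]_(t in `[0, x]) h1 t = \int[leb]_(t in `[0, x]) h2 t) ->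
  \int[leb]_(t in `[0, b]) (h1 t ^+ 2) = \int[leb]_(t in `[0, b]) (h2 t ^+ 2).
Proof.
move=> i1 i2 E.
pose h (x : R) : R := h1 x - h2 x.
have ih : L1 `[0, b] h by exact: L1B.
have I0 x : 0 <= x -> x <= b -> \int[leb]_(t in `[0, x]) h t = 0.
  move=> x0 xb; rewrite RintegralB//; [|exact: L1_sub_itv i1 _ _|exact: L1_sub_itv i2 _ _].
  by rewrite E// subrr.
pose f := h \_ `[0, b].
have fi : L1 setT f by exact: L1_patch.
have F0 (x : R) : \int[leb]_(t in `]-oo, x]) f t = 0.
  have [x0|x0] := ltP x 0.
    rewrite (@eq_Rintegral _ _ _ _ _ (cst 0)); first by rewrite Rintegral_cst//= mul0r.
    move=> t /[!inE]/=; rewrite in_itv/= => tx; rewrite /f patchE memNset//= in_itv/=.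
    by apply/negP; rewrite negb_and -ltNge (le_lt_trans tx).
  have [b0|b0] := ltP b 0.
    rewrite (@eq_Rintegral _ _ _ _ _ (cst 0)); first by rewrite Rintegral_cst//= mul0r.
    move=> t _; rewrite /f patchE memNset//= in_itv/=; apply/negP; rewrite negb_and.
    by case: (leP 0 t) => //= t0; rewrite -ltNge (lt_le_trans b0).
  pose y := Num.min x b.
  have y0 : 0 <= y by rewrite le_min x0.
  have yx : y <= x by rewrite ge_min lexx.
  have yb : y <= b by rewrite ge_min lexx orbT.
  rewrite -[RHS](I0 y y0 yb) (@Rintegral_support R f 0 y).
  - apply: eq_Rintegral => t /[!inE]/=; rewrite in_itv/= => /andP[t0 ty].
    by rewrite /f patchE mem_set//= in_itv/= t0 (le_trans ty yb).
  - by move=> t /=; rewrite !in_itv/= => /andP[_ ty]; exact: le_trans ty yx.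
  - move=> t /=; rewrite in_itv/= => tx ht; rewrite /f patchE memNset//= in_itv/=.
    move=> /andP[t0 tb]; apply: ht; rewrite t0/=.
    by rewrite le_min tx.
have ae0 := primitive0_ae fi F0.
congr fine; apply: ae_eq_integral => //.
- by apply/measurable_EFinP; apply: measurable_funX; exact: L1_meas i1.
- by apply/measurable_EFinP; apply: measurable_funX; exact: L1_meas i2.
- move: ae0; apply: filterS; first exact: (ae_filter_ringOfSetsType (@lebesgue_measure R)).
  move=> x fx0 xb; congr EFin.
  move: fx0; rewrite /f patchE mem_set// /h => /eqP; rewrite subr_eq0 => /eqP ->//.
Qed.

Lemma Rintegral_tail_eq f g : L1 `[0, +oo[ f -> L1 `[0, +oo[ g ->
  (forall x, 0 <= x -> 0 <= f x) -> (forall x, 0 <= x -> 0 <= g x) ->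
  (forall Y, 0 <= Y -> \int[leb]_(t in `[0, Y]) f t = \int[leb]_(t in `[0, Y]) g t) ->
  \int[leb]_(t in `[0, +oo[) f t = \int[leb]_(t in `[0, +oo[) g t.
Proof.
move=> fi gi f0 g0 E.
have key (p q : R -> R) : L1 `[0, +oo[ p -> L1 `[0, +oo[ q ->
  (forall x, 0 <= x -> 0 <= p x) -> (forall x, 0 <= x -> 0 <= q x) ->
  (forall Y, 0 <= Y -> \int[leb]_(t in `[0, Y]) p t = \int[leb]_(t in `[0, Y]) q t) ->
  \int[leb]_(t in `[0, +oo[) p t <= \int[leb]_(t in `[0, +oo[) q t.
  move=> ip iq p0 q0 pq; apply/ler_addgt0Pr => e e0.
  have [X X0 HX] := tail_small ip p0 e0.
  rewrite (Rintegral_tail ip X0) (Rintegral_tail iq X0) pq// -addrA lerD2l.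
  apply: le_trans (ltW (HX X (lexx _))) _; rewrite lerDr.
  by apply: Rintegral_tail_ge0 => x xX; apply: q0; exact: le_trans xX.
by apply/eqP; rewrite eq_le !key// => Y Y0; rewrite E.
Qed.

End Uniqueness.

(** * The soliton profile *)
Section ProfileIntegrals.
Context {R : realType} (mu k x0 C : R).
Hypotheses (mu0 : 0 < mu) (k0 : 0 < k) (C0 : 0 < C) (CE : C `^ mu = k ^+ 2 * (mu + 1)).

Let Th (x : R) : R := tanh (mu * k * (x + x0)).
(** Squared modulus of a translated soliton: [CE] says that [C] is the square of the amplitude. *)
Let rho (x : R) : R := C * wt mu (Th x).

Lemma tanh_cvg1 : Th x @[x --> +oo%R] --> (1 : R).
Proof.
have mk0 : 0 < mu * k by rewrite mulr_gt0.
apply/cvgrPdist_lt => e e0.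
near=> x.
have y0 : e^-1 < mu * k * (x + x0).
  rewrite -ltr_pdivrMl// -ltrBlDr; near: x; apply: nbhs_pinfty_gt; exact: num_real.
rewrite /Th tanhE.
set y := mu * k * (x + x0) in y0 *.
have ye : 0 < y by apply: lt_trans y0; rewrite invr_gt0.
have h : 2 * y < expR (2 * y) + 1 by have := expR_ge1Dx (2 * y); lra.
have -> : 1 - (1 - 2 / (expR (2 * y) + 1)) = 2 / (expR (2 * y) + 1) by ring.
have E0 : 0 < expR (2 * y) + 1 by rewrite addr_gt0 ?expR_gt0.
rewrite ger0_norm ?divr_ge0 ?ltW// ltr_pdivrMr//.
have : 1 < e * y by rewrite mulrC -ltr_pdivrMr// div1r.
nra.
Unshelve. all: by end_near. Qed.

Lemma Th_derive (x : R) : is_derive x (1:R) Th (mu * k * (1 - Th x ^+ 2)).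
Proof.
have -> : mu * k * (1 - Th x ^+ 2) = (1 - tanh (mu * k * (x + x0)) ^+ 2) * (mu * k * (1 + 0)).
  by rewrite /Th; ring.
apply: (@is_derive1_comp R (@tanh R) (fun x => mu * k * (x + x0))).
  exact: is_derive_tanh.
Qed.

Lemma Th_cont : continuous Th.
Proof.
by move=> x; apply: differentiable_continuous; apply/derivable1_diffP; case: (Th_derive x).
Qed.

Lemma wt_Th x : wt mu (Th x) = sech_profile mu k (x + x0) ^+ 2.
Proof.
rewrite wtE; last by have := tanh_bnd (mu * k * (x + x0)); rewrite -/(Th x); lra.
rewrite /Th sech2E /sech_profile; have [c <-] := expR_total (cosh_gt0 (mu * k * (x + x0))).
by rewrite !expr2 !powR_expRE; congr expR; field; rewrite gt_eqF.
Qed.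

Lemma profile_powR x : rho x `^ (mu + 1) = k ^+ 2 * (mu + 1) * (1 - Th x ^+ 2) * rho x.
Proof.
have w0 : 0 < wt mu (Th x) by apply: wt_gt0; exact: tanh_bnd.
have r0 : 0 < rho x by rewrite mulr_gt0.
rewrite powRD; last by rewrite (gt_eqF r0) implybT.
rewrite powRr1 ?ltW//; congr (_ * _).
rewrite /rho powRM ?ltW// CE; congr (_ * _).
rewrite wtE; last by have := tanh_bnd (mu * k * (x + x0)); rewrite -/(Th x); lra.
have a0 : 0 < 1 - Th x ^+ 2 by rewrite subr_gt0; have := tanh_bnd (mu * k * (x + x0)); rewrite -/(Th x); nra.
by rewrite -powRrM mulVf ?gt_eqF// powRr1// ltW.
Qed.

Let D := C `^ (mu + 1) / (mu * k).
(** Antiderivative of the mass density, normalized to vanish at +oo, where Th tends to 1 and Psi 1 =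
    0. *)
Let F (x : R) : R := - (D * Psi mu (Th x)).

Lemma rho_derive (x : R) : is_derive x (1:R) rho (- (2 * k) * Th x * rho x).
Proof.
have dp : is_derive x (1:R) (fun x => sech_profile mu k (x + x0)) (- k * Th x * sech_profile mu k (x + x0)).
  rewrite -[X in is_derive _ _ _ X]mulr1.
  apply: (@is_derive1_comp R (sech_profile mu k) (fun x => x + x0)).
    by apply: is_derive_sech_profile; rewrite gt_eqF.
  by rewrite -[X in is_derive _ _ _ X]addr0; exact: (@is_deriveD R R R id (cst x0)).
have E : - (2 * k) * Th x * rho x = C * (sech_profile mu k (x + x0) * (- k * Th x * sech_profile mu k (x + x0))
    + sech_profile mu k (x + x0) * (- k * Th x * sech_profile mu k (x + x0))).
  by rewrite /rho wt_Th; ring.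
rewrite {}E.
have -> : rho = C \*: (fun x => sech_profile mu k (x + x0) * sech_profile mu k (x + x0)).
  by apply/funext => y; rewrite /rho wt_Th expr2.
exact: (@is_deriveZ _ _ _ _ C _ _ _ (is_deriveM dp dp)).
Qed.

Lemma F_derive (x : R) : is_derive x (1:R) F (rho x `^ (mu + 1)).
Proof.
have -> : rho x `^ (mu + 1) = - D *: (- wt mu (Th x) * (mu * k * (1 - Th x ^+ 2))).
  rewrite profile_powR /D powRD; last by rewrite (gt_eqF C0) implybT.
  rewrite powRr1 ?ltW// CE /rho -[_ *: _]/(_ * _); field.
  by rewrite !gt_eqF.
have -> : F = - D \*: (Psi mu \o Th) by apply/funext => y; rewrite /F -mulNr.
apply: is_deriveZ; apply: is_derive1_comp; first exact: Psi_derive.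
exact: Th_derive.
Qed.

Lemma F_cvg : F x @[x --> +oo%R] --> (0 : R).
Proof.
rewrite -oppr0 -(mulr0 D) -(Psi1 mu).
apply: cvgN; apply: cvgM; first exact: cvg_cst.
apply: (cvg_comp _ _ tanh_cvg1); exact: Psi_cont.
Qed.

Lemma rho_cvg : rho x @[x --> +oo%R] --> (0 : R).
Proof.
rewrite -(mulr0 C) -(wt_out (t := 1) mu0); last by rewrite lexx orbT.
apply: cvgM; first exact: cvg_cst.
apply: (cvg_comp _ _ tanh_cvg1); exact: wt_cont.
Qed.

Let derive_cont (f f' : R -> R) : (forall x, is_derive x (1:R) f (f' x)) -> continuous f.
Proof.
by move=> df x; apply: differentiable_continuous; apply/derivable1_diffP; case: (df x).
Qed.

(** Stated in the extended reals: for a nonnegative integrand the formula precedes integrability,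
    which then follows from the finite value. *)
Lemma FTC_ray (f f' : R -> R) (l : R) : (forall x, is_derive x (1:R) f (f' x)) -> continuous f' ->
  (forall x, 0 <= f' x) -> f x @[x --> +oo%R] --> l ->
  (\int[leb]_(x in `[0%R, +oo[) (f' x)%:E = (l - f 0)%R%:E)%E.
Proof.
move=> df cf' f'0 fl.
apply: (@ge0_continuous_FTC2y R f' f 0 l) => //.
- exact: continuous_subspaceT.
- by apply: cvg_at_right_filter; exact: (derive_cont df).
- by move=> x _; rewrite derive1E; case: (df x).
Qed.

Lemma profile_mass : (\int[leb]_(x in `[0%R, +oo[) (rho x `^ (mu + 1))%R%:E = (D * Psi mu (Th 0))%R%:E)%E.
Proof.
have cr : continuous rho := derive_cont rho_derive.
rewrite (FTC_ray F_derive _ _ F_cvg); first by rewrite sub0r /F opprK.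
  apply: continuous_powR => //; last by rewrite addr_gt0.
  by move=> x; rewrite mulr_ge0 ?wt_ge0// ltW.
by move=> x; exact: powR_ge0.
Qed.

Lemma profile_energy : (\int[leb]_(x in `[0%R, +oo[) (k ^+ 2 * (1 + Th x ^+ 2) * rho x)%R%:E =
   (k * Th 0 * rho 0 + D * Psi mu (Th 0))%R%:E)%E.
Proof.
have cr : continuous rho := derive_cont rho_derive.
have cT := Th_cont.
(* Both deficits vanish on a soliton, so the energy density is the derivative of the boundary term
   plus the mass density. *)
pose E (x : R) : R := - k * (Th x * rho x) + F x.
have dE x : is_derive x (1:R) E (k ^+ 2 * (1 + Th x ^+ 2) * rho x).
  have d1 := @is_deriveZ R R R _ (- k) _ _ _ (is_deriveM (Th_derive x) (rho_derive x)).
  apply: (is_derive_eq (is_deriveD d1 (F_derive x))).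
  rewrite profile_powR -![_ *: _]/(_ * _); ring.
rewrite (FTC_ray (l := 0) dE).
- by congr EFin; rewrite /E /F; ring.
- move=> x; apply: (@continuousM R R (fun x => k ^+ 2 * (1 + Th x ^+ 2)) rho); last exact: cr.
  apply: (@continuousM R R (cst (k ^+ 2)) (fun x => 1 + Th x ^+ 2)); first exact: cst_continuous.
  apply: (@continuousD R R R (cst 1) (fun x => Th x ^+ 2)); first exact: cst_continuous.
  by apply: (@continuous_comp R R R Th (fun y => y ^+ 2)); [exact: cT|exact: exprn_continuous].
- move=> x; rewrite !mulr_ge0 ?sqr_ge0 ?addr_ge0 ?sqr_ge0 ?wt_ge0//; exact: ltW.
- rewrite -[X in _ --> X](addr0 0) -[in X in _ --> X + _](mulr0 (- k)).
  rewrite -[in X in _ --> X + _](mulr0 1).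
  apply: cvgD; last exact: F_cvg.
  apply: cvgM; first exact: cvg_cst.
  by apply: cvgM; [exact: tanh_cvg1|exact: rho_cvg].
Qed.

End ProfileIntegrals.

Section ProfileHalfLine.
Context {R : realType} (mu k x0 C : R).
Hypotheses (mu0 : 0 < mu) (k0 : 0 < k) (C0 : 0 < C) (CE : C `^ mu = k ^+ 2 * (mu + 1)).

Let Th (x : R) : R := tanh (mu * k * (x + x0)).
Let p (x : R) : R := sech_profile mu k (x + x0).

Lemma profile_derive (x : R) : is_derive x (1:R) p (- k * Th x * p x).
Proof.
rewrite -[X in is_derive _ _ _ X]mulr1.
apply: (@is_derive1_comp R (sech_profile mu k) (fun x => x + x0)).
  by apply: is_derive_sech_profile; rewrite gt_eqF.
by rewrite -[X in is_derive _ _ _ X]addr0; exact: (@is_deriveD R R R id (cst x0)).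
Qed.

Lemma profile_cont : continuous p.
Proof.
by move=> x; apply: differentiable_continuous; apply/derivable1_diffP; case: (profile_derive x).
Qed.

Lemma profile_derivative_cont : continuous (fun x => - k * Th x * p x).
Proof.
move=> x; apply: (@continuousM R R (fun x => - k * Th x) p); last exact: profile_cont.
apply: (@continuousM R R (cst (- k)) Th); first exact: cst_continuous.
exact: Th_cont.
Qed.

Lemma profile_sqr x : wt mu (Th x) = p x ^+ 2.
Proof. exact: wt_Th. Qed.

Lemma L1_of_integral (f : R -> R) (r : R) : measurable_fun (`[0, +oo[ : set (measurableTypeR R)) f ->
  (forall x, 0 <= f x) ->
  (\int[leb]_(x in `[0%R, +oo[) (f x)%:E = r%:E)%E -> L1 `[0, +oo[ f.
Proof.
move=> mf f0 E; apply/integrableP; split; first exact/measurable_EFinP.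
under eq_integral do rewrite /= ger0_norm//.
by rewrite E ltry.
Qed.

Lemma profile_energy_L1 : L1 `[0, +oo[ (fun x => k ^+ 2 * (1 + Th x ^+ 2) * (C * wt mu (Th x))).
Proof.
apply: (L1_of_integral _ _ (profile_energy x0 mu0 k0 C0 CE)).
  apply: measurable_funS (continuous_measurable_fun _) => // x.
  have cT : continuous Th := @Th_cont R mu k x0.
  apply: (@continuousM R R (fun x => k ^+ 2 * (1 + Th x ^+ 2)) (fun x => C * wt mu (Th x))).
    apply: (@continuousM R R (cst (k ^+ 2)) (fun x => 1 + Th x ^+ 2)); first exact: cst_continuous.
    apply: (@continuousD R R R (cst 1) (fun x => Th x ^+ 2)); first exact: cst_continuous.
    by apply: (@continuous_comp R R R Th (fun y => y ^+ 2)); [exact: cT|exact: exprn_continuous].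
  apply: (@continuousM R R (cst C) (fun x => wt mu (Th x))); first exact: cst_continuous.
  by apply: (@continuous_comp R R R Th (wt mu)); [exact: cT|exact: wt_cont].
move=> x; rewrite !mulr_ge0 ?sqr_ge0 ?addr_ge0 ?sqr_ge0 ?wt_ge0//; exact: ltW.
Qed.

Lemma profile_sqr_L1 (c : R) : L1 `[0, +oo[ (fun x => (c * p x) ^+ 2).
Proof.
apply: (@L1_le _ _ _ (fun x => (c ^+ 2 / (k ^+ 2 * C)) * (k ^+ 2 * (1 + Th x ^+ 2) * (C * wt mu (Th x))))) => //.
- apply: measurable_funX; apply: measurable_funS (continuous_measurable_fun _) => // x.
  by apply: (@continuousM R R (cst c) p); [exact: cst_continuous|exact: profile_cont].
- move=> x _; rewrite ger0_norm ?sqr_ge0//.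
  have -> : c ^+ 2 / (k ^+ 2 * C) * (k ^+ 2 * (1 + Th x ^+ 2) * (C * wt mu (Th x))) =
     (c * p x) ^+ 2 + (c * Th x * p x) ^+ 2.
    by rewrite profile_sqr; field; rewrite !gt_eqF.
  by rewrite lerDl sqr_ge0.
- by apply: L1Z => //; exact: profile_energy_L1.
Qed.

Lemma profile_derivative_sqr_L1 (c : R) : L1 `[0, +oo[ (fun x => (c * (- k * Th x * p x)) ^+ 2).
Proof.
apply: (@L1_le _ _ _ (fun x => k ^+ 2 * (c * p x) ^+ 2)) => //.
- apply: measurable_funX; apply: measurable_funS (continuous_measurable_fun _) => // x.
  apply: (@continuousM R R (cst c) (fun x => - k * Th x * p x)); first exact: cst_continuous.
  exact: profile_derivative_cont.
- move=> x _; rewrite ger0_norm ?sqr_ge0//.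
  have -> : (c * (- k * Th x * p x)) ^+ 2 = Th x ^+ 2 * (k ^+ 2 * (c * p x) ^+ 2) by ring.
  have t1 : Th x ^+ 2 <= 1.
    have := tanh_bnd (mu * k * (x + x0)); rewrite -/(Th x) => h.
    by rewrite expr2; nra.
  by rewrite ler_piMl// -exprMn sqr_ge0.
- by apply: L1Z => //; exact: profile_sqr_L1.
Qed.

(** [Ga] and [Gb] are known only up to null sets, so the energies are compared on each segment
    [0, Y] through primitives, and then on the whole ray. *)
Lemma profile_halfline_values A B Ga Gb (cA cB : R) : halfline 0 A B Ga Gb ->
  cA ^+ 2 + cB ^+ 2 = C ->
  (forall x, 0 <= x -> A x = cA * p x) -> (forall x, 0 <= x -> B x = cB * p x) ->
  mass mu A B 0 = C `^ (mu + 1) / (mu * k) * Psi mu (Th 0) /\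
  energy k A B Ga Gb 0 = k * Th 0 * sqsum A B 0 + mass mu A B 0.
Proof.
move=> hl cC AE BE.
have sE x : 0 <= x -> sqsum A B x = C * wt mu (Th x).
  by move=> x_ge0; rewrite /sqsum AE// BE// profile_sqr -cC; ring.
have M : mass mu A B 0 = C `^ (mu + 1) / (mu * k) * Psi mu (Th 0).
  rewrite /mass /Rintegral -[RHS]/(fine (_%:E)) -(profile_mass x0 mu0 k0 C0 CE).
  congr fine; apply: eq_integral => x /[!inE]/=; rewrite in_itv/= andbT => x_ge0.
  by rewrite sE.
split => //; rewrite M.
have <- : \int[leb]_(x in `[0, +oo[) (k ^+ 2 * (1 + Th x ^+ 2) * (C * wt mu (Th x))) =
   k * Th 0 * sqsum A B 0 + C `^ (mu + 1) / (mu * k) * Psi mu (Th 0).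
  by rewrite /Rintegral (profile_energy x0 mu0 k0 C0 CE) sE.
have dprim (c : R) (F f : R -> R) : (forall b, is_primitive 0 b F f) -> (forall x, 0 <= x -> F x = c * p x) ->
   forall Y, 0 <= Y -> \int[leb]_(t in `[0, Y]) (f t ^+ 2) = \int[leb]_(t in `[0, Y]) ((c * (- k * Th t * p t)) ^+ 2).
  move=> Ff FE Y Y0; apply: (@Rintegral_sqr_unique R f (fun t => c * (- k * Th t * p t))).
  - exact: (Ff Y).1.
  - apply: L1_cont => x.
    apply: (@continuousM R R (cst c) (fun x => - k * Th x * p x)); first exact: cst_continuous.
    exact: profile_derivative_cont.
  - move=> x x_ge0 _; rewrite -(primitiveB (Ff x))// !FE//.
    have pp : is_primitive 0 x p (fun t => - k * Th t * p t).
      apply: primitive_C1; [exact: profile_cont|exact: profile_derivative_cont|].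
      by move=> t _ _; exact: profile_derive.
    by rewrite (primitiveB (primitiveZ c pp)).
have i1 := energy_L1 k hl.
apply: Rintegral_tail_eq => //.
- exact: profile_energy_L1.
- by move=> x _; rewrite addr_ge0 ?sqsum_ge0// mulr_ge0 ?sqr_ge0 ?sqsum_ge0.
- move=> x _; rewrite !mulr_ge0 ?sqr_ge0 ?addr_ge0 ?sqr_ge0 ?wt_ge0//; exact: ltW.
move=> Y Y0.
have iG : L1 `[0, Y] (sqsum Ga Gb) := L1_tail_seg Y (hl_L1G hl) (lexx _).
have iS : L1 `[0, Y] (sqsum A B) := L1_tail_seg Y (hl_L1 hl) (lexx _).
have iGa : L1 `[0, Y] (fun t => Ga t ^+ 2).
  apply: (@L1_le _ _ _ (sqsum Ga Gb)) => //.
    by apply: measurable_funX; exact: L1_meas (hl_primA hl Y).1.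
  by move=> x _; rewrite ger0_norm ?sqr_ge0// /sqsum lerDl sqr_ge0.
have iGb : L1 `[0, Y] (fun t => Gb t ^+ 2).
  apply: (@L1_le _ _ _ (sqsum Ga Gb)) => //.
    by apply: measurable_funX; exact: L1_meas (hl_primB hl Y).1.
  by move=> x _; rewrite ger0_norm ?sqr_ge0// /sqsum lerDr sqr_ge0.
have j1 (c : R) : L1 `[0, Y] (fun t => (c * (- k * Th t * p t)) ^+ 2).
  by apply: (@L1_tail_seg R _ 0) => //; exact: profile_derivative_sqr_L1.
rewrite RintegralD//; last exact: L1Z.
rewrite [X in X + _]RintegralD//.
rewrite (dprim cA A Ga (hl_primA hl) AE Y Y0) (dprim cB B Gb (hl_primB hl) BE Y Y0).
rewrite -!RintegralD//; [|exact: L1D|exact: L1Z].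
apply: eq_Rintegral => x /[!inE]/=; rewrite in_itv/= => /andP[x_ge0 _].
by rewrite sE// profile_sqr -cC; ring.
Qed.

End ProfileHalfLine.

(** * Smooth functions as elements of H^1 *)

Section TestIntegration.
Context {R : realType}.

Lemma C1c_integral_by_parts (f f' phi : R -> R) (I : set R) :
  (forall x, is_derive x (1:R) f (f' x)) -> continuous f' -> C1c I phi ->
  \int[leb]_(x in I) (f x * derive1 phi x) = - \int[leb]_(x in I) (f' x * phi x).
Proof.
move=> df cf' [dphi cphi' [K [cK KI phi0]]].
have clK : closed K by apply: compact_closed => //; exact: Rhausdorff.
have phi'0 x : ~ K x -> derive1 phi x = 0.
  move=> Kx; apply: derive1_locally0.
  have : nbhs x (~` K) by apply: open_nbhs_nbhs; split => //; exact/closed_openC.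
  by apply: filterS => t; exact: phi0.
have [M [_ HM]] := compact_bounded cK.
pose b := `|M| + 1.
have Mb : M < b by rewrite /b (le_lt_trans (ler_norm _))// ltrDl.
have b0 : 0 < b by rewrite /b ltr_wpDl.
have Kb x : K x -> - b < x < b.
  move=> Kx; rewrite -ltr_norml; apply: le_lt_trans (HM ((M + b) / 2) _ x Kx) _; lra.
have swap (h : R -> R) : (forall x, ~ K x -> h x = 0) ->
    \int[leb]_(x in I) h x = \int[leb]_(x in `[- b, b]) h x.
  move=> h0; rewrite Rintegral_mkcond [RHS]Rintegral_mkcond; congr Rintegral.
  apply/funext => x; rewrite !patchE; have [Kx|Kx] := pselect (K x).
    rewrite (mem_set (KI _ Kx)) mem_set//= in_itv/=.
    by have /andP[h1 h2] := Kb x Kx; rewrite !ltW.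
  by rewrite h0//; case: ifP; case: ifP.
rewrite !swap; last 2 first.
- by move=> x Kx; rewrite phi0// mulr0.
- by move=> x Kx; rewrite phi'0// mulr0.
have cf : continuous f.
  by move=> x; apply: differentiable_continuous; apply/derivable1_diffP; case: (df x).
have cphi : continuous phi.
  by move=> x; apply: differentiable_continuous; apply/derivable1_diffP; exact: dphi.
have pf : is_primitive (- b) b f f' by apply: primitive_C1.
have pphi : is_primitive (- b) b phi (derive1 phi).
  apply: primitive_C1 => // x _ _; split; first exact: dphi.
  by rewrite derive1E.
have bb : - b <= b by lra.
have := primitiveB (primitiveM cf cphi pf pphi) (lexx _) bb (lexx _).
have out x : (x <= - b) || (b <= x) -> phi x = 0.
  by move=> h; apply: phi0 => /Kb; lra.
rewrite !out ?lexx ?orbT// !mulr0 subr0 RintegralD//.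
- by move=> /esym E; apply/eqP; rewrite -addr_eq0 addrC E.
- by apply: L1_mul_cont => //; exact: L1_cont.
- by apply: L1_cont => x; apply: (@continuousM R R f (derive1 phi)); [exact: cf|exact: cphi'].
Qed.

End TestIntegration.

Section SmoothSobolev.
Context {R : realType}.
Implicit Types (I : set R) (u : R -> R[i]) (f : R -> R).

Lemma normc_real (r : R) : normc r%:C ^+ 2 = r ^+ 2.
Proof. by rewrite normc_sqr/= expr0n addr0. Qed.

Lemma L2_real I u f : measurable (I : set (measurableTypeR R)) ->
  (forall x, I x -> u x = (f x)%:C) -> continuous f ->
  L1 I (fun x => f x ^+ 2) -> L2 I u.
Proof.
move=> mI uf cf fi; split.
- apply: (@eq_measurable_fun _ _ R R I f) => [x /[!inE] Ix|]; first by rewrite /= uf.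
  by apply: measurable_funS (continuous_measurable_fun cf).
- apply: (@eq_measurable_fun _ _ R R I (cst 0)) => [x /[!inE] Ix|]; first by rewrite /= uf.
  exact: measurable_cst.
- apply: (@L1_eq R I (fun x => f x ^+ 2)) => // x Ix.
  by rewrite uf// normc_real.
Qed.

Lemma H1_smooth I u f f' : measurable (I : set (measurableTypeR R)) -> open I ->
  (forall x, I x -> u x = (f x)%:C) -> (forall x, is_derive x (1:R) f (f' x)) -> continuous f' ->
  L1 I (fun x => f x ^+ 2) -> L1 I (fun x => f' x ^+ 2) -> H1 I u.
Proof.
move=> mI oI uf df cf' fi f'i.
have cf : continuous f.
  by move=> x; apply: differentiable_continuous; apply/derivable1_diffP; case: (df x).
have nearE (x : R) : I x -> \near x, u x = (f x)%:C.
  move=> Ix; have : nbhs x I by exact: open_nbhs_nbhs.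
  by apply: filterS => t; exact: uf.
split.
- move=> x /[!inE] Ix; rewrite /continuous_at /= uf//=.
  have := cf x; apply: cvg_trans; apply: near_eq_cvg.
  by apply: filterS (nearE x Ix) => t /= ->.
- move=> x /[!inE] Ix; rewrite /continuous_at /= uf//=.
  have : (fun=> 0 : R) t @[t --> x] --> (0 : R) by exact: cvg_cst.
  apply: cvg_trans; apply: near_eq_cvg.
  by apply: filterS (nearE x Ix) => t /= ->.
- exact: (L2_real mI uf).
exists (fun x => (f' x)%:C); first by apply: (L2_real (f := f') mI).
move=> phi phiC; rewrite /Cintegral.
have ibp := C1c_integral_by_parts df cf' phiC.
have -> : \int[leb]_(x in I) complex.Re (u x * (derive1 phi x)%:C) = \int[leb]_(x in I) (f x * derive1 phi x).
  by apply: eq_Rintegral => x /[!inE] Ix; rewrite uf//= mulr0 subr0.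
have -> : \int[leb]_(x in I) complex.Re ((f' x)%:C * (phi x)%:C) = \int[leb]_(x in I) (f' x * phi x).
  by apply: eq_Rintegral => x _; rewrite /= mulr0 subr0.
have -> : \int[leb]_(x in I) complex.Im (u x * (derive1 phi x)%:C) = 0.
  rewrite (@eq_Rintegral _ _ _ _ _ (cst 0)) ?Rintegral_cst ?mul0r//.
  by move=> x /[!inE] Ix; rewrite uf//= mul0r mulr0 addr0.
have -> : \int[leb]_(x in I) complex.Im ((f' x)%:C * (phi x)%:C) = 0.
  rewrite (@eq_Rintegral _ _ _ _ _ (cst 0)) ?Rintegral_cst ?mul0r//.
  by move=> x _; rewrite /= mul0r mulr0 addr0.
by rewrite ibp /GRing.opp/= oppr0.
Qed.

End SmoothSobolev.

(** * The action and Nehari functionals in half-line terms *)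

Section Functionals.
Context {R : realType}.
Implicit Types (u : R -> R[i]) (mu v tau k : R).

Lemma normc_powR (z : R[i]) (r : R) : normc z `^ (2 * r) = (complex.Re z ^+ 2 + complex.Im z ^+ 2) `^ r.
Proof.
have n0 : 0 <= normc z by case: z => x y; exact: sqrtr_ge0.
by rewrite powRrM -normc_sqr powR_mulrn.
Qed.

(** Both functionals depend only on [Q] and [N]. On the Nehari set Q = N, so the action is a fixed
    positive multiple of the mass [N], and minimizing one is minimizing the other. *)
Lemma halfline_decomposition u mu v tau k : 0 < mu -> H1tau tau u ->
  exists A B Ga Gb A' B' Ga' Gb' : R -> R,
  [/\ halfline 0 A B Ga Gb, halfline 0 A' B' Ga' Gb',
      (forall x, 0 < x -> u (- x) = A x +i* B x) /\ (forall x, 0 < x -> u x = A' x +i* B' x),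
      A' 0 = tau * A 0 /\ B' 0 = tau * B 0 &
      let N := mass mu A B 0 + mass mu A' B' 0 in
      let Q := energy k A B Ga Gb 0 + energy k A' B' Ga' Gb' 0 - v * sqsum A B 0 in
      nehari mu v (k ^+ 2) u = Q - N /\
      action mu v (k ^+ 2) u = 1 / 2 * Q - 1 / (2 * mu + 2) * N].
Proof.
move=> mu0 [Hl Hr Ht].
have [A [B [Ga [Gb [hl ul tl El _]]]]] := H1_left Hl.
have [A' [B' [Ga' [Gb' [hr ur tr Er _]]]]] := H1_right Hr.
exists A, B, Ga, Gb, A', B', Ga', Gb'.
have P (r : R) : 0 < r -> L1 `[0, +oo[ (fun x => sqsum A B x `^ r) -> L1 `[0, +oo[ (fun x => sqsum A' B' x `^ r) ->
    normp_pow (2 * r) u = \int[leb]_(x in `[0, +oo[) sqsum A B x `^ r + \int[leb]_(x in `[0, +oo[) sqsum A' B' x `^ r.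
  move=> r0 il ir; rewrite /normp_pow; apply: Rintegral_whole => // x x0.
    by rewrite ur// normc_powR.
  by rewrite ul// normc_powR.
have NE : normp_pow (2 * mu + 2) u = mass mu A B 0 + mass mu A' B' 0.
  have -> : 2 * mu + 2 = 2 * (mu + 1) by ring.
  by rewrite P ?addr_gt0//; [exact: (mass_L1 hl mu0)|exact: (mass_L1 hr mu0)].
have SE : normp_pow 2 u = \int[leb]_(x in `[0, +oo[) sqsum A B x + \int[leb]_(x in `[0, +oo[) sqsum A' B' x.
  have p1 (F G : R -> R) : (fun x => sqsum F G x `^ 1) = sqsum F G.
    by apply/funext => x; rewrite powRr1// sqsum_ge0.
  by have := P 1 ltr01; rewrite !p1 mulr1 => -> //; [exact: hl_L1 hl|exact: hl_L1 hr].
have EE (F G Gf Gg : R -> R) : halfline 0 F G Gf Gg -> energy k F G Gf Gg 0 =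
    \int[leb]_(x in `[0, +oo[) sqsum Gf Gg x + k ^+ 2 * \int[leb]_(x in `[0, +oo[) sqsum F G x.
  move=> h; rewrite /energy RintegralD//; [|exact: hl_L1G h|by apply: L1Z => //; exact: hl_L1 h].
  by rewrite RintegralZl//; exact: hl_L1 h.
have T : normc (trace_left u) ^+ 2 = sqsum A B 0 by rewrite tl normc_sqr.
have [t1 t2] : A' 0 = tau * A 0 /\ B' 0 = tau * B 0.
  by move: Ht; rewrite tr tl => -[-> ->]; rewrite !mul0r subr0 addr0.
split=> //; rewrite /nehari /action /norm2_deriv_sq El Er NE SE T (EE _ _ _ _ hl) (EE _ _ _ _ hr).
set i1 := \int[leb]_(_ in _) _; set i2 := \int[leb]_(_ in _) sqsum Ga' Gb' _.
set i3 := \int[leb]_(_ in _) sqsum A B _; set i4 := \int[leb]_(_ in _) sqsum A' B' _.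
move: i1 i2 i3 i4 (mass _ _ _ _) (mass _ _ _ _) (sqsum A B 0) (2 * mu + 2)^-1 => i1 i2 i3 i4 m1 m2 s c.
by split; ring.
Qed.

End Functionals.

(** * Sharp constants and auxiliary facts for the lower bound *)

Section LowerBound.
Context {R : realType}.
Implicit Types (mu k C z T n : R).

(** The mass of a half-line soliton piece with parameter T is this constant times Psi T. *)
Definition profile_mass_const mu k C : R := C `^ (mu + 1) / (mu * k).

Lemma profile_mass_const_gt0 mu k C : 0 < mu -> 0 < k -> 0 < C -> 0 < profile_mass_const mu k C.
Proof. by move=> *; rewrite divr_gt0 ?powR_gt0 ?mulr_gt0. Qed.

(** Hence [gns_value mu k T n] is a weighted geometric mean of [n] and the mass of the soliton piece
    with parameter T, and equals [n] when the two agree. *)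
Lemma gns_const_profile mu k C : 0 < mu -> 0 < k -> 0 < C -> C `^ mu = k ^+ 2 * (mu + 1) ->
  gns_const mu k = profile_mass_const mu k C `^ (mu / (mu + 1)).
Proof.
move=> mu0 k0 C0 CE; rewrite /gns_const /profile_mass_const [X in X * _](_ : _ = C `^ mu); last by rewrite CE mulrC.
have mk0 : 0 < mu * k by rewrite mulr_gt0.
have [lk E] := expR_total mk0; rewrite -E; have [c <-] := expR_total C0.
by rewrite !powR_expRE; congr expR; field; rewrite gt_eqF// addr_gt0.
Qed.

Lemma gns_value_linear mu k z l n : 0 < mu -> 0 <= n -> 0 <= l -> Psi mu z = l * n ->
  gns_value mu k z n = gns_const mu k * l `^ (mu / (mu + 1)) * n.
Proof.
move=> mu0 n_ge0 l0 E; have mu1 : 0 < mu + 1 by rewrite addr_gt0.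
move: n_ge0 E; rewrite le_eqVlt => /predU1P[<-|n0] E.
  by rewrite /gns_value powR0 ?mulr0// invr_eq0 gt_eqF.
rewrite /gns_value E (powRM _ l0 (ltW n0)); move: (gns_const mu k) => c.
rewrite -!mulrA; congr (_ * (_ * _)).
have [x <-] := expR_total n0.
by rewrite !powR_expRE; congr expR; field; rewrite gt_eqF.
Qed.

Lemma mass_gt0 (A B Ga Gb : R -> R) mu x : halfline 0 A B Ga Gb -> 0 < mu -> 0 < x ->
  sqsum A B x != 0 -> 0 < mass mu A B 0.
Proof.
move=> hl mu0 x0 r0; rewrite lt_def mass_ge0 andbT; apply/eqP => M0.
have cP := sqsum_powR_cont mu0 (hl_contA hl) (hl_contB hl).
have x1 : x < x + 1 by rewrite ltrDl.
have y0 : 0 <= x + 1 by rewrite addr_ge0// ltW.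
have I0 : \int[leb]_(t in `[0, x + 1]) (sqsum A B t `^ (mu + 1)) = 0.
  apply/eqP; rewrite eq_le Rintegral_ge0 ?andbT; last by move=> t _; exact: powR_ge0.
  have := mass_ge0 A B mu (x + 1); have := mass_split hl mu0 y0.
  by rewrite M0 => E h; move: (esym E) => /eqP; rewrite addr_eq0 => /eqP ->; rewrite oppr_le0.
have := zero_integral_cont cP (fun t => powR_ge0 _ _) I0 x0 x1.
by move/powR_eq0_eq0 => E; move: r0; rewrite E eqxx.
Qed.

Lemma eq_at_right_end (f g : R -> R) : continuous f -> continuous g ->
  (forall x, 0 < x -> f x = g x) -> forall x, 0 <= x -> f x = g x.
Proof.
move=> cf cg fg x; rewrite le_eqVlt => /predU1P[<-|]; last exact: fg.
have h1 : f x @[x --> (0 : R)^'+] --> f 0 by apply: cvg_at_right_filter; exact: cf.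
have h2 : f x @[x --> (0 : R)^'+] --> g 0.
  have : g x @[x --> (0 : R)^'+] --> g 0 by apply: cvg_at_right_filter; exact: cg.
  apply: cvg_trans; apply: near_eq_cvg; near=> t; apply/esym/fg.
  by near: t; exact: nbhs_right_gt.
exact: (cvg_unique _ h1 h2).
Unshelve. all: by end_near. Qed.

Lemma unit_circle_angle (a b : R) : a ^+ 2 + b ^+ 2 = 1 -> exists th : R, cos th = a /\ sin th = b.
Proof.
move=> ab.
have a1 : -1 <= a <= 1.
  rewrite -ler_norml -(@ler_pXn2r _ 2)// ?nnegrE// expr1n real_normK ?num_real//.
  by rewrite -ab lerDl sqr_ge0.
have sE : sin (acos a) = `|b|.
  by rewrite sin_acos// -ab addrAC subrr add0r sqrtr_sqr.
have [b0|b0] := leP 0 b.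
  by exists (acos a); rewrite acosK ?in_itv//= sE ger0_norm.
by exists (- acos a); rewrite cosN sinN acosK ?in_itv//= sE ltr0_norm// opprK.
Qed.

Lemma sech_profileN mu k x : sech_profile mu k (- x) = sech_profile mu k x.
Proof.
by rewrite /sech_profile mulrN; congr (_ `^ _); rewrite /cosh opprK addrC.
Qed.

Lemma tanhN x : tanh (- x) = - tanh x :> R.
Proof. by rewrite /tanh opprK [in X in _ / X]addrC -mulNr opprB. Qed.

End LowerBound.

(** * Minimality *)
Lemma le_budget (R : realDomainType) (a1 a2 g1 g2 e1 e2 b n : R) :
  a1 + g1 <= e1 -> a2 + g2 <= e2 -> e1 + e2 - b = n -> a1 + a2 = b -> g1 + g2 <= n.
Proof. by move=> h1 h2 <- <-; rewrite lerBrDr addrC addrACA lerD. Qed.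

Lemma eq_budget (R : realDomainType) (a1 a2 g1 g2 e1 e2 b n : R) :
  a1 + g1 <= e1 -> a2 + g2 <= e2 -> e1 + e2 - b = n -> a1 + a2 = b -> g1 + g2 = n ->
  a1 + g1 = e1 /\ a2 + g2 = e2.
Proof.
by move=> h1 h2 E1 E2 E3; split; apply/eqP; rewrite eq_le; apply/andP; split => //; lra.
Qed.

Lemma proportional (F : fieldType) (p q a b : F) : a + b != 0 -> p * b = q * a ->
  p = (p + q) / (a + b) * a /\ q = (p + q) / (a + b) * b.
Proof.
move=> ab E; split; apply: (mulIf ab); rewrite [RHS]mulrAC divfK// mulrDr [RHS]mulrDl.
  by rewrite E.
by rewrite -E.
Qed.

Section TwoHalfLines.
Context {R : realType}.
Context (A B Ga Gb A' B' Ga' Gb' : R -> R) (mu k t u s P S C rho n1 n2 D : R).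
Hypotheses (hl : halfline 0 A B Ga Gb) (hl' : halfline 0 A' B' Ga' Gb').
Hypotheses (mu0 : 0 < mu) (k0 : 0 < k) (t0 : 0 < t) (su : s < 1 + u)
  (uE : u = t ^+ 2) (t1 : t != 1)
  (E1 : P + u * S = s) (E2 : t `^ (2 * mu) * (1 - P ^+ 2) = 1 - S ^+ 2) (PS : 0 < P + S)
  (hP : -1 < P < 1) (hS : -1 < S < 1) (side : if 1 < t then 0 < P else 0 < S).
Hypotheses (C0 : 0 < C) (CE : C `^ mu = k ^+ 2 * (mu + 1)).
Hypotheses (r1 : sqsum A B 0 = rho) (r2 : sqsum A' B' 0 = u * rho).
Hypotheses (m1 : mass mu A B 0 = n1) (m2 : mass mu A' B' 0 = n2).
Hypothesis n0 : 0 < n1 + n2.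
Hypothesis nehari0 : energy k A B Ga Gb 0 + energy k A' B' Ga' Gb' 0 - k * s * rho = n1 + n2.
Hypothesis DE : profile_mass_const mu k C = D.

(** The function [h] has opposite signs at the ends T = 1 and z = 1 of the segment, which is
    nonempty by [su]. At a zero, Psi z = l n1 and Psi T = l n2, so the two half-line bounds add up
    to (D l)^(mu/(mu+1)) (n1 + n2) <= n1 + n2. Hence D l <= 1, that is D (Psi z + Psi T) <= n1 + n2,
    and [matching_min] concludes. *)
Lemma two_halflines_bound : D * (Psi mu P + Psi mu S) <= n1 + n2 /\
  (n1 + n2 <= D * (Psi mu P + Psi mu S) ->
   [/\ n1 = D * Psi mu P, n2 = D * Psi mu S,
       k * P * sqsum A B 0 + gns_value mu k P n1 = energy k A B Ga Gb 0 &
       k * S * sqsum A' B' 0 + gns_value mu k S n2 = energy k A' B' Ga' Gb' 0]).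
Proof.
have u0 : 0 < u by rewrite uE exprn_gt0.
have n1_ge0 : 0 <= n1 by rewrite -m1; exact: mass_ge0.
have n2_ge0 : 0 <= n2 by rewrite -m2; exact: mass_ge0.
have D0 : 0 < D by rewrite -DE; exact: profile_mass_const_gt0.
have th0 : 0 < mu / (mu + 1) by rewrite divr_gt0// addr_gt0.
pose T (z : R) : R := (s - z) / u.
pose h (z : R) : R := Psi mu z * n2 - Psi mu (T z) * n1.
have cT : continuous T.
  move=> z; apply: (@continuousM R R (fun z => s - z) (cst u^-1)); last exact: cst_continuous.
  by apply: (@continuousB R R R (cst s) id); [exact: cst_continuous|exact: cvg_id].
have cPsi := @Psi_cont R mu mu0.
have ch : continuous h.
  move=> z; apply: (@continuousB R R R (fun z => Psi mu z * n2) (fun z => Psi mu (T z) * n1)).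
    by apply: (@continuousM R R (Psi mu) (cst n2)); [exact: cPsi|exact: cst_continuous].
  apply: (@continuousM R R (fun z => Psi mu (T z)) (cst n1)); last exact: cst_continuous.
  by apply: (@continuous_comp R R R T (Psi mu)); [exact: cT|exact: cPsi].
have s1 : s - u <= 1 by move: su; lra.
have hs : 0 <= h (s - u).
  have -> : h (s - u) = Psi mu (s - u) * n2 - Psi mu 1 * n1.
    by rewrite /h /T opprB addrCA subrr addr0 divff// gt_eqF.
  by rewrite Psi1 mul0r subr0 mulr_ge0// Psi_ge0.
have T11 : T 1 <= 1 by rewrite /T ler_pdivrMr// mul1r; move: su; lra.
have h1 : h 1 <= 0 by rewrite /h Psi1 mul0r sub0r oppr_le0 mulr_ge0// Psi_ge0.
(* [h z] = 0 means that Psi z and Psi (T z) are in the ratio n1 : n2, so that the two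
   half-line bounds add up linearly in the masses. *)
have [|z] := @IVT R h (s - u) 1 0 s1 (continuous_subspaceT ch).
  by rewrite ge_min h1 orbT le_max hs.
rewrite in_itv/= => /andP[z1 z2] hz.
have uT : u * T z = s - z by rewrite /T mulrC divfK// gt_eqF.
have Tz1 : T z <= 1 by rewrite /T ler_pdivrMr// mul1r; lra.
set Tz := T z in uT Tz1 hz.
have [min1 min2] := matching_min mu0 t0 uE erefl t1 E1 E2 PS hP hS side uT z2 Tz1.
pose M := Psi mu z + Psi mu Tz.
have [l lE] : exists l : R, l = M / (n1 + n2) by exists (M / (n1 + n2)).
have PP0 : 0 < Psi mu P by apply: Psi_gt0 => //; case/andP: hP.
have PS0 : 0 < Psi mu S by apply: Psi_gt0 => //; case/andP: hS.
have M0 : 0 < M by apply: lt_le_trans min1; rewrite addr_gt0.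
have l0 : 0 < l by rewrite lE divr_gt0.
have hz' : Psi mu z * n2 = Psi mu Tz * n1 by apply/eqP; rewrite -subr_eq0 -[X in X == _]/(h z) hz.
have nn : n1 + n2 != 0 by rewrite gt_eqF.
have [l1 l2] : Psi mu z = l * n1 /\ Psi mu Tz = l * n2 by rewrite lE; exact: proportional.
have i1 := halfline_ineq hl mu0 k0 z2.
have i2 := halfline_ineq hl' mu0 k0 Tz1.
have G1 := gns_value_linear k mu0 n1_ge0 (ltW l0) l1.
have G2 := gns_value_linear k mu0 n2_ge0 (ltW l0) l2.
rewrite m1 r1 in i1; rewrite m2 r2 in i2.
have kzT : k * z * rho + k * Tz * (u * rho) = k * s * rho.
  have -> : s = z + u * Tz by rewrite uT; ring.
  ring.
have Gle : gns_value mu k z n1 + gns_value mu k Tz n2 <= n1 + n2.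
  exact: le_budget i1 i2 nehari0 kzT.
have CD := gns_const_profile mu0 k0 C0 CE; rewrite DE in CD.
have Dl : (D * l) `^ (mu / (mu + 1)) <= 1.
  rewrite powRM ?(ltW D0) ?(ltW l0)// -CD -(ler_pM2r n0) mul1r.
  by apply: le_trans Gle; rewrite G1 G2 -mulrDr.
have Dl1 : D * l <= 1.
  rewrite leNgt; apply/negP => h2.
  have : 1 `^ (mu / (mu + 1)) < (D * l) `^ (mu / (mu + 1)).
    apply: (gt0_ltr_powR th0); rewrite ?nnegrE ?ler01//.
    by rewrite mulr_ge0 ?(ltW D0) ?(ltW l0).
  by rewrite powR1 ltNge Dl.
have DM : D * M <= n1 + n2.
  have : D * l * (n1 + n2) <= 1 * (n1 + n2) by rewrite ler_pM2r.
  by rewrite lE mulrA divfK// mul1r.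
split; first by apply: le_trans DM; rewrite ler_pM2l.
move=> nle.
have DMe : D * (Psi mu P + Psi mu S) = D * M.
  by apply/eqP; rewrite eq_le ler_pM2l// min1/=; exact: le_trans DM nle.
have Me : Psi mu P + Psi mu S = M by apply: (mulfI (lt0r_neq0 D0)).
have zP := min2 Me.
have TS : Tz = S by apply: (mulfI (lt0r_neq0 u0)); rewrite uT zP -E1; ring.
have nE : n1 + n2 = D * M by apply/eqP; rewrite eq_le DM andbT -DMe.
have lD : D * l = 1 by rewrite lE mulrA -nE divff.
have Dl' (x : R) : D * (l * x) = x by rewrite mulrA lD mul1r.
have gE : gns_value mu k z n1 + gns_value mu k Tz n2 = n1 + n2.
  by rewrite G1 G2 -mulrDr CD -powRM ?(ltW D0) ?(ltW l0)// lD powR1 mul1r.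
have [e1 e2] := eq_budget i1 i2 nehari0 kzT gE.
by rewrite -zP -TS l1 l2 !Dl' r1 r2.
Qed.

End TwoHalfLines.

(** * The candidate made of two soliton pieces *)

Section HalfLineRestriction.
Context {R : realType}.
Implicit Types f g : R -> R.

Lemma L1_open_half f : L1 `[0, +oo[ f -> L1 `]0, +oo[ f.
Proof. by apply: L1S => // x /=; rewrite !in_itv/= !andbT => /ltW. Qed.

Lemma L1_reflected_half f g : (forall x, g x = f (- x)) -> L1 `[0, +oo[ f -> L1 `]-oo, 0[ g.
Proof.
move=> fg /L1_open_half fi; rewrite (_ : g = fun x => f (- x)); last exact/funext.
apply: (@L1_opp R f `]0, +oo[%classic) fi => //.
by move=> x /=; rewrite !in_itv/= andbT oppr_gt0.
Qed.

End HalfLineRestriction.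

Section ScaledProfile.
Context {R : realType} (mu k c x0 : R).
Hypothesis mu0 : 0 < mu.

Lemma is_derive_scaled_profile (x : R) :
  is_derive x (1:R) (fun x => c * sech_profile mu k (x + x0))
    (c * (- k * tanh (mu * k * (x + x0)) * sech_profile mu k (x + x0))).
Proof.
by apply: (@is_deriveZ R R R (fun x => sech_profile mu k (x + x0)) c); exact: profile_derive.
Qed.

Lemma scaled_profile_derivative_cont :
  continuous (fun x => c * (- k * tanh (mu * k * (x + x0)) * sech_profile mu k (x + x0))).
Proof.
move=> x; apply: (@continuousM R R (cst c)
  (fun x => - k * tanh (mu * k * (x + x0)) * sech_profile mu k (x + x0))).
  exact: cst_continuous.
exact: profile_derivative_cont.
Qed.

Lemma scaled_profile_cont : continuous (fun x => c * sech_profile mu k (x + x0)).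
Proof.
move=> x; apply: (@continuousM R R (cst c) (fun x => sech_profile mu k (x + x0))).
  exact: cst_continuous.
exact: profile_cont.
Qed.

(** The zero imaginary part is written as a multiple of the profile to fit
    [profile_halfline_values]; the values at 0 come from continuity. *)
Lemma real_profile_parts (u : R -> R[i]) (A B : R -> R) : continuous A -> continuous B ->
  (forall x, 0 < x -> u x = (c * sech_profile mu k (x + x0))%:C) ->
  (forall x, 0 < x -> u x = A x +i* B x) -> forall x, 0 <= x ->
  A x = c * sech_profile mu k (x + x0) /\ B x = 0 * sech_profile mu k (x + x0).
Proof.
move=> cA cB uE uAB.
have AE (x : R) : 0 < x -> A x = c * sech_profile mu k (x + x0).
  by move=> x_gt0; have := uAB x x_gt0; rewrite uE// => -[].
have BE (x : R) : 0 < x -> B x = 0.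
  by move=> x_gt0; have := uAB x x_gt0; rewrite uE// => -[].
move=> x x_ge0; split; first exact: (eq_at_right_end cA scaled_profile_cont AE).
by rewrite mul0r (eq_at_right_end cB (@cst_continuous _ _ 0) BE).
Qed.

End ScaledProfile.

Section ProfilePair.
Context {R : realType} (mu k v tau sg amp a b : R) (u : R -> R[i]).
Hypotheses (mu0 : 0 < mu) (k0 : 0 < k) (amp0 : 0 < amp)
  (ampE : (amp ^+ 2) `^ mu = k ^+ 2 * (mu + 1)) (sg1 : sg ^+ 2 = 1).
Hypothesis jump : sg * (amp * sech_profile mu k b) = tau * (amp * sech_profile mu k a).
Hypothesis uneg : forall x, x < 0 -> u x = (amp * sech_profile mu k (x + a))%:C.
Hypothesis upos : forall x, 0 < x -> u x = (sg * (amp * sech_profile mu k (x + b)))%:C.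

Let C0 : 0 < amp ^+ 2. Proof. exact: exprn_gt0. Qed.

Let upos' x : 0 < x -> u x = ((sg * amp) * sech_profile mu k (x + b))%:C.
Proof. by move=> x0; rewrite (upos x0) mulrA. Qed.

Let uneg' x : 0 < x -> u (- x) = (amp * sech_profile mu k (x + - a))%:C.
Proof. by rewrite -oppr_lt0 => /uneg ->; rewrite -sech_profileN opprD opprK. Qed.

Lemma profile_pair_H1_right : H1 Rpos u.
Proof.
have mI : measurable (Rpos : set (measurableTypeR R)) by exact: measurable_itv.
apply: (H1_smooth mI _ _ (is_derive_scaled_profile k (sg * amp) b mu0)
  (@scaled_profile_derivative_cont R mu k (sg * amp) b mu0)).
- exact: interval_open.
- by move=> x; rewrite /Rpos/= in_itv/= andbT => /upos'.
- exact: L1_open_half (profile_sqr_L1 b mu0 k0 C0 ampE (sg * amp)).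
- exact: L1_open_half (profile_derivative_sqr_L1 b mu0 k0 C0 ampE (sg * amp)).
Qed.

Lemma profile_pair_H1_left : H1 Rneg u.
Proof.
have mI : measurable (Rneg : set (measurableTypeR R)) by exact: measurable_itv.
apply: (H1_smooth mI _ _ (is_derive_scaled_profile k amp a mu0)
  (@scaled_profile_derivative_cont R mu k amp a mu0)).
- exact: interval_open.
- by move=> x; rewrite /Rneg/= in_itv/= => /uneg.
- apply: L1_reflected_half (profile_sqr_L1 (- a) mu0 k0 C0 ampE amp) => x.
  have := sech_profileN mu k (x + a); rewrite opprD /= => ->; exact: erefl.
- apply: L1_reflected_half (profile_derivative_sqr_L1 (- a) mu0 k0 C0 ampE amp) => x.
  rewrite -(opprD x a) (sech_profileN mu k (x + a)) (mulrN (mu * k)) (tanhN (mu * k * (x + a))).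
  move: (tanh _) (sech_profile _ _ _) => y z; ring.
Qed.

Lemma profile_pair_H1tau : H1tau tau u.
Proof.
split; [exact: profile_pair_H1_left|exact: profile_pair_H1_right|].
have [A [B [Ga [Gb [hl uAB -> _ _]]]]] := H1_left profile_pair_H1_left.
have [A' [B' [Ga' [Gb' [hl' uAB' -> _ _]]]]] := H1_right profile_pair_H1_right.
have [-> ->] := real_profile_parts mu0 (hl_contA hl) (hl_contB hl) uneg' uAB (lexx _).
have [-> ->] := real_profile_parts mu0 (hl_contA hl') (hl_contB hl') upos' uAB' (lexx _).
rewrite !add0r (sech_profileN mu k a) -(mulrA sg) jump !mul0r.
by apply/eqP; rewrite eq_complex/= !mulr0 !mul0r subr0 addr0 !eqxx.
Qed.

(** The hypothesis is the jump condition on the derivative at 0. Each half-line energy exceeds its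
    mass by a boundary term, and it makes the two terms add up to v |u(0-)|^2. *)
Lemma profile_pair_values : k * (tanh (mu * k * b) * tau ^+ 2 - tanh (mu * k * a)) = v ->
  nehari mu v (k ^+ 2) u = 0 /\
  action mu v (k ^+ 2) u = (1 / 2 - 1 / (2 * mu + 2)) *
    (profile_mass_const mu k (amp ^+ 2) * (Psi mu (- tanh (mu * k * a)) + Psi mu (tanh (mu * k * b)))).
Proof.
move=> vE.
have [A [B [Ga [Gb [A' [B' [Ga' [Gb' [hl hl' [uAB uAB'] [Aj Bj]]]]]]]]]] :=
  halfline_decomposition v k mu0 profile_pair_H1tau.
have L := real_profile_parts mu0 (hl_contA hl) (hl_contB hl) uneg' uAB.
have L' := real_profile_parts mu0 (hl_contA hl') (hl_contB hl') upos' uAB'.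
have c1 : amp ^+ 2 + 0 ^+ 2 = amp ^+ 2 by rewrite expr0n addr0.
have c2 : (sg * amp) ^+ 2 + 0 ^+ 2 = amp ^+ 2 by rewrite expr0n addr0 exprMn sg1 mul1r.
have [] := profile_halfline_values mu0 k0 C0 ampE hl c1
  (fun x hx => (L x hx).1) (fun x hx => (L x hx).2).
have [] := profile_halfline_values mu0 k0 C0 ampE hl' c2
  (fun x hx => (L' x hx).1) (fun x hx => (L' x hx).2).
rewrite !add0r mulrN tanhN => M' E' M E /= [-> ->].
rewrite E E' M M' /profile_mass_const.
have -> : sqsum A' B' 0 = tau ^+ 2 * sqsum A B 0 by rewrite /sqsum Aj Bj; ring.
rewrite -vE; move: (_ `^ (mu + 1) / _) (Psi mu _) (Psi mu _) (sqsum A B 0) => q1 q2 q3 q4.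
split; first ring.
by rewrite [RHS]mulrBl; congr (_ * _ - _ * _); ring.
Qed.

End ProfilePair.

Lemma equality_amplitude (R : realType) (A B Ga Gb : R -> R) (mu k x0 C : R) :
  halfline 0 A B Ga Gb -> 0 < mu -> 0 < k -> 0 < C ->
  let T0 := tanh (mu * k * x0) in
  mass mu A B 0 = profile_mass_const mu k C * Psi mu T0 ->
  k * T0 * sqsum A B 0 + gns_value mu k T0 (mass mu A B 0) = energy k A B Ga Gb 0 ->
  exists cA cB : R, [/\ cA ^+ 2 + cB ^+ 2 = C,
    forall x, 0 <= x -> A x = cA * sech_profile mu k (x + x0) &
    forall x, 0 <= x -> B x = cB * sech_profile mu k (x + x0)].
Proof.
move=> hl mu0 k0 C0 T0 mE heq.
have P0 : 0 < Psi mu T0 by apply: Psi_gt0 => //; case/andP: (tanh_bnd (mu * k * x0)).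
have N0 : 0 < mass mu A B 0 by rewrite mE mulr_gt0// profile_mass_const_gt0.
have [cA [cB [cE AE BE]]] := equality_profile hl mu0 k0 N0 heq.
exists cA, cB; split => //.
have mu1 : 0 < mu + 1 by rewrite addr_gt0.
apply: (powR_injective mu1); rewrite ?nnegrE ?addr_ge0 ?sqr_ge0 ?(ltW C0)//.
rewrite cE mE /profile_mass_const.
move: (lt0r_neq0 P0) (lt0r_neq0 mu0) (lt0r_neq0 k0); rewrite -/T0.
move: (Psi mu T0) (C `^ (mu + 1)) => p c p0 m0 q0.
by field; rewrite p0 m0 q0.
Qed.

Lemma complex_neq0_sqr (R : rcfType) (a b : R) : a +i* b != 0 -> a ^+ 2 + b ^+ 2 != 0.
Proof.
apply: contraNN; rewrite paddr_eq0 ?sqr_ge0// !sqrf_eq0 => /andP[/eqP -> /eqP ->].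
by rewrite eq_complex/= !eqxx.
Qed.

Lemma action_coefficient_gt0 (R : realFieldType) (mu : R) : 0 < mu ->
  0 < 1 / 2 - 1 / (2 * mu + 2).
Proof.
move=> mu0; have mu2 : 0 < 2 * mu by rewrite mulr_gt0.
by rewrite !div1r subr_gt0 ltf_pV2 ?posrE ?ltrDr// ltr_wpDl// ltW.
Qed.

Lemma rotated_real (R : rcfType) (a b c p : R) : c != 0 ->
  (a * p) +i* (b * p) = ((a / c) +i* (b / c)) * (c * p)%:C.
Proof.
move=> c0; apply/eqP; rewrite eq_complex/= !mulr0 subr0 add0r.
by rewrite !mulrA !divfK// !eqxx.
Qed.

Lemma cancel_common_factor (R : idomainType) (x y c p q : R) : c != 0 ->
  x * (c * p) = y * (c * q) -> y * q = x * p.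
Proof. by move=> c0 E; apply: (mulfI c0); rewrite mulrCA -E mulrCA. Qed.

Section Minimality.
Context {R : realType} (mu k v tau t sg amp a b P S D : R).
Hypotheses (mu0 : 0 < mu) (k0 : 0 < k) (t0 : 0 < t) (t1 : t != 1)
  (tauE : tau ^+ 2 = t ^+ 2) (amp0 : 0 < amp)
  (ampE : (amp ^+ 2) `^ mu = k ^+ 2 * (mu + 1)).
Hypothesis jump : sg * (amp * sech_profile mu k b) = tau * (amp * sech_profile mu k a).
Hypotheses (PE : P = tanh (mu * k * - a)) (SE : S = tanh (mu * k * b)).
Hypotheses (vk : v / k < 1 + t ^+ 2) (E1 : P + t ^+ 2 * S = v / k)
  (E2 : t `^ (2 * mu) * (1 - P ^+ 2) = 1 - S ^+ 2) (PS : 0 < P + S)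
  (side : if 1 < t then 0 < P else 0 < S).
Hypothesis DE : profile_mass_const mu k (amp ^+ 2) = D.

Let hP : -1 < P < 1. Proof. by rewrite PE tanh_bnd. Qed.
Let hS : -1 < S < 1. Proof. by rewrite SE tanh_bnd. Qed.

Let jump' : tau * sech_profile mu k a = sg * sech_profile mu k b.
Proof. exact: cancel_common_factor (lt0r_neq0 amp0) jump. Qed.

Let propagate (c c' : R) : c' * sech_profile mu k (0 + b) = tau * (c * sech_profile mu k (0 + - a)) ->
  c' = sg * c.
Proof.
rewrite !add0r sech_profileN mulrCA jump' => h.
by apply: (mulIf (lt0r_neq0 (sech_profile_gt0 mu k b))); rewrite h mulrCA mulrA.
Qed.

Lemma nehari_lower_bound w : nehari_set mu v tau (k ^+ 2) w ->
  (1 / 2 - 1 / (2 * mu + 2)) * (D * (Psi mu P + Psi mu S)) <= action mu v (k ^+ 2) w /\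
  (action mu v (k ^+ 2) w <= (1 / 2 - 1 / (2 * mu + 2)) * (D * (Psi mu P + Psi mu S)) ->
   exists theta : R, forall x, x != 0 -> w x = (cos theta +i* sin theta) *
     (if x < 0 then (amp * sech_profile mu k (x + a))%:C
      else (sg * (amp * sech_profile mu k (x + b)))%:C)).
Proof.
move=> [wH [x x0 wx] wN].
have [A [B [Ga [Gb [A' [B' [Ga' [Gb' [hl hl' [wAB wAB'] [Aj Bj]]]]]]]]]] :=
  halfline_decomposition v k mu0 wH.
cbv zeta; rewrite wN; set N := mass _ _ _ _ + _; set Q := _ - v * _ => -[/esym/eqP].
rewrite subr_eq0 => /eqP QN; rewrite QN -mulrBl => ->.
have coef0 := action_coefficient_gt0 mu0.
rewrite !(ler_pM2l coef0).
have m1 : 0 <= mass mu A B 0 by exact: mass_ge0.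
have m2 : 0 <= mass mu A' B' 0 by exact: mass_ge0.
have N0 : 0 < N.
  move: x0; rewrite neq_lt => /orP[x0|x0].
    have y0 : 0 < - x by rewrite oppr_gt0.
    have := wAB (- x) y0; rewrite opprK => E; move: wx; rewrite E => /complex_neq0_sqr h.
    exact: ltr_pwDl (mass_gt0 hl mu0 y0 h) m2.
  move: wx; rewrite (wAB' x x0) => /complex_neq0_sqr h.
  exact: ltr_wpDl m1 (mass_gt0 hl' mu0 x0 h).
have rE : sqsum A' B' 0 = t ^+ 2 * sqsum A B 0 by rewrite -tauE /sqsum Aj Bj; ring.
have QE : energy k A B Ga Gb 0 + energy k A' B' Ga' Gb' 0 - k * (v / k) * sqsum A B 0 = N.
  rewrite [k * _]mulrC (divfK (lt0r_neq0 k0)); exact: QN.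
have [bound eqc] := two_halflines_bound hl hl' mu0 k0 t0 vk erefl t1 E1 E2 PS hP
  hS side (exprn_gt0 2 amp0) ampE erefl rE erefl erefl N0 QE DE.
split; first exact: bound.
move=> /eqc[M1 M2 heq1 heq2]; rewrite -DE PE in M1; rewrite -DE SE in M2.
rewrite PE in heq1; rewrite SE in heq2.
have [cA [cB [cC AE BE]]] := equality_amplitude hl mu0 k0 (exprn_gt0 2 amp0) M1 heq1.
have [cA' [cB' [_ AE' BE']]] := equality_amplitude hl' mu0 k0 (exprn_gt0 2 amp0) M2 heq2.
(* The traces at 0 are linked by tau, so both sides carry the same phase. *)
have cAE : cA' = sg * cA.
  by apply: propagate; rewrite -(AE' 0 (lexx _)) -(AE 0 (lexx _)).
have cBE : cB' = sg * cB.
  by apply: propagate; rewrite -(BE' 0 (lexx _)) -(BE 0 (lexx _)).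
have [th [thA thB]] : exists th : R, cos th = cA / amp /\ sin th = cB / amp.
  apply: unit_circle_angle; rewrite !expr_div_n -mulrDl cC.
  exact: divff (expf_neq0 2 (lt0r_neq0 amp0)).
exists th => y; rewrite neq_lt thA thB => /orP[y0|y0].
  have y1 : 0 < - y by rewrite oppr_gt0.
  have := wAB (- y) y1; rewrite opprK (AE _ (ltW y1)) (BE _ (ltW y1)) -opprD sech_profileN y0 => ->.
  exact: rotated_real (lt0r_neq0 amp0).
rewrite ltNge (ltW y0) (wAB' y y0) (AE' _ (ltW y0)) (BE' _ (ltW y0)) cAE cBE.
by rewrite (mulrCA sg amp) -(rotated_real _ _ _ (lt0r_neq0 amp0)) (mulrC sg cA) (mulrC sg cB) !mulrA.
Qed.

End Minimality.

(** * The explicit parameters and the jump condition *)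

Section StationaryParameters.
Context {R : realType}.
Implicit Types mu k t s v omega a b P S : R.

Lemma threshold_sqrt v t omega : 0 < v -> v ^+ 2 / (t ^+ 2 + 1) ^+ 2 < omega ->
  [/\ 0 < omega, 0 < Num.sqrt omega & v / Num.sqrt omega < 1 + t ^+ 2].
Proof.
move=> v0 h; have t2 : 0 < t ^+ 2 + 1 by rewrite ltr_wpDl ?sqr_ge0.
have o0 : 0 < omega by apply: le_lt_trans h; rewrite divr_ge0 ?sqr_ge0.
have k0 : 0 < Num.sqrt omega by rewrite sqrtr_gt0.
split => //; rewrite ltr_pdivrMr// addrC -ltr_pdivrMl//.
rewrite -(ltr_pXn2r (n := 2))// ?nnegrE ?mulr_ge0 ?invr_ge0 ?(ltW t2) ?(ltW v0) ?(ltW k0)//.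
by rewrite sqr_sqrtr ?(ltW o0)// mulrC expr_div_n.
Qed.

Lemma Ttilde_matching mu v t omega : 0 < mu -> 0 < v -> 0 < t -> t != 1 ->
  v ^+ 2 / (t ^+ 2 + 1) ^+ 2 < omega ->
  let s := v / Num.sqrt omega in
  let P := - Ttilde_minus mu v t omega in
  let S := Ttilde_plus mu v t omega in
  [/\ P + t ^+ 2 * S = s, t `^ (2 * mu) * (1 - P ^+ 2) = 1 - S ^+ 2, 0 < P + S,
      -1 < P < 1 & -1 < S < 1] /\ (if 1 < t then 0 < P else 0 < S).
Proof.
move=> mu0 v0 t0 t1 homega s P S.
have [om0 k0 st] := threshold_sqrt v0 homega.
have tc := matching_regime mu0 t0 erefl t1.
have tD (r : R) (n : nat) : t `^ (r + n%:R) = t `^ r * t ^+ n.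
  rewrite powRD; last by rewrite (gt_eqF t0) implybT.
  by rewrite powR_mulrn// ltW.
have s2 : s ^+ 2 = v ^+ 2 / omega by rewrite expr_div_n sqr_sqrtr// ltW.
set c := t `^ (2 * mu) in tc.
have c0 : 0 < c by rewrite powR_gt0.
pose D := c * (t ^+ 2) ^+ 2 - 1.
have t4 : t `^ (2 * mu + 4) - 1 = D by rewrite tD /D -exprM.
have Dc : 0 <= D * (c - 1) /\ D != 0.
  have u4 : (t ^+ 2) ^+ 2 = t ^+ 4 by rewrite -exprM.
  case/orP: tc => /andP[h1 h2].
    have : 1 < c * (t ^+ 2) ^+ 2 by rewrite u4 mulr_egt1// exprn_egt1.
    by rewrite /D -subr_gt0 => h; rewrite mulr_ge0 ?(ltW h) ?gt_eqF// subr_ge0 ltW.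
  have : c * (t ^+ 2) ^+ 2 < 1.
    by rewrite u4 mulr_ilt1 ?exprn_ge0 ?exprn_ilt1 ?(ltW c0) ?(ltW t0).
  rewrite /D -subr_lt0 => h; rewrite mulr_le0 ?(ltW h) ?lt_eqF//.
  by rewrite subr_le0 ltW.
have AE : A_coef mu v t omega = s ^+ 2 * c + D * (c - 1) by rewrite /A_coef t4 s2.
have A0 : 0 <= A_coef mu v t omega.
  by rewrite AE addr_ge0 ?Dc.1// mulr_ge0 ?sqr_ge0// ltW.
have PD : P * D = t ^+ 2 * Num.sqrt (A_coef mu v t omega) - s.
  rewrite /P /Ttilde_minus t4 mulNr mulrAC div1r mulVf ?Dc.2// mul1r opprB.
  exact: erefl.
have SD : S * D = c * t ^+ 2 * s - Num.sqrt (A_coef mu v t omega).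
  rewrite /S /Ttilde_plus t4 mulrAC div1r mulVf ?Dc.2// mul1r tD.
  exact: erefl.
have s0 : 0 < s by rewrite divr_gt0.
apply: (matching_algebra t0 c0 s0 st (sqrtr_ge0 _) erefl erefl _ tc PD SD).
by rewrite sqr_sqrtr// AE.
Qed.

Lemma amplitude_powR mu omega : 0 < mu -> 0 < omega ->
  ((omega * (mu + 1)) `^ (1 / (2 * mu)) ^+ 2) `^ mu = omega * (mu + 1).
Proof.
move=> mu0 o0; have om : 0 < omega * (mu + 1) by rewrite mulr_gt0// addr_gt0.
rewrite -powR_mulrn ?powR_ge0// -!powRrM.
by rewrite div1r mulVf ?powRr1 ?(ltW om)// gt_eqF// mulr_gt0.
Qed.

(** The hypothesis raised to the power 1/mu is the square of the conclusion, because t^(2 mu / mu) =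
    t^2. *)
Lemma sech_profile_ratio mu k t a b : 0 < mu -> 0 < t ->
  t `^ (2 * mu) * (1 - tanh (mu * k * a) ^+ 2) = 1 - tanh (mu * k * b) ^+ 2 ->
  sech_profile mu k b = t * sech_profile mu k a.
Proof.
move=> mu0 t0 E.
have sq (x : R) : sech_profile mu k x ^+ 2 = wt mu (tanh (mu * k * x)).
  by have := wt_Th k 0 mu0 x; rewrite addr0 => ->.
have sle (x : R) : 0 <= sech_profile mu k x by rewrite ltW// sech_profile_gt0.
apply/eqP; rewrite -(@eqrXn2 _ 2)// ?mulr_ge0 ?(ltW t0)//.
have tb (x : R) : -1 <= tanh x <= 1 by have /andP[] := tanh_bnd x; lra.
rewrite exprMn !sq !wtE ?tb// -E powRM ?powR_ge0//; last first.
  by have := tanh_bnd (mu * k * a); rewrite -subr1_sqr_gt0 => /ltW.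
rewrite -powRrM (_ : 2 * mu * mu^-1 = 2%:R); last by rewrite mulfK// gt_eqF.
by rewrite powR_mulrn// ltW.
Qed.

End StationaryParameters.

(* The two tanh equations determine xminus and xplus; their solvability is part
   of the claim.  Uniqueness of the minimizer is up to a constant phase. *)
Theorem theorem4p4 (R : realType) (mu v tau omega : R)
  (hmu : 0 < mu) (hv : 0 < v)
  (htau0 : tau != 0) (htau1 : tau != 1) (htauN1 : tau != -1)
  (homega : v ^+ 2 / (tau ^+ 2 + 1) ^+ 2 < omega) :
  exists xminus xplus : R,
    [/\ tanh (mu * Num.sqrt omega * xminus) = Ttilde_minus mu v `|tau| omega,
        tanh (mu * Num.sqrt omega * xplus) = Ttilde_plus mu v `|tau| omega,
        ground_state mu v tau omega (u_Ttilde mu tau omega xminus xplus)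
      & forall w : R -> R[i], ground_state mu v tau omega w ->
          exists theta : R, forall x : R, x != 0 ->
            w x = (cos theta +i* sin theta)
                  * u_Ttilde mu tau omega xminus xplus x].
Proof.
(* The functionals see tau only through |u(0+)|^2 = tau^2 |u(0-)|^2, so the algebra is done with
   [t]; the sign returns in [jump]. *)
set t := `|tau|; set k := Num.sqrt omega.
have t0 : 0 < t by rewrite normr_gt0.
have t1 : t != 1.
  by rewrite /t; case: (ger0P tau) => _; rewrite ?eqr_oppLR.
have tauE : tau ^+ 2 = t ^+ 2 by rewrite /t real_normK ?num_real.
rewrite tauE in homega.
have [om0 k0 vk] := threshold_sqrt hv homega.
have kE : k ^+ 2 = omega by rewrite sqr_sqrtr// ltW.
have [[E1 E2 PS hP hS] side] := Ttilde_matching hmu hv t0 t1 homega.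
have mk0 : mu * k != 0 by rewrite gt_eqF// mulr_gt0.
have hTm : -1 < Ttilde_minus mu v t omega < 1 by move: hP; rewrite ltrNl opprK ltrNl andbC.
have [ym ymE] := tanh_surj hTm; have [yp ypE] := tanh_surj hS.
pose a := ym / (mu * k); pose b := yp / (mu * k).
have aE : tanh (mu * k * a) = Ttilde_minus mu v t omega by rewrite /a mulrC divfK.
have bE : tanh (mu * k * b) = Ttilde_plus mu v t omega by rewrite /b mulrC divfK.
exists a, b; rewrite aE bE.
pose amp := (omega * (mu + 1)) `^ (1 / (2 * mu)).
have amp0 : 0 < amp by rewrite powR_gt0// mulr_gt0// addr_gt0.
have ampE : (amp ^+ 2) `^ mu = k ^+ 2 * (mu + 1) by rewrite kE amplitude_powR.
have sg1 : Num.sg tau ^+ 2 = 1 by rewrite sqr_sg htau0.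
have ratio : sech_profile mu k b = t * sech_profile mu k a.
  by apply: sech_profile_ratio => //; rewrite aE bE -E2 sqrrN.
have jump : Num.sg tau * (amp * sech_profile mu k b) = tau * (amp * sech_profile mu k a).
  by rewrite ratio mulrCA mulrA -mulrA [in RHS](numEsg tau) -/t; ring.
pose u := u_Ttilde mu tau omega a b.
have uneg (x : R) : x < 0 -> u x = (amp * sech_profile mu k (x + a))%:C.
  by rewrite /u /u_Ttilde => ->.
have upos (x : R) : 0 < x -> u x = (Num.sg tau * (amp * sech_profile mu k (x + b)))%:C.
  by move=> x0; rewrite /u /u_Ttilde ltNge (ltW x0).
have PE : - Ttilde_minus mu v t omega = tanh (mu * k * - a) by rewrite mulrN tanhN aE.
have uH := profile_pair_H1tau hmu k0 amp0 ampE jump uneg upos.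
have vE : k * (tanh (mu * k * b) * tau ^+ 2 - tanh (mu * k * a)) = v.
  rewrite aE bE tauE addrC (mulrC _ (t ^+ 2)) E1 mulrC; exact: divfK (lt0r_neq0 k0) _.
have [] := profile_pair_values hmu k0 amp0 ampE sg1 jump uneg upos vE.
rewrite aE bE kE => un ua.
have lb := nehari_lower_bound hmu k0 t0 t1 tauE amp0 ampE jump PE (esym bE) vk E1 E2 PS side erefl.
rewrite kE in lb.
have uS : nehari_set mu v tau omega u.
  split; [exact: uH| |exact: un].
  exists 1; first exact: oner_neq0.
  rewrite (upos 1 ltr01) eq_complex negb_and; apply/orP; left.
  apply: mulf_neq0; first by rewrite sgr_eq0.
  exact: mulf_neq0 (lt0r_neq0 amp0) (lt0r_neq0 (sech_profile_gt0 _ _ _)).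
split; [exact: erefl|exact: erefl| |].
- split; [exact: uS|by move=> w wS; rewrite ua; exact: (lb w wS).1].
- move=> w [wS wmin]; have [_] := lb w wS; rewrite -ua => /(_ (wmin u uS))[th thE].
  exists th; exact: thE.
Qed.
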